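(* The groups $\widetilde{\mathcal G}$ and $\widetilde{\mathcal B}$ embed into the group $\mathcal D(\mathbb Q_2)$ of dilations of the field $\mathbb Q_2$ of $2$-adic numbers. Moreover, these embeddings can be taken so that, when $\mathcal D(\mathbb Q_2)$ is identified with $\mathrm{Aut}(\widetilde T_3)_{\omega}$, the images of these embeddings act transitively on (the vertices of) $\widetilde T_3$ and their closures are scale groups acting $2$-transitively on the punctured boundary $\partial_{\omega}\widetilde T_3=\partial\widetilde T_3\setminus\{\omega\}$.
   Context: The group $\widetilde{\mathcal G}$. Let $\sigma$ be the substitution $a\mapsto aca$, $b\mapsto d$, $c\mapsto b$, $d\mapsto c$. Then $$\widetilde{\mathcal G}=\langle a,b,c,d,t\mid a^2,b^2,c^2,d^2,bcd,(ad)^4,(adacac)^4,\ tst^{-1}\sigma(s)^{-1},\ s\in\{a,b,c,d\}\rangle.$$ It is the ascending HNN extension, by the injective endomorphism induced by $\sigma$, of the group $\mathcal G=\langle a,b,c,d\rangle$ of automorphisms of the rooted binary tree $T_2$ given by the wreath recursion $a=(1,1)\varepsilon$, $b=(a,c)$, $c=(a,d)$, $d=(1,b)$. The group $\widetilde{\mathcal B}$. Let $\mathcal B=\langle a,b\rangle$ be the group of automorphisms of $T_2$ given by the wreath recursion $a=(b,1)\varepsilon$, $b=(a,1)$ (Basilica group). The assignment $a\mapsto b$, $b\mapsto a^2$ extends to an injective endomorphism $\sigma_{\mathcal B}$ of $\mathcal B$, and $\widetilde{\mathcal B}=\langle \mathcal B,t\mid \text{relations in }\mathcal B,\ tgt^{-1}=\sigma_{\mathcal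 B}(g),\ g\in\mathcal B\rangle$. Here $T_2$ has vertex set $\{0,1\}^*$; $g=(g_0,g_1)\pi$ with $\pi\in\mathrm{Sym}(\{0,1\})$ means $g(xw)=\pi(x)g_x(w)$; $\varepsilon$ is the nontrivial permutation of $\{0,1\}$, omitted trivial permutations are the identity, and products are read left to right, $gh(y)=h(g(y))$. A dilation of a metric space $(Y,d_Y)$ is a homeomorphism $f$ of $Y$ for which there is $\lambda>0$ with $d_Y(f(x),f(y))=\lambda d_Y(x,y)$ for all $x,y$; $\mathbb Q_2$ has the $2$-adic metric. $\widetilde T_3$ is the $3$-regular tree. An end is an equivalence class of infinite geodesic rays (equivalent if they eventually coincide), $\partial\widetilde T_3$ is the set of ends, $\omega$ is a fixed end, and $\mathrm{Aut}(\widetilde T_3)_\omega$ is the group of automorphisms of $\widetilde T_3$ fixing $\omega$, with the topology of pointwise convergence on vertices. Identification: realize $\widetilde T_3=\bigcup_{n\ge0}T_2^{(n)}$ as the union of copies of $T_2$, with $T_2^{(n)}$ embedded in $T_2^{(n+1)}$ by $v\mapsto 0v$, and $\omega$ the end of the ray formed by the roots of the $T_2^{(n)}$. A vertex at level $k$ of $T_2^{(n)}$ has level $k-n\in\mathbb Z$. Points of $\partial_\omega\widetilde T_3$ correspond to bi-infinite sequences $(x_i)_{i\in\mathbb Z}$ over $\{0,1\}$ with $x_i=0$ for all sufficiently negative $i$ ($x_{i+1}$ being the letter chosen in going from level $i$ to level $i+1$ along the geodesic from $\omega$), hence to elements $\sum_i x_i2^i$ of $\mathbb Q_2$. Under this bijection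 the action of $\mathrm{Aut}(\widetilde T_3)_\omega$ on $\partial_\omega\widetilde T_3$ identifies $\mathrm{Aut}(\widetilde T_3)_\omega$ with $\mathcal D(\mathbb Q_2)$. A scale group is a closed vertex-transitive subgroup of $\mathrm{Aut}(\widetilde T_{d+1})$ fixing an end (here $d=2$). An action is $2$-transitive if it is transitive on ordered pairs of distinct points. *)

(* Defs.v *)
From HB Require Import structures.
From mathcomp Require Import all_boot all_order all_algebra.
From mathcomp Require Import generic_quotient ring_quotient ring.
From mathcomp Require Import all_classical all_reals all_analysis.

Set Implicit Arguments.
Unset Strict Implicit.
Unset Printing Implicit Defensive.

Import Order.TTheory GRing.Theory Num.Theory.
Import numFieldNormedType.Exports.
Local Open Scope classical_set_scope.
Local Open Scope ring_scope.
Local Open Scope quotient_scope.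

(* The field of 2-adic numbers is built as the completion of [rat] for the
   2-adic absolute value: Cauchy sequences modulo null sequences. *)

Definition val2 (q : rat) : int :=
  (logn 2 `|numq q|)%:Z - (logn 2 `|denq q|)%:Z.

Definition abs2 (R : realType) (q : rat) : R :=
  if q == 0 then 0 else 2%:R ^ (- val2 q).

Lemma val2_frac (n d : int) : n != 0 -> d != 0 ->
  val2 (n%:~R / d%:~R) = (logn 2 `|n|)%:Z - (logn 2 `|d|)%:Z.
Proof.
move=> n0 d0; set q := _ / _.
have dq : d%:~R != 0 :> rat by rewrite intr_eq0.
have q0 : q != 0 by rewrite mulf_neq0 ?invr_eq0 ?intr_eq0.
have E : numq q * d = n * denq q.
  apply: (@intr_inj rat); rewrite !intrM numqE -mulrA [(denq q)%:~R * _]mulrC.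
  by rewrite mulrA divfK.
have := congr1 (fun z : int => logn 2 `|z|) E.
rewrite /= !abszM !lognM ?absz_gt0 ?numq_eq0 ?denq_neq0 // => H.
rewrite /val2; apply/eqP; rewrite subr_eq addrAC eq_sym subr_eq.
by rewrite -!PoszD -H.
Qed.

Lemma rat_fracP (q : rat) : exists n d : int, d != 0 /\ q = n%:~R / d%:~R.
Proof. by exists (numq q), (denq q); rewrite denq_neq0 divq_num_den. Qed.

Lemma val2M (p q : rat) : p != 0 -> q != 0 -> val2 (p * q) = val2 p + val2 q.
Proof.
have [n [d [d0 ->]]] := rat_fracP p; have [m [e [e0 ->]]] := rat_fracP q.
rewrite !mulf_eq0 !invr_eq0 !intr_eq0 (negPf d0) (negPf e0) !orbF => n0 m0.
rewrite mulrACA -invfM -!intrM !val2_frac ?mulf_neq0 // !abszM.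
by rewrite !lognM ?absz_gt0 // !PoszD opprD addrACA.
Qed.

Lemma val2_1D (q : rat) : q != 0 -> 1 + q != 0 -> 0 <= val2 q ->
  0 <= val2 (1 + q).
Proof.
have [n [d [d0 ->]]] := rat_fracP q.
rewrite mulf_eq0 invr_eq0 !intr_eq0 (negPf d0) orbF => n0.
have dq : d%:~R != 0 :> rat by rewrite intr_eq0.
have -> : 1 + n%:~R / d%:~R = (d + n)%:~R / d%:~R :> rat.
  by rewrite intrD mulrDl divff.
rewrite mulf_eq0 invr_eq0 !intr_eq0 (negPf d0) orbF => dn0.
rewrite !val2_frac // !subr_ge0 !lez_nat => le_dn.
have dvdE (z : int) k : z != 0 -> ((2 ^ k)%N%:Z %| z)%Z = (k <= logn 2 `|z|)%N.
  by move=> z0; rewrite dvdzE /= pfactor_dvdn // absz_gt0.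
by rewrite -dvdE // rpredD // dvdE.
Qed.

Section Abs2.
Variable R : realType.
Local Notation abs2 := (@abs2 R).

Lemma abs2_0 : abs2 0 = 0. Proof. by rewrite /abs2 eqxx. Qed.

Lemma abs2_gt0 q : q != 0 -> 0 < abs2 q.
Proof. by move=> q0; rewrite /abs2 (negPf q0) exprz_gt0. Qed.

Lemma abs2_ge0 q : 0 <= abs2 q.
Proof. by have [->|/abs2_gt0/ltW//] := eqVneq q 0; rewrite abs2_0. Qed.

Lemma abs2_eq0 q : (abs2 q == 0) = (q == 0).
Proof.
have [->|/abs2_gt0] := eqVneq q 0; first by rewrite abs2_0 eqxx.
by rewrite lt0r => /andP[/negPf].
Qed.

Lemma abs2M : {morph abs2 : p q / p * q}.
Proof.
move=> p q; have [->|p0] := eqVneq p 0; first by rewrite mul0r abs2_0 mul0r.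
have [->|q0] := eqVneq q 0; first by rewrite mulr0 abs2_0 mulr0.
rewrite /abs2 mulf_eq0 (negPf p0) (negPf q0) /= val2M // opprD.
by rewrite expfzDr // pnatr_eq0.
Qed.

Lemma abs2_1 : abs2 1 = 1.
Proof. by rewrite /abs2 oner_eq0 /val2 /= subrr oppr0 expr0z. Qed.

Lemma abs2N q : abs2 (- q) = abs2 q.
Proof. by rewrite /abs2 oppr_eq0 /val2 numqN denqN abszN. Qed.

Lemma abs2V q : abs2 q^-1 = (abs2 q)^-1.
Proof.
have [->|q0] := eqVneq q 0; first by rewrite invr0 abs2_0 invr0.
apply: (@mulIf _ (abs2 q)); first by rewrite abs2_eq0.
by rewrite -abs2M mulVf // mulVf ?abs2_eq0 // abs2_1.
Qed.

Lemma abs2D p q : abs2 (p + q) <= Num.max (abs2 p) (abs2 q).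
Proof.
wlog le_qp : p q / abs2 q <= abs2 p.
  move=> W; have /orP[/W//|/W] := le_total (abs2 q) (abs2 p).
  by rewrite addrC maxC.
rewrite le_max; apply/orP; left.
have [p0|p0] := eqVneq p 0; first by rewrite {1}p0 add0r.
have -> : p + q = p * (1 + p^-1 * q) by rewrite mulrDr mulr1 mulVKf.
rewrite abs2M -[leRHS]mulr1 ler_wpM2l ?abs2_ge0 //.
have : abs2 (p^-1 * q) <= 1.
  by rewrite abs2M abs2V mulrC ler_pdivrMr ?abs2_gt0 // mul1r.
move: (p^-1 * q) => r.
have [->|r0] := eqVneq r 0; first by rewrite addr0 abs2_1.
have [->|s0] := eqVneq (1 + r) 0; first by rewrite abs2_0 ler01.
have le1 s : (s != 0) -> (abs2 s <= 1) = (0 <= val2 s).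
  move=> sn0; rewrite /abs2 (negPf sn0) -[1 in LHS](expr0z (2%:R : R)).
  by rewrite ler_eXz2l ?ltr1n // oppr_le0.
by rewrite !le1 //; exact: val2_1D.
Qed.

Lemma abs2_triangle p q : abs2 (p + q) <= abs2 p + abs2 q.
Proof.
apply: le_trans (abs2D p q) _.
by rewrite ge_max lerDl lerDr !abs2_ge0.
Qed.

Lemma abs2_sub_dist p q : `|abs2 p - abs2 q| <= abs2 (p - q).
Proof.
rewrite ler_distl lerBlDr; apply/andP; split.
  by rewrite addrC -[abs2 (p - q)]abs2N opprB -{1}(subrK p q) abs2_triangle.
by rewrite addrC -{1}(subrK q p) abs2_triangle.
Qed.

End Abs2.

Section CauchySequences.
Variable R : realType.
Local Notation abs2 := (@abs2 R).
Implicit Types u v : nat -> rat.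

Definition cauchy2 : {pred nat -> rat} := fun u =>
  `[< forall e : R, 0 < e -> exists N, forall m n, (N <= m)%N -> (N <= n)%N ->
      abs2 (u m - u n) < e >].

Lemma cauchy2_bounded u : u \in cauchy2 ->
  exists2 M : R, 0 < M & \forall n \near \oo, abs2 (u n) <= M.
Proof.
move=> /asboolP/(_ 1 ltr01)[N uN]; exists (abs2 (u N) + 1).
  by rewrite ltr_wpDl ?abs2_ge0.
exists N => // n /= leNn; rewrite -{1}(subrK (u N) (u n)) [leRHS]addrC.
by apply: le_trans (abs2_triangle _ _ _) _; rewrite lerD2r ltW ?uN.
Qed.

Lemma cauchy2_subring : subring_closed cauchy2.
Proof.
split=> [|u v /asboolP uC /asboolP vC|u v uC vC]; apply/asboolP => e e0.
- by exists 0%N => m n _ _; rewrite subrr abs2_0.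
- have [N uN] := uC _ e0; have [N' vN] := vC _ e0.
  exists (maxn N N') => m n; rewrite !geq_max => /andP[? ?] /andP[? ?].
  have -> : (u - v) m - (u - v) n = (u m - u n) + - (v m - v n).
    rewrite -[(u - v) m]/(u m - v m) -[(u - v) n]/(u n - v n).
    by rewrite !opprB [v n - u n]addrC addrACA [- v m + _]addrC.
  by apply: le_lt_trans (abs2D _ _ _) _; rewrite gt_max abs2N uN ?vN.
- have [M M0 [K _ uM]] := cauchy2_bounded uC.
  have [M' M'0 [K' _ vM]] := cauchy2_bounded vC.
  move/asboolP: uC => /(_ (e / M')) [|N uN]; first by rewrite divr_gt0.
  move/asboolP: vC => /(_ (e / M)) [|N' vN]; first by rewrite divr_gt0.
  exists (maxn (maxn N N') (maxn K K')) => m n; rewrite !geq_max.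
  move=> /andP[/andP[? ?] /andP[? ?]] /andP[/andP[? ?] /andP[? ?]].
  have -> : (u * v) m - (u * v) n = u m * (v m - v n) + (u m - u n) * v n.
    rewrite -[(u * v) m]/(u m * v m) -[(u * v) n]/(u n * v n).
    by rewrite mulrBr mulrBl addrA subrK.
  apply: le_lt_trans (abs2D _ _ _) _; rewrite gt_max !abs2M; apply/andP; split.
    apply: le_lt_trans (_ : M * abs2 (v m - v n) < e).
      by rewrite ler_wpM2r ?abs2_ge0 ?uM.
    by rewrite mulrC -ltr_pdivlMr ?vN.
  apply: le_lt_trans (_ : abs2 (u m - u n) * M' < e).
    by rewrite ler_wpM2l ?abs2_ge0 ?vM.
  by rewrite -ltr_pdivlMr ?uN.
Qed.

HB.instance Definition _ :=
  GRing.isSubringClosed.Build (nat -> rat) cauchy2 cauchy2_subring.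

Record cauchy_seq := CauchySeq {
  cauchy_val :> nat -> rat;
  _ : cauchy_val \in cauchy2 }.

HB.instance Definition _ := [isSub for cauchy_val].
HB.instance Definition _ := [Choice of cauchy_seq by <:].
HB.instance Definition _ := [SubChoice_isSubComNzRing of cauchy_seq by <:].

Definition null2 : {pred cauchy_seq} := fun u : cauchy_seq =>
  `[< (fun n => abs2 (u n)) @ \oo --> (0 : R) >].

Lemma null2P (u : cauchy_seq) :
  reflect (forall e : R, 0 < e -> \forall n \near \oo, abs2 (u n) < e)
          (u \in null2).
Proof.
apply: (iffP (asboolP _)) => [/cvgrPdist_lt u0 e /u0|u0].
  apply: filterS => n; rewrite sub0r normrN ger0_norm ?abs2_ge0 //.
apply/cvgrPdist_lt => e /u0; apply: filterS => n.
by rewrite sub0r normrN ger0_norm ?abs2_ge0.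
Qed.

Lemma null2_ideal : idealr_closed null2.
Proof.
split.
- by apply/null2P => e e0; exists 0%N => // n _; rewrite /= abs2_0.
- apply/negP => /null2P/(_ 1 ltr01)[N _ /(_ N)] /=.
  by rewrite leqnn abs2_1 ltxx => /(_ isT).
- move=> a u v /null2P uN /null2P vN; apply/null2P => e e0.
  have [M M0 aM] := cauchy2_bounded (valP a).
  near=> n; rewrite /= !fctE.
  apply: le_lt_trans (abs2D _ _ _) _; rewrite gt_max abs2M; apply/andP; split.
    apply: le_lt_trans (_ : M * abs2 (u n) < e).
      by rewrite ler_wpM2r ?abs2_ge0 //; near: n.
    rewrite mulrC -ltr_pdivlMr //; near: n; apply: uN; exact: divr_gt0.
  by near: n; exact: vN.
Unshelve. all: by end_near. Qed.

HB.instance Definition _ := isIdealr.Build cauchy_seq null2 null2_ideal.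

End CauchySequences.

Definition Q2 (R : realType) := {ideal_quot (@null2 R)}.
HB.instance Definition _ (R : realType) := GRing.ComNzRing.on (Q2 R).

Section Q2Theory.
Variable R : realType.
Local Notation abs2 := (@abs2 R).
Local Notation cseq := (cauchy_seq R).
Local Notation Q2 := (Q2 R).
Implicit Types u v : cseq.

Definition pi2 (u : cseq) : Q2 := \pi_{ideal_quot (@null2 R)} u.
Definition repr2 (x : Q2) : cseq := repr (x : {ideal_quot (@null2 R)}).

Lemma repr2K x : pi2 (repr2 x) = x. Proof. exact: reprK. Qed.

Lemma pi2_eq u v : (pi2 u == pi2 v) = (u - v \in @null2 R).
Proof. by rewrite /pi2 -Quotient.idealrBE. Qed.

Lemma pi2D u v : pi2 (u + v) = pi2 u + pi2 v. Proof. exact: rmorphD. Qed.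
Lemma pi2N u : pi2 (- u) = - pi2 u. Proof. exact: rmorphN. Qed.
Lemma pi2M u v : pi2 (u * v) = pi2 u * pi2 v. Proof. exact: rmorphM. Qed.
Lemma pi2_0 : pi2 0 = 0. Proof. exact: rmorph0. Qed.
Lemma pi2_1 : pi2 1 = 1. Proof. exact: rmorph1. Qed.

Lemma not_null2 u : u \notin @null2 R ->
  exists2 c : R, 0 < c & \forall n \near \oo, c <= abs2 (u n).
Proof.
move=> /negP u0; apply: contrapT => H; apply: u0; apply/null2P => e e0.
have /asboolP/(_ e e0)[N uN] := valP u.
have [n leNn ltn] : exists2 n, (N <= n)%N & abs2 (u n) < e.
  apply: contrapT => K; apply: H; exists e => //; exists N => // n /= leNn.
  by rewrite leNgt; apply/negP => ?; apply: K; exists n.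
exists N => // m /= leNm; rewrite -(subrK (u n) (u m)).
by apply: le_lt_trans (abs2D _ _ _) _; rewrite gt_max ltn andbT; exact: uN.
Qed.

Lemma cauchy2_inv u : u \notin @null2 R ->
  (fun n => (u n)^-1) \in @cauchy2 R.
Proof.
move=> /not_null2 [c c0 [K _ uK]]; apply/asboolP => e e0.
have /asboolP/(_ (e * c ^+ 2)) [|N uN] := valP u.
  by rewrite mulr_gt0 ?exprn_gt0.
exists (maxn N K) => m n; rewrite !geq_max => /andP[? Km] /andP[? Kn].
have um0 : u m != 0 by rewrite -(abs2_eq0 R) gt_eqF // (lt_le_trans c0) ?uK.
have un0 : u n != 0 by rewrite -(abs2_eq0 R) gt_eqF // (lt_le_trans c0) ?uK.
have -> : (u m)^-1 - (u n)^-1 = (u n - u m) / (u m * u n).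
  by field; rewrite um0 un0.
rewrite abs2M abs2V abs2M ltr_pdivrMr ?mulr_gt0 ?abs2_gt0 //.
apply: lt_le_trans (_ : e * c ^+ 2 <= _); first exact: uN.
by rewrite ler_wpM2l ?(ltW e0) // expr2 ler_pM ?(ltW c0) ?uK.
Qed.

Definition inv2 (x : Q2) : Q2 :=
  if x == 0 then 0
  else pi2 (insubd (0 : cseq) (fun n => (repr2 x n)^-1)).

Lemma mulV2 (x : Q2) : x != 0 -> inv2 x * x = 1.
Proof.
move=> x0; rewrite /inv2 (negPf x0).
have u0 : repr2 x \notin @null2 R.
  apply: contra x0; rewrite -[X in X \in _]subr0 -pi2_eq repr2K.
  by rewrite pi2_0.
rewrite -[X in _ * X]repr2K -pi2M -pi2_1; apply/eqP; rewrite pi2_eq.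
have [c c0 uc] := not_null2 u0; apply/null2P => e e0.
apply: filterS uc => n ucn; rewrite (_ : (_ - _ : cseq) n = 0) ?abs2_0 //.
rewrite -[LHS]/((insubd (0 : cseq) (fun n => (repr2 x n)^-1)) n * repr2 x n - 1).
rewrite /= insubdK ?cauchy2_inv // mulVf ?subrr //.
by rewrite -(abs2_eq0 R) gt_eqF // (lt_le_trans c0).
Qed.

Lemma inv2_0 : inv2 0 = 0. Proof. by rewrite /inv2 eqxx. Qed.

HB.instance Definition _ := GRing.ComNzRing_isField.Build Q2 mulV2 inv2_0.

Definition norm2 (x : Q2) : R := limn (fun n => abs2 (repr2 x n)).

Lemma cvg_abs2 u : cvgn (fun n => abs2 (u n)).
Proof.
apply/cauchy_cvgP/cauchy_exP => e e0.
have /asboolP/(_ e e0)[N uN] := valP u.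
exists (abs2 (u N)); exists N => // n /= leNn; rewrite /ball /=.
by apply: le_lt_trans (abs2_sub_dist _ _ _) _; exact: uN.
Qed.

Lemma norm2_pi u : norm2 (pi2 u) = limn (fun n => abs2 (u n)).
Proof.
apply/esym/cvg_lim => //.
have /null2P uv : repr2 (pi2 u) - u \in @null2 R by rewrite -pi2_eq repr2K.
have := @cvg_abs2 (repr2 (pi2 u)); rewrite -/(norm2 _) => /cvgrPdist_lt cv.
apply/cvgrPdist_lt => e e0; near=> n.
rewrite -(subrK (abs2 (repr2 (pi2 u) n)) (norm2 _)) -addrA (splitr e).
apply: le_lt_trans (ler_normD _ _) _; apply: ltrD.
  by near: n; apply: cv; rewrite divr_gt0.
apply: le_lt_trans (abs2_sub_dist _ _ _) _.
by near: n; apply: uv; rewrite divr_gt0.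
Unshelve. all: by end_near. Qed.

Definition dist2 (x y : Q2) : R := norm2 (x - y).

Lemma dist2xx x : dist2 x x = 0.
Proof.
rewrite /dist2 subrr -pi2_0 norm2_pi.
by rewrite (_ : (fun _ => _) = cst 0) ?lim_cst //; apply/funext => n.
Qed.

Lemma dist2_eq0 x y : dist2 x y = 0 -> x = y.
Proof.
rewrite /dist2 => xy0; apply/eqP; rewrite -subr_eq0 -pi2_0 -[x - y]repr2K.
rewrite pi2_eq subr0; apply/asboolP; rewrite -xy0; exact: cvg_abs2.
Qed.

Lemma dist2_sym x y : dist2 x y = dist2 y x.
Proof.
rewrite /dist2 -opprB -[y - x]repr2K -pi2N !norm2_pi.
by under eq_fun do rewrite abs2N.
Qed.

Lemma dist2_triangle y x z : dist2 x z <= dist2 x y + dist2 y z.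
Proof.
rewrite /dist2 (_ : x - z = (x - y) + (y - z)); last by rewrite addrA subrK.
rewrite -[x - y]repr2K -[y - z]repr2K -pi2D !norm2_pi.
rewrite -limD; [|exact: cvg_abs2|exact: cvg_abs2].
apply: ler_lim; [exact: cvg_abs2|apply: is_cvgD; exact: cvg_abs2|].
by exists 0%N => // n _; exact: abs2_triangle.
Qed.

HB.instance Definition _ := isMetric.Build R Q2
  dist2xx dist2_eq0 dist2_sym dist2_triangle.

End Q2Theory.


Section SymmetricGroup.
Variable T : choiceType.

Definition is_bij : {pred T -> T} := fun f => `[< bijective f >].

Record sym := Sym { sym_val :> T -> T; _ : sym_val \in is_bij }.

HB.instance Definition _ := [isSub for sym_val].
HB.instance Definition _ := [Choice of sym by <:].

Lemma sym_bij (f : sym) : bijective f.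
Proof. exact/asboolP/(valP f). Qed.

Lemma sym_inv_ex (f : sym) :
  {g : T -> T | [/\ cancel f g, cancel g f & g \in is_bij]}.
Proof.
apply: cid; have [g fK gK] := sym_bij f; exists g; split=> //.
by apply/asboolP; exists f.
Qed.

Lemma sym_mul_proof (f g : sym) : (g \o f : T -> T) \in is_bij.
Proof. by apply/asboolP; apply: bij_comp; exact: sym_bij. Qed.

Lemma sym_one_proof : (@id T : T -> T) \in is_bij.
Proof. by apply/asboolP; exists id. Qed.

Lemma sym_inv_proof (f : sym) : sval (sym_inv_ex f) \in is_bij.
Proof. by case: (sym_inv_ex f) => g []. Qed.

Definition sym_one := Sym sym_one_proof.
(* Products are read left to right: [(f * g) x = g (f x)], see [symM]. *)
Definition sym_mul f g := Sym (sym_mul_proof f g).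
Definition sym_inv f := Sym (sym_inv_proof f).

Lemma sym_mulA : associative sym_mul.
Proof. by move=> f g h; exact: val_inj. Qed.
Lemma sym_mul1g : left_id sym_one sym_mul.
Proof. by move=> f; exact: val_inj. Qed.
Lemma sym_mulg1 : right_id sym_one sym_mul.
Proof. by move=> f; exact: val_inj. Qed.

Lemma sym_mulVg : left_inverse sym_one sym_inv sym_mul.
Proof.
move=> f; apply/val_inj/funext => x /=.
by case: (sym_inv_ex f) => g [].
Qed.

Lemma sym_mulgV : right_inverse sym_one sym_inv sym_mul.
Proof.
move=> f; apply/val_inj/funext => x /=.
by case: (sym_inv_ex f) => g [].
Qed.

HB.instance Definition _ :=
  isGroup.Build sym sym_mulA sym_mul1g sym_mulg1 sym_mulVg sym_mulgV.

Lemma symM (f g : sym) x : (f * g)%g x = g (f x). Proof. by []. Qed.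

Lemma symK (f : sym) : cancel f (f^-1)%g.
Proof. by move=> x; rewrite -symM mulgV. Qed.

Lemma symVK (f : sym) : cancel (f^-1)%g f.
Proof. by move=> x; rewrite -symM mulVg. Qed.

End SymmetricGroup.

Section Dilations.
Variables (R : realType) (T : metricType R).

Definition dilation : {pred sym T} := fun f =>
  `[< [/\ continuous f, continuous (f^-1)%g &
      exists2 lambda : R, 0 < lambda &
        forall x y, mdist (f x) (f y) = lambda * mdist x y] >].

Lemma dilation_group_closed : group_closed dilation.
Proof.
split=> [|f g /asboolP[fc fVc [l l0 fl]] /asboolP[gc gVc [m m0 gm]]].
  apply/asboolP; split; try by move=> x; exact: cvg_id.
    by rewrite invg1 => x; exact: cvg_id.
  by exists 1 => // x y; rewrite mul1r.
apply/asboolP; split.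
- by move=> x; apply: continuous_comp; [exact: fc|exact: gVc].
- by rewrite invgF => x; apply: continuous_comp; [exact: gc|exact: fVc].
- exists (l / m); first exact: divr_gt0.
  move=> x y; rewrite !symM -[in RHS]mulrA [_ * mdist _ _]mulrC mulrA -fl.
  apply: (canRL (mulfK _)); first by rewrite gt_eqF.
  by rewrite mulrC -gm !symVK.
Qed.

Record dil := Dil { dil_val :> sym T; _ : dil_val \in dilation }.

HB.instance Definition _ := [isSub for dil_val].
HB.instance Definition _ := [Choice of dil by <:].
HB.instance Definition _ :=
  SubChoice_isSubGroup.Build _ _ dil dilation_group_closed.

End Dilations.

Section GraphAutomorphisms.
Variables (V : choiceType) (adj : rel V).

Definition graph_aut : {pred sym V} := fun g =>
  `[< forall x y, adj (g x) (g y) = adj x y >].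

Lemma graph_aut_group_closed : group_closed graph_aut.
Proof.
split=> [|f g /asboolP fA /asboolP gA]; apply/asboolP => // x y.
by rewrite !symM -gA !symVK.
Qed.

Record aut := Aut { aut_val :> sym V; _ : aut_val \in graph_aut }.

HB.instance Definition _ := [isSub for aut_val].
HB.instance Definition _ := [Choice of aut by <:].
HB.instance Definition _ :=
  SubChoice_isSubGroup.Build _ _ aut graph_aut_group_closed.

(* [aut] carries the topology of pointwise convergence on vertices. *)
Definition aut_fun (g : aut) : {ptws V -> discrete_topology V} := g.

HB.instance Definition _ := Topological.copy aut (initial_topology aut_fun).

(* Given the first conjunct, the second one says that the graph distance between
   [r m] and [r n] is [`|n - m|]. *)
Definition geodesic_ray (r : nat -> V) : Prop :=
  (forall n, adj (r n) (r n.+1)) /\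
  forall m n p, path adj (r m) p -> last (r m) p = r n -> (n - m <= size p)%N.

Definition cofinal (r s : nat -> V) : Prop :=
  exists m n, forall i, r (m + i)%N = s (n + i)%N.

(* Ends are equivalence classes, i.e. sets, of geodesic rays. *)
Definition end_of (r : nat -> V) : set (nat -> V) :=
  [set s | geodesic_ray s /\ cofinal r s].

Definition boundary : set (set (nat -> V)) :=
  [set end_of r | r in geodesic_ray].

Definition end_act (g : aut) (E : set (nat -> V)) : set (nat -> V) :=
  [set (g : V -> V) \o r | r in E].

Definition end_stabilizer (E : set (nat -> V)) : set aut :=
  [set g | end_act g E = E].

Definition vertex_transitive (H : set aut) : Prop :=
  forall u v, exists2 g, H g & g u = v.

Definition scale_group (H : set aut) : Prop :=
  [/\ group_closed (mem H), closed H, vertex_transitive H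
    & exists2 E, boundary E & H `<=` end_stabilizer E].

Definition two_transitive_on (H : set aut) (D : set (set (nat -> V))) : Prop :=
  (forall g E, H g -> D E -> D (end_act g E)) /\
  forall E1 E2 F1 F2, D E1 -> D E2 -> D F1 -> D F2 -> E1 <> E2 -> F1 <> F2 ->
    exists g, [/\ H g, end_act g E1 = F1 & end_act g E2 = F2].

End GraphAutomorphisms.

Section Presentations.
Variable X : choiceType.

(* The letter [(x, true)] stands for the inverse of the generator [x]. *)
Definition word := seq (X * bool).

Definition gen (x : X) : word := [:: (x, false)].
Definition winv (w : word) : word := rev [seq (l.1, ~~ l.2) | l <- w].

Definition wpow (w : word) (n : nat) : word := flatten (nseq n w).

Definition weval (G : groupType) (f : X -> G) (w : word) : G :=
  (\prod_(l <- w) if l.2 then (f l.1)^-1 else f l.1)%g.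

Variable Rels : set word.

Inductive pres_rel : word -> word -> Prop :=
| pres_refl w : pres_rel w w
| pres_sym w1 w2 : pres_rel w1 w2 -> pres_rel w2 w1
| pres_trans w1 w2 w3 : pres_rel w1 w2 -> pres_rel w2 w3 -> pres_rel w1 w3
| pres_cat w1 w2 w3 w4 : pres_rel w1 w2 -> pres_rel w3 w4 ->
    pres_rel (w1 ++ w3) (w2 ++ w4)
| pres_cancel x e : pres_rel [:: (x, e); (x, ~~ e)] [::]
| pres_relator r : Rels r -> pres_rel r [::].

Definition pres_eq : rel word := fun w1 w2 => `[< pres_rel w1 w2 >].

Lemma pres_eq_equiv : equiv_class_of pres_eq.
Proof.
split=> [w|w1 w2|w2 w1 w3 /asboolP ? /asboolP ?].
- by apply/asboolP; exact: pres_refl.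
- by apply/asboolP/asboolP; exact: pres_sym.
- by apply/asboolP; exact: pres_trans (_ : pres_rel _ w2) _.
Qed.

Canonical pres_equiv := EquivRelPack pres_eq_equiv.

Definition presented := {eq_quot pres_eq}.
HB.instance Definition _ := EqQuotient.on presented.
HB.instance Definition _ := Choice.on presented.

Definition pres_class (w : word) : presented := \pi w.

Lemma pres_classP w1 w2 : pres_class w1 = pres_class w2 <-> pres_rel w1 w2.
Proof.
split=> [/eqP|H]; first by rewrite /pres_class eqmodE => /asboolP.
by apply/eqP; rewrite /pres_class eqmodE; apply/asboolP.
Qed.

Lemma pres_classK (x : presented) : pres_class (repr x) = x.
Proof. exact: reprK. Qed.

Lemma pres_repr w : pres_rel (repr (pres_class w)) w.
Proof. by apply/pres_classP; rewrite pres_classK. Qed.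

Lemma winv_cat w1 w2 : winv (w1 ++ w2) = winv w2 ++ winv w1.
Proof. by rewrite /winv map_cat rev_cat. Qed.

Lemma winvK : involutive winv.
Proof.
move=> w; rewrite /winv map_rev revK -map_comp -[RHS]map_id.
by apply: eq_map => -[x e] /=; rewrite negbK.
Qed.

Lemma pres_mulV w : pres_rel (w ++ winv w) [::].
Proof.
elim: w => [|[x e] w IH]; first exact: pres_refl.
rewrite -cat1s winv_cat -catA [w ++ _]catA.
apply: pres_trans (pres_cancel x e).
apply: (pres_cat (pres_refl [:: (x, e)])).
exact: (pres_cat IH (pres_refl [:: (x, ~~ e)])).
Qed.

Lemma pres_winv w1 w2 : pres_rel w1 w2 -> pres_rel (winv w1) (winv w2).
Proof.
move=> w12; apply: pres_trans (_ : pres_rel (winv w1 ++ (w2 ++ winv w2)) _).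
  rewrite -[X in pres_rel X _]cats0; apply: pres_cat; first exact: pres_refl.
  exact/pres_sym/pres_mulV.
rewrite catA -[X in pres_rel _ X]cat0s.
apply: pres_cat; last exact: pres_refl.
apply: pres_trans (_ : pres_rel (winv w1 ++ w1) _).
  by apply: pres_cat; [exact: pres_refl|exact: pres_sym].
by have := pres_mulV (winv w1); rewrite winvK.
Qed.

Definition pres_one : presented := pres_class [::].
Definition pres_mul (x y : presented) := pres_class (repr x ++ repr y).
Definition pres_inv (x : presented) := pres_class (winv (repr x)).

Lemma pres_class_cat w1 w2 :
  pres_mul (pres_class w1) (pres_class w2) = pres_class (w1 ++ w2).
Proof. by apply/pres_classP; apply: pres_cat; exact: pres_repr. Qed.

Lemma pres_class_winv w : pres_inv (pres_class w) = pres_class (winv w).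
Proof. by apply/pres_classP/pres_winv/pres_repr. Qed.

Lemma pres_mulA : associative pres_mul.
Proof.
move=> x y z; rewrite -[x]pres_classK -[y]pres_classK -[z]pres_classK.
by rewrite !pres_class_cat catA.
Qed.

Lemma pres_mul1g : left_id pres_one pres_mul.
Proof. by move=> x; rewrite -[x]pres_classK pres_class_cat. Qed.

Lemma pres_mulg1 : right_id pres_one pres_mul.
Proof. by move=> x; rewrite -[x]pres_classK pres_class_cat cats0. Qed.

Lemma pres_mulgV : right_inverse pres_one pres_inv pres_mul.
Proof.
move=> x; rewrite -[x]pres_classK pres_class_winv pres_class_cat.
exact/pres_classP/pres_mulV.
Qed.

Lemma pres_mulVg : left_inverse pres_one pres_inv pres_mul.
Proof.
move=> x; rewrite -[x]pres_classK pres_class_winv pres_class_cat.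
by apply/pres_classP; rewrite -{2}[repr x]winvK; exact: pres_mulV.
Qed.

HB.instance Definition _ := isGroup.Build presented
  pres_mulA pres_mul1g pres_mulg1 pres_mulVg pres_mulgV.

End Presentations.

Section AscendingHNN.
Variables (X : choiceType) (Rels : set (word X)) (sigma : X -> word X).

Definition wsubst (w : word X) : word X :=
  flatten [seq (if l.2 then winv (sigma l.1) else sigma l.1) | l <- w].

(* Words in the generators of the base group together with the stable letter
   [t = None]; the relator of [w] is [t w t^-1 sigma(w)^-1]. *)
Definition base_word (w : word X) : word (option X) :=
  [seq (Some l.1, l.2) | l <- w].

Definition hnn_relator (w : word X) : word (option X) :=
  gen None ++ base_word w ++ winv (gen None) ++ winv (base_word (wsubst w)).

Definition base_relators : set (word (option X)) :=
  [set base_word r | r in Rels].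

End AscendingHNN.

Definition adjT2 : rel (seq bool) := fun u v =>
  [exists x : bool, (v == rcons u x) || (u == rcons v x)].

(* The vertex [v] of the [p.1]-th copy of the binary tree, seen in the [m]-th
   copy, for [p.1 <= m]; the letters 0, 1 are [false], [true]. *)
Definition liftT2 (m : nat) (p : nat * seq bool) : seq bool :=
  nseq (m - p.1) false ++ p.2.

(* The 3-regular tree is the direct limit of the copies of the binary tree along
   the embeddings [v |-> 0v]: pairs (index of a copy, vertex of that copy) are
   identified when they agree in a common copy. *)
Definition T3_eq : rel (nat * seq bool) := fun p q =>
  liftT2 (maxn p.1 q.1) p == liftT2 (maxn p.1 q.1) q.

Lemma liftT2_nseq m k p : (p.1 <= m)%N ->
  liftT2 (k + m) p = nseq k false ++ liftT2 m p.
Proof. by move=> pm; rewrite /liftT2 -addnBA // nseqD catA. Qed.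

Lemma T3_eqE m p q : (p.1 <= m)%N -> (q.1 <= m)%N ->
  T3_eq p q = (liftT2 m p == liftT2 m q).
Proof.
move=> pm qm; have Mm : (maxn p.1 q.1 <= m)%N by rewrite geq_max pm.
rewrite -(subnK Mm) !liftT2_nseq ?leq_maxl ?leq_maxr //.
by rewrite eqseq_cat // eqxx.
Qed.

Lemma T3_eq_equiv : equiv_class_of T3_eq.
Proof.
split=> [p|p q|q p r]; first by rewrite /T3_eq eqxx.
  by rewrite /T3_eq maxnC eq_sym.
pose m := maxn p.1 (maxn q.1 r.1).
have pm : (p.1 <= m)%N by exact: leq_maxl.
have qm : (q.1 <= m)%N by rewrite /m maxnCA leq_maxl.
have rm : (r.1 <= m)%N by rewrite /m maxnA leq_maxr.
by rewrite !(@T3_eqE m) // => /eqP-> /eqP->.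
Qed.

Canonical T3_equiv := EquivRelPack T3_eq_equiv.

Definition T3 := {eq_quot T3_eq}.
HB.instance Definition _ := EqQuotient.on T3.
HB.instance Definition _ := Choice.on T3.

Definition vertex (n : nat) (v : seq bool) : T3 := \pi_T3 (n, v).

Lemma vertexP n v m w :
  vertex n v = vertex m w <-> T3_eq (n, v) (m, w).
Proof.
split=> [/eqP|H]; first by rewrite /vertex eqmodE.
by apply/eqP; rewrite /vertex eqmodE.
Qed.

Lemma vertex_repr x : vertex (repr x).1 (repr x).2 = x.
Proof. by rewrite /vertex -surjective_pairing reprK. Qed.

Definition adjT3 : rel T3 := fun x y =>
  let m := maxn (repr x).1 (repr y).1 in
  adjT2 (liftT2 m (repr x)) (liftT2 m (repr y)).

Definition level (x : T3) : int := (size (repr x).2)%:Z - (repr x).1%:Z.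

Definition child (x : T3) (d : bool) : T3 :=
  vertex (repr x).1 (rcons (repr x).2 d).

Lemma level_vertex n v : level (vertex n v) = (size v)%:Z - n%:Z.
Proof.
have /vertexP := vertex_repr (vertex n v); rewrite /T3_eq /level /liftT2 /=.
case: (repr (vertex n v)) => m w /= /eqP/(congr1 size).
rewrite !size_cat !size_nseq.
move: (maxn m n) (leq_maxl m n) (leq_maxr m n) => k mk nk E.
have {}E : (size w + n = size v + m)%N.
  by apply: (@addnI (k - m)%N);
    rewrite addnA E addnAC subnK // addnCA subnK // addnC.
by apply/eqP; rewrite subr_eq addrAC eq_sym subr_eq -!PoszD E.
Qed.

Lemma child_vertex n v d : child (vertex n v) d = vertex n (rcons v d).
Proof.
have /vertexP := vertex_repr (vertex n v); rewrite /T3_eq /liftT2 /= => /eqP E.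
by apply/vertexP; rewrite /T3_eq /liftT2 /= -!rcons_cat E.
Qed.

Definition omega : set (nat -> T3) := end_of adjT3 (fun n => vertex n [::]).

Definition punctured_boundary : set (set (nat -> T3)) :=
  boundary adjT3 `\ omega.

(* The partial sum over [- n <= i < n] of the two-sided series [x_i 2^i]. *)
Definition digit_sum (R : realType) (x : int -> bool) (n : nat) : Q2 R :=
  \sum_(k < n.*2) (x (k%:Z - n%:Z))%:R * 2%:R ^ (k%:Z - n%:Z).

(* [v] is the bi-infinite geodesic from [omega] to [E], parametrized by levels,
   [x] is its sequence of letters, and [z] is the sum of the [x_i 2^i]. *)
Definition boundary_coord (R : realType) (E : set (nat -> T3)) (z : Q2 R) :=
  exists (v : int -> T3) (x : int -> bool),
    [/\ forall i, level (v i) = i,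
        forall i, v (i + 1) = child (v i) (x (i + 1)),
        omega (fun n => v (- n%:Z)),
        E (fun n => v n%:Z)
      & digit_sum R x @ \oo --> z].

(* The identification of the dilations of Q_2 with the automorphisms fixing
   [omega]: the bijection [E |-> z] of [boundary_coord] intertwines [g] and
   [f]. *)
Definition corresponds (R : realType) (f : dil (Q2 R)) (g : aut adjT3) :=
  end_stabilizer omega g /\
  forall E z, punctured_boundary E -> boundary_coord E z ->
    boundary_coord (end_act g E) (f z).

Inductive letter4 := La | Lb | Lc | Ld.

HB.instance Definition _ := gen_eqMixin letter4.
HB.instance Definition _ := gen_choiceMixin letter4.

Definition sigmaG (s : letter4) : word letter4 :=
  match s with
  | La => gen La ++ gen Lc ++ gen La
  | Lb => gen Ld
  | Lc => gen Lb
  | Ld => gen Lc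
  end.

Definition relatorsG : set (word letter4) :=
  [set` [:: gen La ++ gen La; gen Lb ++ gen Lb; gen Lc ++ gen Lc;
            gen Ld ++ gen Ld; gen Lb ++ gen Lc ++ gen Ld;
            wpow (gen La ++ gen Ld) 4;
            wpow (gen La ++ gen Ld ++ gen La ++ gen Lc ++ gen La ++ gen Lc) 4]].

Definition Gtilde : groupType := presented
  (base_relators relatorsG `|` [set hnn_relator sigmaG (gen s) | s in setT]).

(* [a = (b, 1) eps] and [b = (a, 1)], where [eps] exchanges 0 and 1. *)
Fixpoint basilica_a_fun (w : seq bool) : seq bool :=
  match w with
  | [::] => [::]
  | false :: w' => true :: basilica_b_fun w'
  | true :: w' => false :: w'
  end
with basilica_b_fun (w : seq bool) : seq bool :=
  match w with
  | [::] => [::]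
  | false :: w' => false :: basilica_a_fun w'
  | true :: w' => true :: w'
  end.

Fixpoint basilica_a_inv (w : seq bool) : seq bool :=
  match w with
  | [::] => [::]
  | false :: w' => true :: w'
  | true :: w' => false :: basilica_b_inv w'
  end
with basilica_b_inv (w : seq bool) : seq bool :=
  match w with
  | [::] => [::]
  | false :: w' => false :: basilica_a_inv w'
  | true :: w' => true :: w'
  end.

Lemma basilica_funK :
  (cancel basilica_a_fun basilica_a_inv * cancel basilica_b_fun basilica_b_inv)%type.
Proof.
suff H w : basilica_a_inv (basilica_a_fun w) = w /\
           basilica_b_inv (basilica_b_fun w) = w by split=> w; case: (H w).
by elim: w => [|[] w [IHa IHb]] //=; rewrite ?IHa ?IHb.
Qed.

Lemma basilica_invK :
  (cancel basilica_a_inv basilica_a_fun * cancel basilica_b_inv basilica_b_fun)%type.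
Proof.
suff H w : basilica_a_fun (basilica_a_inv w) = w /\
           basilica_b_fun (basilica_b_inv w) = w by split=> w; case: (H w).
by elim: w => [|[] w [IHa IHb]] //=; rewrite ?IHa ?IHb.
Qed.

Lemma basilica_a_bij : basilica_a_fun \in @is_bij _.
Proof.
by apply/asboolP; exists basilica_a_inv;
  [exact: basilica_funK.1|exact: basilica_invK.1].
Qed.

Lemma basilica_b_bij : basilica_b_fun \in @is_bij _.
Proof.
by apply/asboolP; exists basilica_b_inv;
  [exact: basilica_funK.2|exact: basilica_invK.2].
Qed.

Lemma basilica_fun_rcons w x :
  (exists y, basilica_a_fun (rcons w x) = rcons (basilica_a_fun w) y) /\
  (exists y, basilica_b_fun (rcons w x) = rcons (basilica_b_fun w) y).
Proof.
elim: w => [|d w [[y IHa] [z IHb]]]; first by case: x; split; eexists.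
case: d => /=; rewrite ?IHa ?IHb; split.
- by exists x.
- by exists x.
- by exists z.
- by exists y.
Qed.

Lemma adjT2_preserved (f : seq bool -> seq bool) :
  injective f -> (forall w x, exists y, f (rcons w x) = rcons (f w) y) ->
  f [::] = [::] -> forall u v, adjT2 (f u) (f v) = adjT2 u v.
Proof.
move=> fI fr f0.
have child u v : (exists x, f v = rcons (f u) x) <-> (exists x, v = rcons u x).
  split=> [[x]|[x ->]]; last exact: fr.
  case: (lastP v) => [|v' y]; first by rewrite f0; case: (f u).
  have [z ->] := fr v' y; move=> /rcons_inj[/fI -> _]; by exists y.
move=> u v; apply/existsP/existsP => -[x /orP[/eqP E|/eqP E]].
- have /child[y ->] : exists x, f v = rcons (f u) x by exists x.
  by exists y; rewrite eqxx.
- have /child[y ->] : exists x, f u = rcons (f v) x by exists x.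
  by exists y; rewrite eqxx orbT.
- have /child[y ->] : exists x, v = rcons u x by exists x.
  by exists y; rewrite eqxx.
- have /child[y ->] : exists x, u = rcons v x by exists x.
  by exists y; rewrite eqxx orbT.
Qed.

Lemma basilica_a_aut : Sym basilica_a_bij \in graph_aut adjT2.
Proof.
apply/asboolP; apply: adjT2_preserved => //.
  exact: can_inj basilica_funK.1.
by move=> w x; case: (basilica_fun_rcons w x).
Qed.

Lemma basilica_b_aut : Sym basilica_b_bij \in graph_aut adjT2.
Proof.
apply/asboolP; apply: adjT2_preserved => //.
  exact: can_inj basilica_funK.2.
by move=> w x; case: (basilica_fun_rcons w x).
Qed.

Definition basilica_a : aut adjT2 := Aut basilica_a_aut.
Definition basilica_b : aut adjT2 := Aut basilica_b_aut.

Inductive letter2 := Ba | Bb.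

HB.instance Definition _ := gen_eqMixin letter2.
HB.instance Definition _ := gen_choiceMixin letter2.

Definition basilica_gen (s : letter2) : aut adjT2 :=
  match s with Ba => basilica_a | Bb => basilica_b end.

Definition sigmaB (s : letter2) : word letter2 :=
  match s with Ba => gen Bb | Bb => gen Ba ++ gen Ba end.

(* All relations of the group generated by [basilica_a] and [basilica_b]; the
   endomorphism of that group sends the element represented by a word [w] to the
   one represented by [wsubst sigmaB w]. *)
Definition relatorsB : set (word letter2) :=
  [set w | weval basilica_gen w = 1%g].

Definition Btilde : groupType := presented
  (base_relators relatorsB `|` [set hnn_relator sigmaB w | w in setT]).

(* Main.v *)
Require Import Defs.
From HB Require Import structures.
From mathcomp Require Import all_boot all_order all_algebra.
From mathcomp Require Import zify ring.
From mathcomp Require Import all_classical all_reals all_analysis.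

(* Both HNN extensions act on the union of the trees T_2^(n): the stable letter
   sends the vertex v of T_2^(n) to the vertex v of T_2^(n+1), and a generator s
   acts on T_2^(n) as sigma^n(s).  This is compatible with v |-> 0v because
   sigma(g) = (g, rho(g)) in the wreath recursion (for the Grigorchuk group, after
   exchanging the two letters).

   An automorphism commuting with the parent map permutes the lines issued from
   omega; two lines branching at level k correspond to 2-adic numbers at distance
   2^(-k), so a translation of the levels by h becomes a dilation of ratio 2^(-h).

   Every element is t^(-m) w t^n with w in the base group.  Triviality on the tree
   gives m = n and w trivial on T_2, and it remains to see that w is then trivial
   in the extension.  For the Basilica group this holds by definition.  For the
   Grigorchuk group put psi(x) = t x t^-1 and psi'(x) = a psi(x) a, which behave
   like (x, rho(x)) and (rho(x), x).  The relators (ad)^4 and (adacac)^4 say that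
   psi(b) commutes with psi'(b) and with psi'(dabad), hence psi(b) commutes with
   psi'(b^r) for all r in <a, d>; therefore a word w with an even number of a's
   and sections u, v equals psi'(v rho(u)^-1) psi(u), and induction on the length
   applies.

   That sigma preserves the relations of the Basilica group amounts to the fact
   that trivial words have exponent sum zero in b.

   The closure contains, for lines branching at the same vertices, a limit along an
   ultrafilter of elements matching longer and longer pieces of the lines; the
   matching elements come from elements moving the subtree under 00 transitively
   while fixing the subtree under 1. *)

Set Implicit Arguments.
Unset Strict Implicit.
Unset Printing Implicit Defensive.

Import Order.TTheory GRing.Theory Num.Theory.
Import numFieldNormedType.Exports.
Local Open Scope classical_set_scope.
Local Open Scope ring_scope.

(** * The 3-regular tree *)

Section Tree.
Implicit Types (x y : T3) (v w : seq bool).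

Lemma T3_ind (P : T3 -> Prop) : (forall n v, P (vertex n v)) -> forall x, P x.
Proof. by move=> H x; rewrite -(vertex_repr x). Qed.

Lemma vertex_lift k n v : vertex (k + n) (nseq k false ++ v) = vertex n v.
Proof.
apply/vertexP; rewrite (@T3_eqE (k + n)%N) ?leq_addl //= /liftT2 /=.
by rewrite subnn addnK.
Qed.

Lemma vertexS n v : vertex n.+1 (false :: v) = vertex n v.
Proof. exact: (vertex_lift 1). Qed.

(** Words of different copies are compared in a common later copy, of index [k + n = l + m]; free
    [k] and [l] avoid maxima and subtractions. *)
Lemma vertex_eqP n v m w k l : (k + n = l + m)%N ->
  vertex n v = vertex m w <-> nseq k false ++ v = nseq l false ++ w.
Proof.
move=> E; rewrite -(vertex_lift k n) -(vertex_lift l m) -E; split=> [|->//].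
move/vertexP; rewrite (@T3_eqE (k + n)%N) //= /liftT2 /= subnn.
by move/eqP.
Qed.

Lemma vertex_inj n : injective (vertex n).
Proof. by move=> v w /(@vertex_eqP _ _ _ _ 0 0 erefl). Qed.

(** [belast false v] drops the last letter of [0v], the name of [v] in the next copy; thus the root
    of a copy has a parent too. *)
Definition parent x : T3 := vertex (repr x).1.+1 (belast false (repr x).2).
Definition letter x : bool := last false (repr x).2.

Lemma nseq_cons_cat k v : nseq k false ++ false :: v = false :: nseq k false ++ v.
Proof. by elim: k => //= k ->. Qed.

(** The chosen representative is unknown, but it differs from a given one by leading zeros only;
    this is how functions defined through [repr] are computed. *)
Lemma repr_vertex n v : exists k l, (k + (repr (vertex n v)).1 = l + n)%N /\
  nseq k false ++ (repr (vertex n v)).2 = nseq l false ++ v.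
Proof.
move: (repr (vertex n v)) (vertex_repr (vertex n v)) => -[m w] /= E.
exists n, m; split; first by rewrite addnC.
by apply/(@vertex_eqP m w n v n m); rewrite // addnC.
Qed.

Lemma belast_nseq k v :
  belast false (nseq k false ++ v) = nseq k false ++ belast false v.
Proof. by elim: k => //= k ->; elim: v => //= [|d v _]; case: k. Qed.

Lemma parent_vertex n v : parent (vertex n v) = vertex n.+1 (belast false v).
Proof.
rewrite /parent; have [k [l [E1 E2]]] := repr_vertex n v.
apply/(@vertex_eqP _ _ _ _ k l); first by rewrite !addnS E1.
by rewrite -!belast_nseq E2.
Qed.

Lemma letter_vertex n v : letter (vertex n v) = last false v.
Proof.
have lastE k w : last false (nseq k false ++ w) = last false w.
  by rewrite last_cat; congr (last _ w); elim: k.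
rewrite /letter; have [k [l [_ E2]]] := repr_vertex n v.
by rewrite -(lastE k) E2 lastE.
Qed.

Lemma parent_rcons n v d : parent (vertex n (rcons v d)) = vertex n v.
Proof. by rewrite parent_vertex belast_rcons vertexS. Qed.

Lemma parent_child x d : parent (child x d) = x.
Proof. by elim/T3_ind: x => n v; rewrite child_vertex parent_rcons. Qed.

Lemma letter_child x d : letter (child x d) = d.
Proof. by elim/T3_ind: x => n v; rewrite child_vertex letter_vertex last_rcons. Qed.

Lemma child_parent x : child (parent x) (letter x) = x.
Proof.
elim/T3_ind: x => n v; rewrite parent_vertex letter_vertex child_vertex.
by rewrite -lastI vertexS.
Qed.

Lemma parent_letter_inj x y : parent x = parent y -> letter x = letter y -> x = y.
Proof. by move=> E1 E2; rewrite -(child_parent x) E1 E2 child_parent. Qed.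

Lemma level_parent x : level (parent x) = level x - 1.
Proof.
elim/T3_ind: x => n v; rewrite parent_vertex !level_vertex size_belast; lia.
Qed.

Lemma level_child x d : level (child x d) = level x + 1.
Proof. by rewrite -[in RHS](parent_child x d) level_parent subrK. Qed.

Lemma adjT3P x y : reflect (y = parent x \/ x = parent y) (adjT3 x y).
Proof.
have H : adjT3 x y <-> exists d, y = child x d \/ x = child y d.
  rewrite /adjT3; set m := maxn _ _; set v := liftT2 m (repr x).
  set w := liftT2 m (repr y).
  have xE : x = vertex m v.
    rewrite -[LHS]vertex_repr -(vertex_lift (m - (repr x).1)).
    by rewrite subnK ?leq_maxl.
  have yE : y = vertex m w.
    rewrite -[LHS]vertex_repr -(vertex_lift (m - (repr y).1)).
    by rewrite subnK ?leq_maxr.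
  clearbody m v w; rewrite xE yE; split.
    case/existsP => d /orP[/eqP->|/eqP->]; exists d; rewrite !child_vertex;
      by [left|right].
  case=> d; rewrite !child_vertex => -[] /vertex_inj E;
    by apply/existsP; exists d; rewrite E eqxx ?orbT.
apply: (iffP idP) => [/H[d [->|->]]|[E|E]].
- by right; rewrite parent_child.
- by left; rewrite parent_child.
- by apply/H; exists (letter x); right; rewrite E child_parent.
- by apply/H; exists (letter y); left; rewrite E child_parent.
Qed.

Lemma level_iter_parent k x : level (iter k parent x) = level x - k%:Z.
Proof.
elim: k => [|k IH] /=; first by rewrite subr0.
by rewrite level_parent IH; lia.
Qed.

Lemma iter_parent_nil k n : iter k parent (vertex n [::]) = vertex (k + n) [::].
Proof. by elim: k => //= k ->; rewrite parent_vertex. Qed.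

Lemma iter_parent_vertex n v : iter (size v) parent (vertex n v) = vertex n [::].
Proof.
elim/last_ind: v => // v d IH.
by rewrite size_rcons iterSr parent_rcons.
Qed.

Lemma parent_reaches_root x :
  exists k n, forall i, iter (i + k) parent x = vertex (i + n) [::].
Proof.
elim/T3_ind: x => n v; exists (size v), n => i.
by rewrite iterD iter_parent_vertex iter_parent_nil.
Qed.

End Tree.

(** * Ends and lines *)

Section GraphEnds.
Variables (V : choiceType) (adj : rel V).
Implicit Types (r s : nat -> V) (g : aut adj).

Lemma aut_adj g x y : adj (g x) (g y) = adj x y.
Proof. by have /asboolP := valP g; exact. Qed.

Lemma autM g1 g2 x : (g1 * g2)%g x = g2 (g1 x). Proof. by []. Qed.

Lemma autK g : cancel g (g^-1)%g.
Proof. by move=> x; rewrite -autM mulgV. Qed.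

Lemma autVK g : cancel (g^-1)%g g.
Proof. by move=> x; rewrite -autM mulVg. Qed.

Lemma aut_inj g : injective g. Proof. exact: can_inj (autK g). Qed.

Lemma autP g1 g2 : (forall x, g1 x = g2 x) -> g1 = g2.
Proof. by move=> E; do 2 apply: val_inj; exact/funext. Qed.

Lemma cofinal_refl r : cofinal r r. Proof. by exists 0%N, 0%N. Qed.

Lemma cofinal_sym r s : cofinal r s -> cofinal s r.
Proof. by move=> [m [n E]]; exists n, m => i. Qed.

Lemma cofinal_trans r s t : cofinal r s -> cofinal s t -> cofinal r t.
Proof.
move=> [m [n E]] [m' [n' E']]; exists (m + m')%N, (n' + n)%N => i.
by rewrite -addnA E addnA [(n + m')%N]addnC -addnA E' addnA.
Qed.

Lemma end_of_cofinal r s : cofinal r s -> end_of adj r = end_of adj s.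
Proof.
move=> rs; apply/seteqP; split=> t [tG rt]; split=> //.
  exact: cofinal_trans (cofinal_sym rs) rt.
exact: cofinal_trans rs rt.
Qed.

Lemma end_of_eq r s : geodesic_ray adj s ->
  end_of adj r = end_of adj s -> cofinal r s.
Proof.
move=> sG E; have : end_of adj s s by split=> //; exact: cofinal_refl.
by rewrite -E => -[].
Qed.

Lemma aut_geodesic g r : geodesic_ray adj r -> geodesic_ray adj ((g : V -> V) \o r).
Proof.
move=> [rA rD]; split=> [n|m n p pP pL]; first by rewrite /= aut_adj.
rewrite -(size_map (g^-1)%g p); apply: rD.
  by rewrite -(autK g (r m)) (mono_path (e := adj)) // => x y; rewrite aut_adj.
by rewrite -{1}(autK g (r m)) last_map pL; exact: autK.
Qed.

Lemma end_act_end_of g r : geodesic_ray adj r ->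
  end_act g (end_of adj r) = end_of adj ((g : V -> V) \o r).
Proof.
move=> rG; apply/seteqP; split=> t.
  case=> s [sG [m [n E]]] <-; split; first exact: aut_geodesic.
  by exists m, n => i; rewrite /= E.
case=> tG [m [n E]]; exists ((g^-1)%g \o t); last first.
  by apply/funext => i; exact: autVK.
split; first exact: aut_geodesic.
by exists m, n => i; rewrite /= -E; apply/esym/autK.
Qed.

End GraphEnds.

Section Lines.
Implicit Types (x y : T3) (v w : int -> T3) (r s : nat -> T3).

Lemma level_adj x y : adjT3 x y -> `|level y - level x| <= 1.
Proof. by case/adjT3P => ->; rewrite level_parent; lia. Qed.

Lemma level_path x p : path adjT3 x p -> `|level (last x p) - level x| <= (size p)%:Z.
Proof.
elim: p x => [|y p IH] x /=; first by rewrite subrr normr0.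
by move=> /andP[/level_adj xy /IH]; lia.
Qed.

(** An edge changes the level by at most 1, so a ray whose level moves by 1 in a constant direction
    takes no detour. *)
Lemma level_geodesic r (e : int) : `|e| = 1 ->
  (forall n, adjT3 (r n) (r n.+1)) ->
  (forall n : nat, level (r n) = level (r 0) + e * n%:Z) -> geodesic_ray adjT3 r.
Proof.
move=> e1 rA rL; split=> // m n p /level_path H E; rewrite -lez_nat; apply: le_trans H.
rewrite E (rL m) (rL n).
by have [->|->] : e = 1 \/ e = -1 by [lia]; lia.
Qed.

(** After one step away from omega a geodesic ray can never turn back to a parent. *)
Lemma geodesic_cases r : geodesic_ray adjT3 r ->
  (forall n, r n.+1 = parent (r n)) \/
  exists N, forall i, parent (r (N + i).+1) = r (N + i)%N.
Proof.
move=> [rA rD]; have [H|/existsNP[N HN]] := pselect (forall n, r n.+1 = parent (r n)).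
  by left.
right; exists N; elim=> [|i IH].
  by rewrite addn0; case/adjT3P: (rA N) => // ->.
rewrite addnS; case/adjT3P: (rA (N + i).+1) => // E.
(* Otherwise [r] takes the same value at [N + i] and [N + i + 2], and the empty path joins the
   two. *)
have := rD (N + i)%N (N + i).+2 [::] isT; rewrite /= E IH => /(_ erefl).
by rewrite -addn2 addnC addnK.
Qed.

(** Lines are the bi-infinite geodesics issued from omega; indexing by the level leaves no freedom
    of parametrization. *)
Definition is_line v := forall i, level (v i) = i /\ parent (v (i + 1)) = v i.

Definition line_end v : set (nat -> T3) := end_of adjT3 (fun n => v n%:Z).

Lemma line_parent v i : is_line v -> parent (v i) = v (i - 1).
Proof. by move=> /(_ (i - 1))[_]; rewrite subrK. Qed.

Lemma line_iter_parent v k i : is_line v -> iter k parent (v i) = v (i - k%:Z).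
Proof.
move=> vL; elim: k => [|k IH] /=; first by rewrite subr0.
by rewrite IH line_parent //; congr v; lia.
Qed.

Lemma line_geodesic v : is_line v -> geodesic_ray adjT3 (fun n => v n%:Z).
Proof.
move=> vL; apply: (@level_geodesic _ 1) => // [n|n].
  by apply/adjT3P; right; rewrite line_parent //; congr v; lia.
by rewrite !(vL _).1; lia.
Qed.

Lemma omega_ray_geodesic : geodesic_ray adjT3 (fun n => vertex n [::]).
Proof.
apply: (@level_geodesic _ (-1)) => // [n|n].
  by apply/adjT3P; left; rewrite parent_vertex.
by rewrite !level_vertex /=; lia.
Qed.

Lemma boundary_omega : boundary adjT3 omega.
Proof. by exists (fun n => vertex n [::]) => //; exact: omega_ray_geodesic. Qed.

Lemma descending_omega r : (forall n, r n.+1 = parent (r n)) -> omega r.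
Proof.
move=> rP; have rE n : r n = iter n parent (r 0) by elim: n => //= n <-.
split.
  apply: (@level_geodesic _ (-1)) => // [n|n]; first by apply/adjT3P; left.
  by rewrite rE level_iter_parent; lia.
have [k [n H]] := parent_reaches_root (r 0).
by exists n, k => i; rewrite rE [(k + i)%N]addnC H addnC.
Qed.

Lemma line_omega v : is_line v -> omega (fun n => v (- n%:Z)).
Proof.
move=> vL; apply: descending_omega => n; rewrite line_parent //.
by congr v; lia.
Qed.

(** The ancestors of [v 0] are eventually roots of copies, and the level tells of which copy. *)
Lemma line_root v : is_line v ->
  exists N : nat, forall n : nat, (N <= n)%N -> v (- n%:Z) = vertex n [::].
Proof.
move=> vL; have [k [n H]] := parent_reaches_root (v 0).
exists k => i /subnK ki; have := H (i - k)%N; rewrite ki line_iter_parent // sub0r.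
move=> ->; have := congr1 level (H (i - k)%N).
rewrite ki line_iter_parent // (vL _).1 level_vertex /= => E.
by congr vertex; lia.
Qed.

Lemma line_end_punctured v : is_line v -> punctured_boundary (line_end v).
Proof.
move=> vL; split.
  by exists (fun n => v n%:Z) => //; exact: line_geodesic.
move/end_of_eq => /(_ omega_ray_geodesic)[m [n E]].
have := congr1 level (E 0%N); have := congr1 level (E 1%N).
by rewrite !(vL _).1 !level_vertex /=; lia.
Qed.

Lemma punctured_boundaryP E : punctured_boundary E ->
  exists2 v, is_line v & E = line_end v.
Proof.
move=> [[r rG <-] rO]; have [H|[N H]] := geodesic_cases rG.
  case: rO; apply: end_of_cofinal.
  by have [_] := descending_omega H; exact: cofinal_sym.
pose l := level (r N).
have rL i : level (r (N + i)%N) = l + i%:Z.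
  elim: i => [|i IH]; first by rewrite addn0 addr0.
  have := level_parent (r (N + i).+1); rewrite H IH addnS => /eqP.
  by rewrite eq_sym subr_eq => /eqP->; lia.
(* From level [l] upwards the line follows the ray; below, it consists of the ancestors of [r N]. *)
pose v i := if l <= i then r (N + `|(i - l)%R|)%N else iter `|(i - l)%R|%N parent (r N).
exists v.
  move=> i; split; rewrite /v.
    by case: ifP => li; rewrite ?rL ?level_iter_parent -/l; lia.
  have [li|li] := lerP l i.
    have -> : l <= i + 1 by lia.
    have -> : (`|(i + 1 - l)%R| = `|(i - l)%R|.+1)%N by lia.
    by rewrite addnS H.
  case: ifP => li'.
    have -> : (`|(i + 1 - l)%R| = 0)%N by lia.
    have -> : (`|(i - l)%R| = 1)%N by lia.
    by rewrite addn0.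
  by have -> : (`|(i - l)%R| = `|(i + 1 - l)%R|.+1)%N by lia.
apply: end_of_cofinal; exists (N + `|l|)%N, (`|(l + `|l|%N%:Z)%R|)%N => i.
rewrite /v ifT; last by lia.
by congr r; lia.
Qed.

End Lines.

(** * Automorphisms commuting with the parent map, and their action on lines *)

Section ParentPreserving.
Implicit Types (g h : aut adjT3) (v w : int -> T3).

Definition parent_preserving g := forall x, parent (g x) = g (parent x).

Lemma parent_preserving1 : parent_preserving 1%g. Proof. by []. Qed.

Lemma parent_preservingM g h :
  parent_preserving g -> parent_preserving h -> parent_preserving (g * h)%g.
Proof. by move=> gP hP x; rewrite !autM hP gP. Qed.

Lemma parent_preservingV g : parent_preserving g -> parent_preserving g^-1%g.
Proof. by move=> gP x; apply: (aut_inj (g := g)); rewrite -gP !autVK. Qed.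

Definition translation g : int := level (g (vertex 0 [::])).

Lemma parent_preserving_iter g k x : parent_preserving g ->
  iter k parent (g x) = g (iter k parent x).
Proof. by move=> gP; elim: k => //= k ->; rewrite gP. Qed.

(** Every vertex shares an ancestor with the root of the copy 0, so the level changes by the same
    amount everywhere. *)
Lemma level_translation g x : parent_preserving g -> level (g x) = level x + translation g.
Proof.
move=> gP; elim/T3_ind: x => n v.
have E : iter (size v) parent (vertex n v) = iter n parent (vertex 0 [::]).
  by rewrite iter_parent_vertex iter_parent_nil addn0.
have := congr1 (fun x => level (g x)) E; rewrite -!parent_preserving_iter //.
by rewrite !level_iter_parent -/(translation g) level_vertex; lia.
Qed.

Lemma translationM g h : parent_preserving g -> parent_preserving h ->
  translation (g * h)%g = translation g + translation h.
Proof. by move=> gP hP; rewrite {1}/translation autM level_translation. Qed.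

(** The image line is reindexed so that its parameter is again the level. *)
Definition push g v : int -> T3 := fun i => g (v (i - translation g)).

Lemma push_line g v : parent_preserving g -> is_line v -> is_line (push g v).
Proof.
move=> gP vL i; rewrite /push level_translation // (vL _).1; split; first by lia.
by rewrite gP line_parent //; congr (g (v _)); lia.
Qed.

Lemma pushM g h v : parent_preserving g -> parent_preserving h ->
  push (g * h)%g v = push h (push g v).
Proof.
move=> gP hP; apply/funext => i; rewrite /push autM translationM //.
by congr (h (g (v _))); lia.
Qed.

Lemma push1 v : push 1%g v = v.
Proof. by apply/funext => i; rewrite /push /translation level_vertex /= !subr0. Qed.

Lemma end_act_line g v : parent_preserving g -> is_line v ->
  end_act g (line_end v) = line_end (push g v).
Proof.
move=> gP vL; rewrite end_act_end_of; last exact: line_geodesic.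
apply: end_of_cofinal; exists `|translation g|%N,
  `|(translation g + `|translation g|%N%:Z)%R|%N => i /=.
by rewrite /push; congr (g (v _)); lia.
Qed.

Lemma parent_preserving_stab g : parent_preserving g -> end_stabilizer omega g.
Proof.
move=> gP; rewrite /end_stabilizer /= end_act_end_of; last exact: omega_ray_geodesic.
apply/esym/end_of_cofinal.
have [|_] := @descending_omega (g \o (fun n => vertex n [::])); last by [].
by move=> n /=; rewrite gP parent_vertex.
Qed.

Lemma end_act_punctured g E : parent_preserving g ->
  punctured_boundary E -> punctured_boundary (end_act g E).
Proof.
move=> gP /punctured_boundaryP[v vL ->]; rewrite end_act_line //.
exact/line_end_punctured/push_line.
Qed.

Lemma line_vertex x : exists2 v, is_line v & v (level x) = x.
Proof.
pose v i := if i <= level x then iter `|(level x - i)%R|%N parent x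
  else iter `|(i - level x)%R|%N (child^~ false) x.
have lc k y : level (iter k (child^~ false) y) = level y + k%:Z.
  by elim: k => [|k IH]; rewrite ?addr0 //= level_child IH; lia.
exists v; last by rewrite /v lexx subrr.
move=> i; rewrite /v; split.
  by case: ifP => ?; rewrite ?lc ?level_iter_parent; lia.
have [li|li] := lerP (i + 1) (level x).
  rewrite ifT; last by lia.
  by have -> : (`|(level x - i)%R| = `|(level x - (i + 1))%R|.+1)%N by lia.
have -> : (`|(i + 1 - level x)%R| = `|(i - level x)%R|.+1)%N by lia.
rewrite iterS parent_child; case: ifP => // li'.
have -> : (`|(level x - i)%R| = 0)%N by lia.
by have -> : (`|(i - level x)%R| = 0)%N by lia.
Qed.

(** Every vertex lies on a line, so only a shift along the lines has to be excluded. *)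
Lemma push_faithful g : parent_preserving g ->
  (forall v, is_line v -> push g v = v) -> g = 1%g.
Proof.
move=> gP H; apply: autP => x; have [v vL vx] := line_vertex x.
have s0 : translation g = 0.
  (* The lines [p] and [q] coincide up to level 0 and differ from level 1 on; as [g] preserves both,
     it cannot shift their branching. *)
  pose o := vertex 0 [::].
  have [p pL p1] := line_vertex (child o false).
  have [q qL q1] := line_vertex (child o true).
  rewrite !level_child !level_vertex /= subrr add0r in p1 q1.
  have pq1 : p 1 <> q 1.
    by rewrite p1 q1 => /(congr1 letter); rewrite !letter_child.
  have pq0 : p 0 = q 0.
    by rewrite -(line_parent 1 pL) -(line_parent 1 qL) p1 q1 !parent_child.
  have below k : p (- k%:Z) = q (- k%:Z).
    by rewrite -(sub0r k%:Z) -!line_iter_parent // pq0.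
  have above i : 1 <= i -> p i <> q i.
    move=> i1 /(congr1 (iter `|(i - 1)%R|%N parent)); rewrite !line_iter_parent //.
    by have -> : i - `|(i - 1)%R|%N%:Z = 1 by lia.
  have pE i := congr1 (fun w => w i) (H p pL).
  have qE i := congr1 (fun w => w i) (H q qL).
  have [h0|h0|//] := ltgtP (translation g) 0.
    case: (above (- translation g)); first by lia.
    by apply: (aut_inj (g := g)); rewrite -(sub0r (translation g)) [LHS]pE [RHS]qE.
  case: pq1; rewrite -pE -qE /push; congr (g _).
  by have -> : 1 - translation g = - `|(translation g - 1)%R|%N%:Z by lia.
by have := congr1 (fun w => w (level x)) (H v vL); rewrite /push s0 subr0 vx.
Qed.

End ParentPreserving.

(** * 2-adic numbers *)

Section Rational.
Variable R : realType.
Local Notation abs2 := (@abs2 R).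

Lemma abs2_isosceles p q : abs2 q < abs2 p -> abs2 (p + q) = abs2 p.
Proof.
move=> qp; apply/eqP; rewrite eq_le; apply/andP; split.
  by apply: le_trans (abs2D _ _ _) _; rewrite ge_max lexx ltW.
have := abs2D R (p + q) (- q); rewrite addrK abs2N le_max => /orP[//|].
by rewrite leNgt qp.
Qed.

Lemma abs2_2 : abs2 2%:R = 2%:R^-1.
Proof.
have H : val2 2%:R = 1 by rewrite -(divr1 2%:R) (@val2_frac 2 1) // subr0.
by rewrite /Defs.abs2 pnatr_eq0 /= H -exprN1.
Qed.

Lemma abs2_exp2 (i : int) : abs2 (2%:R ^ i) = 2%:R ^ (- i).
Proof.
have H n : abs2 (2%:R ^+ n) = 2%:R ^- n.
  by elim: n => [|n IH]; rewrite ?abs2_1 ?invr1 // !exprS abs2M IH abs2_2 invfM.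
by case: i => n; rewrite ?NegzE -?exprnN ?abs2V H -?exprnP ?invrK // exprnN.
Qed.

Lemma abs2_int (n : int) : abs2 n%:~R <= 1.
Proof.
have H m : abs2 m%:R <= 1.
  elim: m => [|m IH]; first by rewrite abs2_0 ler01.
  by rewrite -natr1; apply: le_trans (abs2D _ _ _) _; rewrite ge_max abs2_1 IH /=.
by case: n => m; rewrite ?NegzE ?mulrNz ?abs2N; exact: H.
Qed.

Lemma abs2_int_half (n : int) : abs2 (2%:R * n%:~R) <= 2%:R^-1.
Proof.
by rewrite abs2M abs2_2 -[leRHS]mulr1 ler_wpM2l ?abs2_int // invr_ge0.
Qed.

Lemma half_lt1 : 2%:R^-1 < 1 :> R.
Proof. by rewrite invf_lt1 ?ltr1n. Qed.

Lemma abs2_odd (n : int) : abs2 (1 + 2%:R * n%:~R) = 1.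
Proof.
rewrite abs2_isosceles abs2_1 //.
by apply: le_lt_trans (abs2_int_half n) half_lt1.
Qed.

Lemma int_parity (n : int) : exists m : int, n = 2 * m \/ n = 1 + 2 * m.
Proof. by exists (divz n 2); lia. Qed.

(** The residue field has two elements. An even denominator would force an odd numerator and an
    absolute value above 1; with an odd denominator the parity of the numerator decides. *)
Lemma abs2_residue (q : rat) : abs2 q <= 1 ->
  abs2 q <= 2%:R^-1 \/ abs2 (q - 1) <= 2%:R^-1.
Proof.
have dn0 : (denq q)%:~R != 0 :> rat by rewrite intr_eq0 denq_neq0.
have qE : (numq q)%:~R = q * (denq q)%:~R by rewrite numqE.
have absn : abs2 (numq q)%:~R = abs2 q * abs2 (denq q)%:~R by rewrite qE abs2M.
have [n nE] := int_parity (numq q); have [d dE] := int_parity (denq q).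
case: dE => dE q1.
  have nE' : numq q = 1 + 2 * n.
    case: nE => // nE; have := coprime_num_den q.
    by rewrite nE dE !abszM coprimeMl => /andP[]; rewrite coprimeMr.
  move: absn; rewrite nE' intrD intrM abs2_odd => absn.
  have : abs2 q * abs2 (denq q)%:~R < 1.
    rewrite -[ltRHS]mul1r; apply: le_lt_trans (_ : 1 * abs2 (denq q)%:~R < _).
      by rewrite ler_wpM2r ?abs2_ge0.
    rewrite !mul1r dE intrM; exact: le_lt_trans (abs2_int_half d) half_lt1.
  by rewrite -absn ltxx.
have absd : abs2 (denq q)%:~R = 1 by rewrite dE intrD intrM abs2_odd.
rewrite absd mulr1 in absn.
case: nE => nE; first by left; rewrite -absn nE intrM abs2_int_half.
right; have -> : abs2 (q - 1) = abs2 (2%:R * (n - d)%:~R).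
  rewrite -[LHS]mulr1 -absd -abs2M mulrBl -qE mul1r; congr Defs.abs2.
  by rewrite nE dE !intrD !intrM mulrNz; ring.
exact: abs2_int_half.
Qed.

End Rational.

Section TwoAdic.
Variable R : realType.
Local Notation abs2 := (@abs2 R).
Local Notation norm2 := (@norm2 R).
Local Notation Q2 := (Q2 R).
Implicit Types x y z : Q2.

Lemma cst_cauchy (q : rat) : (fun=> q) \in @cauchy2 R.
Proof. by apply/asboolP => e e0; exists 0%N => m n _ _; rewrite subrr abs2_0. Qed.

Definition emb (q : rat) : Q2 := pi2 (CauchySeq (cst_cauchy q)).

Lemma emb_additive : additive emb.
Proof.
by move=> p q; rewrite /emb -pi2N -pi2D; congr pi2; apply/val_inj/funext.
Qed.

Lemma emb_multiplicative : multiplicative emb.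
Proof.
split=> [p q|]; last first.
  rewrite /emb -pi2_1; by congr pi2; apply/val_inj/funext.
by rewrite /emb -pi2M; congr pi2; apply/val_inj/funext.
Qed.

HB.instance Definition _ := GRing.isZmodMorphism.Build rat Q2 emb emb_additive.
HB.instance Definition _ := GRing.isMonoidMorphism.Build rat Q2 emb
  (conj emb_multiplicative.2 emb_multiplicative.1).

Lemma norm2_emb q : norm2 (emb q) = abs2 q.
Proof.
rewrite norm2_pi; apply/cvg_lim => //; rewrite /=. apply: (@cvg_cst _ _ nat).
Qed.

Lemma norm2_cvg z : (fun n => abs2 (repr2 z n)) @ \oo --> norm2 z.
Proof. exact: cvg_abs2. Qed.

Lemma norm2_ge0 z : 0 <= norm2 z.
Proof.
apply: limr_ge; first exact: cvg_abs2.
by apply: nearW => n; exact: abs2_ge0.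
Qed.

Lemma norm2_eq0 z : (norm2 z == 0) = (z == 0).
Proof.
apply/eqP/eqP => [z0|->]; last by rewrite -(rmorph0 emb) norm2_emb abs2_0.
by apply: (@dist2_eq0 R); rewrite /dist2 subr0.
Qed.

Lemma norm2N z : norm2 (- z) = norm2 z.
Proof. by have := dist2_sym 0 z; rewrite /dist2 sub0r subr0. Qed.

Lemma norm2M x y : norm2 (x * y) = norm2 x * norm2 y.
Proof.
rewrite -{1}(repr2K x) -{1}(repr2K y) -pi2M norm2_pi; apply/cvg_lim => //.
under eq_fun do rewrite abs2M.
by apply: cvgM; exact: norm2_cvg.
Qed.

Lemma norm2D x y : norm2 (x + y) <= Num.max (norm2 x) (norm2 y).
Proof.
rewrite -{1}(repr2K x) -{1}(repr2K y) -pi2D norm2_pi.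
pose m n := Num.max (abs2 (repr2 x n)) (abs2 (repr2 y n)).
have mc : m @ \oo --> Num.max (norm2 x) (norm2 y).
  rewrite /m; under eq_fun do rewrite maxr_absE.
  rewrite maxr_absE; have xc := @norm2_cvg x; have yc := @norm2_cvg y.
  apply: cvgM; last exact: (@cvg_cst _ _ nat).
  by apply: cvgD; [exact: cvgD|apply: cvg_norm; exact: cvgB].
rewrite -(cvg_lim _ mc) //; apply: ler_lim; first exact: cvg_abs2.
  by apply/cvg_ex; eexists; exact: mc.
by apply: nearW => n; exact: abs2D.
Qed.

Lemma norm2_isosceles x y : norm2 y < norm2 x -> norm2 (x + y) = norm2 x.
Proof.
move=> yx; apply/eqP; rewrite eq_le; apply/andP; split.
  by apply: le_trans (norm2D _ _) _; rewrite ge_max lexx ltW.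
have := norm2D (x + y) (- y); rewrite addrK norm2N le_max => /orP[//|].
by rewrite leNgt yx.
Qed.

Lemma norm2_exp2 (i : int) : norm2 (2%:R ^ i) = 2%:R ^ (- i).
Proof. by rewrite -(rmorph_nat emb) -fmorphXz norm2_emb abs2_exp2. Qed.

Lemma norm2_approx (u : cauchy_seq R) (c : R) n :
  (forall k, (n <= k)%N -> abs2 (u k - u n) <= c) ->
  norm2 (pi2 u - emb (u n)) <= c.
Proof.
move=> H; rewrite /emb -pi2N -pi2D norm2_pi; apply: limr_le.
  exact: (@cvg_abs2 R (u - CauchySeq (cst_cauchy (u n)))).
by exists n => // k /= nk; exact: H.
Qed.

(** Up to an error of norm at most 1/2 a 2-adic number is rational, which reduces the claim to
    [abs2_residue]. *)
Lemma norm2_residue z : norm2 z <= 1 ->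
  norm2 z <= 2%:R^-1 \/ norm2 (z - 1) <= 2%:R^-1.
Proof.
have [q zq] : exists q, norm2 (z - emb q) <= 2%:R^-1.
  have [|N H] := asboolP _ (valP (repr2 z)) 2%:R^-1; first by rewrite invr_gt0.
  exists (repr2 z N); rewrite -{1}(repr2K z).
  by apply: norm2_approx => k Nk; apply/ltW/H.
move=> z1; have q1 : abs2 q <= 1.
  rewrite -norm2_emb -[emb q](subKr z); apply: le_trans (norm2D _ _) _.
  by rewrite norm2N ge_max z1 (le_trans zq) // invf_le1 ?ler1n.
have [qh|qh] := abs2_residue q1; [left|right].
  rewrite -(subrK (emb q) z); apply: le_trans (norm2D _ _) _.
  by rewrite ge_max zq norm2_emb.
rewrite -(subrK (emb q) z) -addrA; apply: le_trans (norm2D _ _) _.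
by rewrite ge_max zq -(rmorph1 emb) -rmorphB norm2_emb.
Qed.

Lemma Q2_cvgP (s : nat -> Q2) z : s @ \oo --> z <->
  (forall e : R, 0 < e -> exists N, forall n, (N <= n)%N -> norm2 (z - s n) < e).
Proof.
split=> [/cvg_ballP H e /H|H].
  by case=> N _ HN; exists N => n /HN; rewrite ballEmdist.
apply/cvg_ballP => e /H[N HN]; by exists N => // n /= /HN.
Qed.

End TwoAdic.

(** * Binary expansions: lines and their 2-adic coordinates *)

Section Digits.
Variable R : realType.
Local Notation abs2 := (@abs2 R).
Local Notation norm2 := (@norm2 R).
Local Notation Q2 := (Q2 R).
Implicit Types (x y : int -> bool) (z : Q2) (v w : int -> T3).

Definition rat_digit_sum x n : rat :=
  \sum_(k < n.*2) (x (k%:Z - n%:Z))%:R * 2%:R ^ (k%:Z - n%:Z).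

Lemma digit_sum_emb x n : digit_sum R x n = emb R (rat_digit_sum x n).
Proof.
rewrite /digit_sum rmorph_sum; apply: eq_bigr => k _.
by rewrite rmorphM fmorphXz !rmorph_nat.
Qed.

Lemma digit_sumS x n : rat_digit_sum x n.+1 =
  (x (- n.+1%:Z))%:R * 2%:R ^ (- n.+1%:Z) + rat_digit_sum x n
  + (x n%:Z)%:R * 2%:R ^ n%:Z.
Proof.
rewrite /rat_digit_sum doubleS big_ord_recl big_ord_recr /= addrA sub0r.
congr (_ + _ + _).
  apply: eq_bigr => k _; rewrite /bump /= add1n.
  by have -> : k.+1%:Z - n.+1%:Z = k%:Z - n%:Z by lia.
rewrite /bump /= add1n.
by have -> : (n.*2).+1%:Z - n.+1%:Z = n%:Z by lia.
Qed.

Lemma abs2_digit (b : bool) (i : int) : abs2 (b%:R * 2%:R ^ i) <= 2%:R ^ (- i).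
Proof.
rewrite abs2M abs2_exp2; case: b; first by rewrite abs2_1 mul1r.
by rewrite abs2_0 mul0r exprz_ge0.
Qed.

Lemma abs2_digit_diff (b c : bool) (i : int) :
  abs2 ((b%:R - c%:R) * 2%:R ^ i) <= 2%:R ^ (- i).
Proof.
case: b c => -[].
- by rewrite subrr mul0r abs2_0 exprz_ge0.
- by rewrite subr0 (abs2_digit true).
- by rewrite sub0r mulNr abs2N (abs2_digit true).
- by rewrite subrr mul0r abs2_0 exprz_ge0.
Qed.

Lemma exp2_le (i j : int) : i <= j -> 2%:R ^ (- j) <= 2%:R ^ (- i) :> R.
Proof. by move=> ij; rewrite ler_eXz2l ?ltr1n // lerN2. Qed.

Lemma exp2_lt (i j : int) : i < j -> 2%:R ^ (- j) < 2%:R ^ (- i) :> R.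
Proof. by move=> ij; rewrite ltr_eXz2l ?ltr1n // ltrN2. Qed.

Lemma exp2_small (e : R) : 0 < e -> exists N, forall n : nat, (N <= n)%N ->
  2%:R ^ (- n%:Z) < e.
Proof.
move=> e0; exists (Num.truncn e^-1).+1 => n Nn.
rewrite -exprnN -[ltRHS]invrK ltf_pV2 ?posrE ?invr_gt0 ?exprn_gt0 //.
apply: lt_le_trans (truncnS_gt _) _.
by rewrite -natrX ler_nat (leq_trans Nn) // ltnW // ltn_expl.
Qed.

(** Past the lowest nonzero digit, a larger range only adds terms of exponent at least [n]. *)
Lemma digit_sum_tail x N : (forall n, (N <= n)%N -> x (- n%:Z) = false) ->
  forall n k, (N <= n)%N -> (n <= k)%N ->
  abs2 (rat_digit_sum x k - rat_digit_sum x n) <= 2%:R ^ (- n%:Z).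
Proof.
move=> xN n k Nn /subnK <-; elim: (k - n)%N => [|m IH].
  by rewrite subrr abs2_0 exprz_ge0.
rewrite addSn digit_sumS xN; last by lia.
rewrite mul0r add0r addrAC; apply: le_trans (abs2D _ _ _) _.
rewrite ge_max IH /=; apply: le_trans (abs2_digit _ _) _.
by apply: exp2_le; lia.
Qed.

(** The terms below [k] cancel, the one at [k] has absolute value [2 ^ (- k)] and the later ones are
    smaller, so the isosceles principle applies. *)
Lemma digit_sum_diff x y (k : int) (n : nat) : (`|k|%N < n)%N ->
  (forall i, i < k -> x i = y i) -> x k <> y k ->
  abs2 (rat_digit_sum x n - rat_digit_sum y n) = 2%:R ^ (- k).
Proof.
move=> kn xy xyk; rewrite /rat_digit_sum -sumrB.
(* The exponent [k] occurs in the sum at the index [k + n]. *)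
have jP : (`|(k + n%:Z)%R|%N < n.*2)%N by lia.
rewrite (bigD1 (Ordinal jP)) //=.
have -> : `|(k + n%:Z)%R|%N%:Z - n%:Z = k by lia.
have ck : abs2 ((x k)%:R * 2%:R ^ k - (y k)%:R * 2%:R ^ k) = 2%:R ^ (- k).
  rewrite -mulrBl abs2M abs2_exp2.
  by case: (x k) (y k) xyk => -[] // _;
    rewrite ?subr0 ?sub0r ?abs2N abs2_1 mul1r.
rewrite abs2_isosceles ck //.
apply: le_lt_trans (_ : 2%:R ^ (- (k + 1)) < _); last by apply: exp2_lt; lia.
elim/big_ind: _ => [|p q pc qc|i ik].
- by rewrite abs2_0 exprz_ge0.
- by apply: le_trans (abs2D _ _ _) _; rewrite ge_max pc.
rewrite -mulrBl.
have [ik'|ik'] := ltP (i%:Z - n%:Z) k.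
  by rewrite xy // subrr mul0r abs2_0 exprz_ge0.
apply: le_trans (abs2_digit_diff _ _ _) _; apply: exp2_le.
suff : i%:Z - n%:Z <> k by lia.
move=> E; case/eqP: ik; apply: val_inj => /=; lia.
Qed.

Definition line_digits v : int -> bool := fun i => letter (v i).

Definition line_coord v z :=
  is_line v /\ digit_sum R (line_digits v) @ \oo --> z.

Lemma line_digits_root v : is_line v ->
  exists N, forall n, (N <= n)%N -> line_digits v (- n%:Z) = false.
Proof.
move=> vL; have [N HN] := line_root vL; exists N => n Nn.
by rewrite /line_digits HN // letter_vertex.
Qed.

(** The rational partial sums are themselves a Cauchy sequence, and they represent the
    coordinate. *)
Lemma line_coord_ex v : is_line v -> exists z, line_coord v z.
Proof.
move=> vL; have [N HN] := line_digits_root vL.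
set x := line_digits v in HN.
have xC : rat_digit_sum x \in @cauchy2 R.
  apply/asboolP => e /exp2_small[M HM]; exists (maxn N M) => m n.
  rewrite !geq_max => /andP[Nm Mm] /andP[Nn Mn].
  wlog nm : m n Nm Mm Nn Mn / (n <= m)%N.
    move=> W; have /orP[?|?] := leq_total n m; first exact: W.
    by rewrite -opprB abs2N; exact: W.
  by apply: le_lt_trans (digit_sum_tail HN Nn nm) _; exact: HM.
exists (pi2 (CauchySeq xC)); split=> //; apply/Q2_cvgP => e /exp2_small[M HM].
exists (maxn N M) => n; rewrite geq_max => /andP[Nn Mn].
apply: le_lt_trans (HM n Mn); rewrite digit_sum_emb.
by apply: norm2_approx => k nk; exact: digit_sum_tail HN _ _ Nn nk.
Qed.

Lemma line_coord_fun v z z' : line_coord v z -> line_coord v z' -> z = z'.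
Proof.
move=> [vL /Q2_cvgP zv] [_ /Q2_cvgP zv']; apply/eqP; rewrite -subr_eq0 -norm2_eq0.
rewrite eq_le norm2_ge0 andbT leNgt; apply/negP => /[dup] /zv[N HN] /zv'[M HM].
have := HN (maxn N M) (leq_maxl _ _); have := HM (maxn N M) (leq_maxr _ _).
set s := digit_sum _ _ _; set e := norm2 (z - z') => sz' sz.
have : e < e; last by rewrite ltxx.
rewrite {1}/e -(subrK s z) -addrA; apply: le_lt_trans (norm2D _ _) _.
by rewrite gt_max sz -norm2N opprB.
Qed.

(** For lines, [k] is then the first level of disagreement, by [line_agree]. *)
Definition branch v w (k : int) := v (k - 1) = w (k - 1) /\ v k <> w k.

Lemma line_agree v w i j : is_line v -> is_line w -> v i = w i -> j <= i -> v j = w j.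
Proof.
move=> vL wL vwi ji; have -> : j = i - `|i - j|%N%:Z by lia.
by rewrite -!line_iter_parent // vwi.
Qed.

Lemma branch_ex v w : is_line v -> is_line w -> v <> w -> exists k, branch v w k.
Proof.
move=> vL wL vw.
have [j jvw] : exists j, v j <> w j.
  by apply/existsNP => H; apply: vw; exact/funext.
have [N HN] := line_root vL; have [M HM] := line_root wL.
(* Far enough towards omega both lines pass through roots of copies, so they agree at level [i]. *)
pose i := - (maxn N M)%:Z.
have vwi : v i = w i by rewrite HN ?HM ?leq_maxl ?leq_maxr.
have ij : i < j.
  by rewrite ltNge; apply/negP => ji; apply: jvw; exact: line_agree vwi ji.
have ex : exists n : nat, v (i + n%:Z) != w (i + n%:Z).
  by exists `|j - i|%N; apply/eqP; have -> : i + `|j - i|%N%:Z = j by lia.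
case: (ex_minnP ex) => -[|n] nP nmin; first by rewrite addr0 vwi eqxx in nP.
exists (i + n.+1%:Z); split; last exact/eqP.
have -> : i + n.+1%:Z - 1 = i + n%:Z by lia.
apply/eqP; apply: contraT => /nmin; by rewrite ltnn.
Qed.

(** For large [n] both coordinates are closer than [2 ^ (- k)] to their partial sums, whose mutual
    distance is exactly that. *)
Lemma branch_dist v w z z' k : line_coord v z -> line_coord w z' ->
  branch v w k -> norm2 (z - z') = 2%:R ^ (- k).
Proof.
move=> [vL /Q2_cvgP zv] [wL /Q2_cvgP zw] [vwk vwk'].
have k0 : 0 < 2%:R ^ (- k) :> R by rewrite exprz_gt0.
have [N HN] := zv _ k0; have [M HM] := zw _ k0.
pose n := maxn (maxn N M) `|k|.+1.
have Dn : norm2 (digit_sum R (line_digits v) n - digit_sum R (line_digits w) n)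
    = 2%:R ^ (- k).
  rewrite !digit_sum_emb -rmorphB norm2_emb; apply: digit_sum_diff.
  - exact: leq_maxr.
  - move=> i ik; rewrite /line_digits (line_agree vL wL vwk) //; lia.
  - by move=> E; apply: vwk'; apply: parent_letter_inj E; rewrite !line_parent.
have {}HN : norm2 (z - digit_sum R (line_digits v) n) < 2%:R ^ (- k).
  by apply: HN; rewrite /n; lia.
have {}HM : norm2 (z' - digit_sum R (line_digits w) n) < 2%:R ^ (- k).
  by apply: HM; rewrite /n; lia.
move: HN HM Dn; move: (digit_sum R (line_digits v) n) (digit_sum R (line_digits w) n).
move=> s s' zs zs' ss.
have -> : z - z' = (s - s') + ((z - s) - (z' - s')) by ring.
rewrite norm2_isosceles ss //; apply: le_lt_trans (norm2D _ _) _.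
by rewrite gt_max zs norm2N.
Qed.

Lemma line_coord_inj v w z : line_coord v z -> line_coord w z -> v = w.
Proof.
move=> vz wz; apply: contrapT => vw.
have [k /(branch_dist vz wz)] := branch_ex vz.1 wz.1 vw.
by move/eqP; rewrite subrr -(rmorph0 (emb R)) norm2_emb abs2_0 eq_sym expfz_eq0
  pnatr_eq0 andbF.
Qed.

Lemma line_of_digits x N : (forall n, (N <= n)%N -> x (- n%:Z) = false) ->
  exists2 v, is_line v & line_digits v = x.
Proof.
move=> xN.
(* [u M i] spells the digits up to level [i], starting from the root of the copy [M], which has
   level [-M]. For [M] at least [N], passing to the next copy only adds a leading zero. *)
pose u M i := vertex M (mkseq (fun k => x (k.+1%:Z - M%:Z)) `|(i + M%:Z)%R|).
have uS M i : (N <= M)%N -> - M%:Z <= i -> u M.+1 i = u M i.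
  move=> NM Mi; rewrite /u -(vertexS M).
  have -> : `|(i + M.+1%:Z)%R|%N = `|(i + M%:Z)%R|.+1 by lia.
  rewrite /mkseq /= (iotaDl 1 0) -map_comp (_ : 1 - M.+1%:Z = - M%:Z) ?xN //; last by lia.
  congr (vertex _ (_ :: _)); apply: eq_map => k /=; congr x; lia.
have uE M M' i : (N <= M)%N -> (M <= M')%N -> - M%:Z <= i -> u M' i = u M i.
  move=> NM /subnK <- Mi; elim: (M' - M)%N => // m IH.
  by rewrite addSn uS ?IH //; lia.
pose v i := u (maxn N `|i|%N) i.
have vE M i : (N <= M)%N -> (`|i| <= M)%N -> v i = u M i.
  by move=> NM iM; rewrite /v (@uE (maxn N `|i|%N) M) //; lia.
exists v.
  move=> i; split; first by rewrite /v /u level_vertex size_mkseq; lia.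
  pose M := maxn N `|i|.+1.
  rewrite !(vE M) /u /M; try by lia.
  have -> : `|(i + 1 + (maxn N `|i|.+1)%:Z)%R|%N =
    `|(i + (maxn N `|i|.+1)%:Z)%R|.+1 by lia.
  by rewrite mkseqS parent_rcons.
apply/funext => i; rewrite /line_digits (vE (maxn N `|i|.+1)); try by lia.
have [n nE] : exists n, `|(i + (maxn N `|i|.+1)%:Z)%R|%N = n.+1.
  by exists `|(i + (maxn N `|i|.+1)%:Z)%R|.-1; lia.
rewrite /u nE letter_vertex mkseqS last_rcons.
by congr x; lia.
Qed.

Lemma norm2_bound z : exists m : nat, norm2 z <= 2%:R ^ m%:Z.
Proof.
exists (Num.truncn (norm2 z)).+1; apply: le_trans (ltW (truncnS_gt _)) _.
by rewrite -exprnP -natrX ler_nat ltnW // ltn_expl.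
Qed.

Lemma line_coord_surj z : exists v, line_coord v z.
Proof.
have [m zm] := norm2_bound z.
(* [d] reads the residue modulo 2; [s] starts from a multiple of [z] of norm at most 1 and
   repeatedly subtracts the residue and halves. *)
pose d z := norm2 z > 2%:R^-1.
pose s n := iter n (fun z => (z - (d z)%:R) / 2%:R) (z * 2%:R ^ m%:Z).
have two0 : 2%:R != 0 :> Q2.
  by rewrite -(rmorph_nat (emb R)) fmorph_eq0 pnatr_eq0.
have s1 n : norm2 (s n) <= 1.
  elim: n => [|n IH] /=.
    rewrite norm2M norm2_exp2 -ler_pdivlMr ?exprz_gt0 // mul1r.
    by rewrite invr_expz opprK.
  rewrite norm2M -exprN1 norm2_exp2 opprK expr1z.
  rewrite -ler_pdivlMr ?ltr0n // div1r /d; case: ltP => zd; last by rewrite subr0.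
  by case: (norm2_residue IH) => //; rewrite leNgt zd.
have sE n : s n = (d (s n))%:R + 2%:R * s n.+1.
  by rewrite /= mulrC divfK // addrC subrK.
have s0 : s 0 = z * 2%:R ^ m%:Z by [].
clearbody s d.
pose x (i : int) := if i < - m%:Z then false else d (s `|(i + m%:Z)%R|%N).
have xN n : (m.+1 <= n)%N -> x (- n%:Z) = false.
  by move=> mn; rewrite /x ifT //; lia.
have [v vL vx] := line_of_digits xN; exists v; split=> //; rewrite vx.
(* The remainder after the digits below [n + m] is [2 ^ (n + m)] times an element of norm at most 1;
   the digit of exponent [i] is that of [s (i + m)]. *)
have zE n : z = digit_sum R x (n + m) + 2%:R ^ (n + m)%N%:Z * s (n + m + m)%N.
  elim: n => [|n IH].
    have H J : z * 2%:R ^ m%:Z =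
        \sum_(k < J) (d (s k))%:R * 2%:R ^ k%:Z + 2%:R ^ J%:Z * s J.
      elim: J => [|J IH]; first by rewrite big_ord0 add0r mul1r s0.
      rewrite IH big_ord_recr /= -addrA; congr (_ + _); rewrite {1}(sE J).
      by rewrite -!exprnP exprS; ring.
    have m0 : 2%:R ^ m%:Z != 0 :> Q2 by rewrite expfz_neq0.
    apply: (mulIf m0); rewrite (H m.*2) mulrDl; congr (_ + _); last first.
      by rewrite add0n -addnn -!exprnP exprD; ring.
    rewrite /digit_sum mulr_suml add0n; apply: eq_bigr => k _.
    rewrite -mulrA -expfzDr // subrK /x ifF; last by lia.
    by have -> : `|(k%:Z - m%:Z + m%:Z)%R|%N = k by lia.
  rewrite {1}IH !digit_sum_emb addSn digit_sumS xN; last by lia.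
  rewrite mul0r add0r [emb R (_ + _)]rmorphD rmorphM fmorphXz !rmorph_nat.
  rewrite -addrA; congr (_ + _); rewrite {1}sE /x ifF; last by lia.
  have -> : `|((n + m)%N%:Z + m%:Z)%R|%N = (n + m + m)%N by lia.
  by rewrite -!exprnP exprS; ring.
apply/Q2_cvgP => e /exp2_small[M HM]; exists (maxn m M) => n.
rewrite geq_max => /andP[/subnK <- Mn].
apply: le_lt_trans (HM _ Mn); rewrite {1}(zE (n - m)%N) addrC addKr.
by rewrite norm2M norm2_exp2 -[leRHS]mulr1 ler_wpM2l // exprz_ge0.
Qed.

End Digits.

(** * From tree automorphisms to dilations *)

Section DilationOf.
Variable R : realType.
Local Notation Q2 := (Q2 R).
Implicit Types (z : Q2) (v w : int -> T3) (g h : aut adjT3).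

Definition boundary_map g z : Q2 :=
  xget 0 (@line_coord R (push g (sval (cid (line_coord_surj z))))).

Lemma boundary_mapP g v z : parent_preserving g -> line_coord v z ->
  line_coord (push g v) (boundary_map g z).
Proof.
move=> gP vz; rewrite /boundary_map; case: cid => w wz /=.
have -> : w = v by exact: line_coord_inj wz vz.
apply: xgetPex; apply: line_coord_ex; exact: push_line vz.1.
Qed.

Lemma boundary_mapM g h z : parent_preserving g -> parent_preserving h ->
  boundary_map (g * h)%g z = boundary_map h (boundary_map g z).
Proof.
move=> gP hP; have [v vz] := line_coord_surj z.
apply: line_coord_fun (boundary_mapP (parent_preservingM gP hP) vz) _.
by rewrite pushM //; apply: boundary_mapP => //; exact: boundary_mapP.
Qed.

Lemma boundary_map1 z : boundary_map 1%g z = z.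
Proof.
have [v vz] := line_coord_surj z.
apply: (@line_coord_fun R v _ _ _ vz); rewrite -{1}(push1 v).
exact: (boundary_mapP parent_preserving1).
Qed.

Lemma boundary_mapK g : parent_preserving g ->
  cancel (boundary_map g) (boundary_map g^-1%g).
Proof.
move=> gP z; rewrite -boundary_mapM //; last exact: parent_preservingV.
by rewrite mulgV boundary_map1.
Qed.

Lemma boundary_map_bij g : parent_preserving g -> boundary_map g \in @is_bij Q2.
Proof.
move=> gP; apply/asboolP; exists (boundary_map g^-1%g); first exact: boundary_mapK.
by rewrite -{2}(invgK g); apply: boundary_mapK; exact: parent_preservingV.
Qed.

Lemma branch_push g v w k : branch v w k ->
  branch (push g v) (push g w) (k + translation g).
Proof.
move=> [E1 E2]; split; last by rewrite /push addrK => /aut_inj.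
by rewrite /push addrAC addrK E1.
Qed.

(** Pushing by [g] shifts the branching level of two lines by the translation of [g]. *)
Lemma boundary_map_dist g z z' : parent_preserving g ->
  mdist (boundary_map g z) (boundary_map g z') = 2%:R ^ (- translation g) * mdist z z'.
Proof.
move=> gP; have [->|/eqP zz'] := eqVneq z z'; first by rewrite !mdistxx mulr0.
have [v vz] := line_coord_surj z; have [w wz] := line_coord_surj z'.
have vw : v <> w by move=> E; apply: zz'; apply: line_coord_fun vz _; rewrite E.
have [k kP] := branch_ex vz.1 wz.1 vw.
have mdistE (a b : Q2) : mdist a b = norm2 (a - b) by [].
rewrite !mdistE (branch_dist vz wz kP).
rewrite (branch_dist (boundary_mapP gP vz) (boundary_mapP gP wz) (branch_push g kP)).
rewrite -expfzDr ?pnatr_eq0 //.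
by congr (_ ^ _); lia.
Qed.

Lemma scaling_continuous (f : Q2 -> Q2) (l : R) : 0 < l ->
  (forall z z', mdist (f z) (f z') = l * mdist z z') -> continuous f.
Proof.
move=> l0 fl z A /nbhs_ballP[e /= e0 eA].
apply/nbhs_ballP; exists (e / l) => [|y]; first exact: divr_gt0.
rewrite ballEmdist /= => zy; apply: eA.
by rewrite ballEmdist /= fl mulrC -ltr_pdivlMr.
Qed.

Lemma boundary_map_dilation g (gP : parent_preserving g) :
  Sym (boundary_map_bij gP) \in @dilation R Q2.
Proof.
have l0 h : 0 < 2%:R ^ (- translation h) :> R by rewrite exprz_gt0.
apply/asboolP; split.
- apply: (scaling_continuous (l0 g)) => z z'; exact: boundary_map_dist.
- apply: (scaling_continuous (l0 g^-1%g)) => z z'.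
  have E : (Sym (boundary_map_bij gP))^-1%g = Sym (boundary_map_bij (parent_preservingV gP)).
    apply: (@mulgI _ (Sym (boundary_map_bij gP))); rewrite mulgV.
    by apply/esym/val_inj/funext => y /=; exact: boundary_mapK.
  rewrite E; apply: boundary_map_dist; exact: parent_preservingV.
- by exists (2%:R ^ (- translation g)) => // z z'; exact: boundary_map_dist.
Qed.

Definition dil_of g (gP : parent_preserving g) : dil Q2 :=
  Dil (boundary_map_dilation gP).

(** Lines are determined by their coordinates, so the quotient of [g] by [h] preserves every line
    and [push_faithful] applies. *)
Lemma dil_of_inj g h (gP : parent_preserving g) (hP : parent_preserving h) :
  dil_of gP = dil_of hP -> g = h.
Proof.
move=> gh; have {}gh z : boundary_map g z = boundary_map h z.
  by have := congr1 (fun f : dil Q2 => (f : Q2 -> Q2) z) gh.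
apply: (@mulIg _ h^-1%g); rewrite mulgV; have hVP := parent_preservingV hP.
apply: push_faithful => [|v vL]; first exact: parent_preservingM.
have [z vz] := line_coord_ex R vL; rewrite pushM //.
apply: (line_coord_inj _ vz); rewrite -(boundary_mapK hP z) -gh.
by apply: boundary_mapP => //; exact: boundary_mapP.
Qed.

Lemma boundary_coordP E z : punctured_boundary E ->
  boundary_coord E z <-> exists2 v, line_coord v z & E = line_end v.
Proof.
move=> EP; split.
  case=> v [x [vl vc _ Ev zx]].
  have vL : is_line v by move=> i; rewrite vl vc parent_child.
  exists v; last first.
    have [w wL EE] := punctured_boundaryP EP.
    by move: Ev; rewrite EE => -[_]; exact: end_of_cofinal.
  split=> //; rewrite (_ : line_digits v = x) //; apply/funext => i.
  by rewrite /line_digits -(subrK 1 i) vc letter_child subrK.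
case=> v [vL vz] ->; exists v, (line_digits v); split=> // [i|i||].
- by have [] := vL i.
- by rewrite -{1}(vL i).2 child_parent.
- exact: line_omega.
- by split; [exact: line_geodesic|exact: cofinal_refl].
Qed.

Lemma dil_of_corresponds g (gP : parent_preserving g) : corresponds (dil_of gP) g.
Proof.
split=> [|E z EP]; first exact: parent_preserving_stab.
move=> /(boundary_coordP _ EP)[v vz Ev].
apply/boundary_coordP; first exact: end_act_punctured.
exists (push g v); first exact: boundary_mapP.
by rewrite Ev end_act_line //; exact: vz.1.
Qed.

End DilationOf.

(** * Closures of groups of tree automorphisms *)

Section PointwiseClosure.
Variables (V : choiceType) (adj : rel V).
Implicit Types (H : set (aut adj)) (g h : aut adj).

(** A basic neighbourhood for pointwise convergence prescribes finitely many values. *)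
Lemma closure_autP H g : closure H g <->
  forall s : seq V, exists2 h, H h & {in s, forall x, h x = g x}.
Proof.
split=> [Hg s|Hg].
  have : nbhs g [set h : aut adj | {in s, forall x, h x = g x}].
    elim: s => [|x s IH]; first by apply: filterS filterT => h _ x.
    have gx : nbhs g [set h : aut adj | h x = g x].
      have gx : nbhs (aut_fun g)
          (@proj V (fun=> discrete_topology V) x @^-1` [set g x]).
        exact: (@proj_continuous V (fun=> discrete_topology V) x (aut_fun g) [set g x]).
      exact: (@initial_continuous _ _ (@aut_fun V adj) g _ gx).
    apply: filterS (filterI gx IH) => h [/= hx hs] y.
    by rewrite inE => /predU1P[->//|/hs].
  by move=> /Hg[h [Hh hs]]; exists h.
(* The sets containing all elements of [H] that agree with [g] on some finite set form a filter; it
   is proper by assumption, contains [H] and converges to [g]. *)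
pose F : set_system (aut adj) := [set A | exists s : seq V,
  forall h, H h -> {in s, forall x, h x = g x} -> A h].
have FF : ProperFilter F.
  split; first by case=> s Fs; have [h Hh hs] := Hg s; exact: Fs Hh hs.
  split; first by exists [::].
  - move=> A B [s As] [t Bt]; exists (s ++ t) => h Hh hst.
    by split; [apply: As|apply: Bt] => // x xs; apply: hst; rewrite mem_cat xs ?orbT.
  - by move=> A B AB [s As]; exists s => h Hh hs; exact/AB/As.
have Fg : (@aut_fun _ adj) @ F --> aut_fun g.
  apply/cvg_sup => x A [B]; case; case=> W oW <- Wgx WA; apply: (filterS WA).
  by exists [:: x] => h _ hx; rewrite /= /aut_fun hx ?mem_head.
move=> A; rewrite nbhsE => -[B]; case; case=> O oO <- Og OA.
have FO : F A.
  by apply: (filterS OA); apply: Fg; apply: open_nbhs_nbhs.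
have FH : F H by exists [::].
exact: filter_ex (filterI FH FO).
Qed.

End PointwiseClosure.

Section ClosureGroup.
Variables (V : choiceType) (adj : rel V).
Implicit Types (H : set (aut adj)) (g h : aut adj) (E : set (nat -> V)).

Lemma closure_aut_group H : group_closed (mem H) -> group_closed (mem (closure H)).
Proof.
move=> [H1 HF]; have {}H1 : H 1%g by exact: set_mem.
have {}HF g h : H g -> H h -> H (g / h)%g.
  by move=> gH hH; apply/set_mem/HF; exact/mem_set.
split; first by apply/mem_set/subset_closure.
move=> g h /set_mem/closure_autP gH /set_mem/closure_autP hH.
apply/mem_set/closure_autP => s.
(* The inverses of [h'] and [h] agree at [g x] once [h'] and [h] agree at the preimage of [g x]
   under [h]. *)
have [g' Hg' gg'] := gH s; have [h' Hh' hh'] := hH [seq (h^-1)%g (g x) | x <- s].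
exists (g' / h')%g => [|x xs]; first exact: HF.
rewrite !autM gg' //; apply: (aut_inj (g := h')); rewrite autVK hh' ?autVK //.
by apply/mapP; exists x.
Qed.

Lemma end_actM g h E : end_act (g * h)%g E = end_act h (end_act g E).
Proof.
apply/seteqP; split=> r.
  by case=> s Es <-; exists ((g : V -> V) \o s) => //; exists s.
by case=> _ [s Es <-] <-; exists s.
Qed.

Lemma end_act1 E : end_act (1%g : aut adj) E = E.
Proof.
apply/seteqP; split=> r; first by case=> s Es <-.
by exists r.
Qed.

End ClosureGroup.

(** * Compactness: pointwise limits of automorphisms fixing a vertex *)

Section Ultralimit.

Lemma ultrafilter_pigeonhole (U : set_system nat) (T : eqType) (f : nat -> T)
  (l : seq T) : UltraFilter U -> (forall n, f n \in l) ->
  exists y, U [set n | f n = y].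
Proof.
move=> UU fl; have {}fl : U [set n | f n \in l] by apply: filterS filterT => n _ /=.
elim: l fl => [|y l IH] fl.
  by have [n] := filter_ex fl.
have [Uy|Uy] := in_ultra_setVsetC [set n | f n = y] UU; first by exists y.
apply: IH; apply: filterS (filterI fl Uy) => n [/=].
by rewrite inE => /predU1P[-> /(_ erefl)|].
Qed.

Fixpoint descendants k (x : T3) : seq T3 :=
  if k is k'.+1 then
    flatten [seq [:: child y false; child y true] | y <- descendants k' x]
  else [:: x].

Lemma descendantsP k x y : iter k parent y = x -> y \in descendants k x.
Proof.
elim: k y => [|k IH] y /=; first by move=> ->; exact: mem_head.
rewrite -iterS iterSr => /IH yk; apply/flattenP.
exists [:: child (parent y) false; child (parent y) true]; first exact: map_f.
by rewrite -{1}(child_parent y); case: (letter y); rewrite !inE eqxx ?orbT.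
Qed.

Local Notation u0 := (vertex 0 [::]).

Lemma orbit_finite (g : nat -> aut adjT3) x :
  (forall n, parent_preserving (g n)) -> (forall n, g n u0 = u0) ->
  exists l : seq T3, forall n, g n x \in l.
Proof.
move=> gP g0; elim/T3_ind: x => m v.
(* The root of the copy [m] is an ancestor of [u0], hence fixed by every [g n]; the images of
   [vertex m v] stay at depth [size v] below it. *)
exists (descendants (size v) (vertex m [::])) => n; apply: descendantsP.
have E : vertex m [::] = iter m parent u0 by rewrite iter_parent_nil addn0.
by rewrite parent_preserving_iter // iter_parent_vertex E -parent_preserving_iter // g0.
Qed.

(** Orbits being finite, [g n x] is constant along an ultrafilter for each [x]; the limit of the
    inverses inverts the limit map. *)
Lemma pointwise_limit (g : nat -> aut adjT3) :
  (forall n, parent_preserving (g n)) -> (forall n, g n u0 = u0) ->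
  exists h : aut adjT3, forall (s : seq T3) N,
    exists2 n, (N <= n)%N & {in s, forall x, g n x = h x}.
Proof.
move=> gP g0; have [U [UU Uoo]] := @ultraFilterLemma nat \oo _.
have gVP n : parent_preserving (g n)^-1%g by exact: parent_preservingV.
have gV0 n : ((g n)^-1)%g u0 = u0 by rewrite -{1}(g0 n) autK.
have ex_f x : exists y, U [set n | g n x = y].
  have [l gl] := orbit_finite x gP g0; exact: ultrafilter_pigeonhole UU gl.
have ex_f' x : exists y, U [set n | ((g n)^-1)%g x = y].
  have [l gl] := orbit_finite x gVP gV0; exact: ultrafilter_pigeonhole UU gl.
pose f x := sval (cid (ex_f x)); pose f' x := sval (cid (ex_f' x)).
have fU x : U [set n | g n x = f x] by rewrite /f; case: cid.
have f'U x : U [set n | ((g n)^-1)%g x = f' x] by rewrite /f'; case: cid.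
have fK : cancel f f'.
  move=> x; have [n [/= E <-]] := filter_ex (filterI (fU x) (f'U (f x))).
  by rewrite -E; exact: autK.
have f'K : cancel f' f.
  move=> x; have [n [/= E <-]] := filter_ex (filterI (f'U x) (fU (f' x))).
  by rewrite -E; exact: autVK.
have fbij : f \in @is_bij T3 by apply/asboolP; exists f'.
have faut : Sym fbij \in graph_aut adjT3.
  apply/asboolP => x y /=.
  by have [n [/= <- <-]] := filter_ex (filterI (fU x) (fU y)); rewrite aut_adj.
exists (Aut faut) => s N.
have : U [set n | (N <= n)%N /\ {in s, forall x, g n x = f x}].
  apply: filterI; first by apply: Uoo; exists N.
  elim: s => [|x s IH]; first by apply: filterS filterT.
  apply: filterS (filterI (fU x) IH) => n [/= E H] y.
  by rewrite inE => /predU1P[->|/H].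
by move=> /filter_ex[n [Nn H]]; exists n.
Qed.

End Ultralimit.

(** * The closure as a scale group acting 2-transitively *)

Section ScaleGroup.
Local Notation u0 := (vertex 0 [::]).
Variable H : set (aut adjT3).
Hypothesis groupH : group_closed (mem H).
Hypothesis parentH : forall g, H g -> parent_preserving g.
Hypothesis transH : vertex_transitive H.
(** This is 2-transitivity at a finite level, for vertices below different children of [u0];
    distinct heads exclude empty words. *)
Hypothesis pairH : forall P Q P' Q' : seq bool,
  size P = size Q -> size P' = size P -> size Q' = size P ->
  head false P != head false Q -> head false P' != head false Q' ->
  exists2 g, H g & g (vertex 0 P) = vertex 0 P' /\ g (vertex 0 Q) = vertex 0 Q'.

Lemma closure_parent_preserving g : closure H g -> parent_preserving g.
Proof.
move=> /closure_autP Hg x; have [h Hh hg] := Hg [:: x; parent x].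
by rewrite -!hg ?inE ?eqxx ?orbT // parentH.
Qed.

Lemma closure_memM g h : closure H g -> closure H h -> closure H (g * h)%g.
Proof.
move=> gH hH; apply/set_mem; apply: (group_closedM (closure_aut_group groupH));
  exact/mem_set.
Qed.

Lemma closure_memV g : closure H g -> closure H g^-1%g.
Proof.
move=> gH; apply/set_mem; apply: (group_closedV (closure_aut_group groupH)).
exact/mem_set.
Qed.

Lemma closure_scale_group : scale_group (closure H).
Proof.
split; first exact: closure_aut_group.
- exact: closed_closure.
- by move=> u v; have [g Hg gu] := transH u v; exists g => //; exact: subset_closure.
- exists omega; first exact: boundary_omega.
  by move=> g /closure_parent_preserving; exact: parent_preserving_stab.
Qed.

Lemma line_through_root v n : is_line v -> v 0 = u0 ->
  v n%:Z = vertex 0 (mkseq (fun i => letter (v i.+1%:Z)) n).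
Proof.
move=> vL v0; elim: n => // n IH.
rewrite mkseqS -child_vertex -IH -{1}(child_parent (v n.+1%:Z)) line_parent //.
by congr (child (v _) _); lia.
Qed.

(** The last common vertex of the two lines is moved to [u0]. *)
Lemma pair_normal_form E1 E2 :
  punctured_boundary E1 -> punctured_boundary E2 -> E1 <> E2 ->
  exists g v w, [/\ H g, is_line v /\ is_line w, end_act g E1 = line_end v,
    end_act g E2 = line_end w & [/\ v 0 = u0, w 0 = u0 & v 1 <> w 1]].
Proof.
move=> /punctured_boundaryP[v vL ->] /punctured_boundaryP[w wL ->] E12.
have vw : v <> w by move=> E; apply: E12; rewrite E.
have [k kP] := branch_ex vL wL vw.
have [g Hg gu] := transH (v (k - 1)) u0; have gP := parentH Hg.
have tk : translation g = 1 - k.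
  have := congr1 level gu; rewrite level_translation // (vL _).1 level_vertex /=; lia.
exists g, (push g v), (push g w); split=> //; first by split; exact: push_line.
- exact: end_act_line.
- exact: end_act_line.
- have [pk1 pk] := branch_push g kP.
  rewrite tk addrCA subrr addr0 subrr in pk1 pk.
  have p0 : push g v 0 = u0 by rewrite /push tk -gu; congr (g (v _)); lia.
  by split=> //; rewrite -pk1.
Qed.

(** Elements of [H] match the lines up to any finite level. They all fix [u0], so they have a
    pointwise limit, which matches the whole lines. *)
Lemma closure_pair v w v' w' :
  is_line v -> is_line w -> is_line v' -> is_line w' ->
  v 0 = u0 -> w 0 = u0 -> v' 0 = u0 -> w' 0 = u0 -> v 1 <> w 1 -> v' 1 <> w' 1 ->
  exists g, [/\ closure H g, push g v = v' & push g w = w'].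
Proof.
move=> vL wL vL' wL' v0 w0 v0' w0' vw vw'.
have ex_g n : exists g, H g /\ g (v n.+1%:Z) = v' n.+1%:Z /\ g (w n.+1%:Z) = w' n.+1%:Z.
  rewrite (line_through_root _ vL v0) (line_through_root _ wL w0).
  rewrite (line_through_root _ vL' v0') (line_through_root _ wL' w0').
  set P := mkseq _ _; set P' := mkseq _ _; set Q := mkseq _ _; set Q' := mkseq _ _.
  have letter1 a b : is_line a -> is_line b -> a 0 = u0 -> b 0 = u0 -> a 1 <> b 1 ->
    letter (a 1) != letter (b 1).
    move=> aL bL a0 b0 ab; apply/eqP => E; apply: ab; apply: parent_letter_inj E.
    by rewrite !line_parent // subrr a0.
  have [] := @pairH P Q P' Q'; rewrite ?size_mkseq //.
  - exact: (letter1 v w vL wL v0 w0 vw).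
  - exact: (letter1 v' w' vL' wL' v0' w0' vw').
  by move=> g gH gPQ; exists g.
pose g n := sval (cid (ex_g n)).
have gE n : H (g n) /\ g n (v n.+1%:Z) = v' n.+1%:Z /\ g n (w n.+1%:Z) = w' n.+1%:Z.
  exact: svalP (cid (ex_g n)).
have gH n : H (g n) by have [] := gE n.
have gv n : g n (v n.+1%:Z) = v' n.+1%:Z by have [_ []] := gE n.
have gw n : g n (w n.+1%:Z) = w' n.+1%:Z by have [_ []] := gE n.
have gP n : parent_preserving (g n) by exact: parentH.
have g0 n : g n u0 = u0.
  have := congr1 (iter n.+1 parent) (gv n).
  by rewrite parent_preserving_iter // !line_iter_parent // subrr v0 v0'.
have t0 n : translation (g n) = 0 by rewrite /translation g0 level_vertex.
have [h hP] := pointwise_limit gP g0.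
have hH : closure H h.
  by apply/closure_autP => s; have [n _ E] := hP s 0%N; exists (g n).
have hP' := closure_parent_preserving hH.
have h0 : translation h = 0.
  have [n _ E] := hP [:: u0] 0%N.
  by rewrite /translation -E ?mem_head // g0 level_vertex.
have line_eq a b : is_line a -> is_line b ->
    (forall n, g n (a n.+1%:Z) = b n.+1%:Z) -> push h a = b.
  move=> aL bL ab; apply/funext => i; rewrite /push h0 subr0.
  (* Since [n] is at least the absolute value of [i], level [i] lies below [n + 1], where [g n]
     already matches the lines. *)
  have [n Nn E] := hP [:: a i] `|i|%N; rewrite -E ?mem_head //.
  have -> : g n (a i) = push (g n) a i by rewrite /push t0 subr0.
  apply: (@line_agree _ _ n.+1%:Z) => //; last by lia.
    exact: push_line.
  by rewrite /push t0 subr0.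
by exists h; split=> //; exact: line_eq.
Qed.

Lemma closure_two_transitive : two_transitive_on (closure H) punctured_boundary.
Proof.
split; first by move=> g E /closure_parent_preserving; exact: end_act_punctured.
move=> E1 E2 F1 F2 E1P E2P F1P F2P E12 F12.
have [g [v [w [Hg [vL wL] gE1 gE2 [v0 w0 vw]]]]] := pair_normal_form E1P E2P E12.
have [h [v' [w' [Hh [vL' wL'] hF1 hF2 [v0' w0' vw']]]]] :=
  pair_normal_form F1P F2P F12.
have [f [fH fv fw]] := closure_pair vL wL vL' wL' v0 w0 v0' w0' vw vw'.
have fP := closure_parent_preserving fH.
have [gC hC] := (subset_closure Hg, subset_closure Hh).
exists (g * f * h^-1)%g; split.
- by apply: closure_memM; [exact: closure_memM|exact: closure_memV].
- by rewrite !end_actM gE1 end_act_line // fv -hF1 -end_actM mulgV end_act1.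
- by rewrite !end_actM gE2 end_act_line // fw -hF2 -end_actM mulgV end_act1.
Qed.

End ScaleGroup.

(** * Presentations and the action of an ascending HNN extension *)

Section Words.
Variable X : choiceType.
Implicit Types (w : word X) (G K : groupType).
Local Open Scope group_scope.

Lemma weval_nil G (f : X -> G) : weval f [::] = 1.
Proof. by rewrite /weval big_nil. Qed.

Lemma weval_cons G (f : X -> G) l w :
  weval f (l :: w) = (if l.2 then (f l.1)^-1 else f l.1) * weval f w.
Proof. by rewrite /weval big_cons. Qed.

Lemma weval_consF G (f : X -> G) s w : weval f ((s, false) :: w) = f s * weval f w.
Proof. exact: weval_cons. Qed.

Lemma weval_consT G (f : X -> G) s w :
  weval f ((s, true) :: w) = (f s)^-1 * weval f w.
Proof. exact: weval_cons. Qed.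

Lemma weval_cat G (f : X -> G) w1 w2 :
  weval f (w1 ++ w2) = weval f w1 * weval f w2.
Proof. by rewrite /weval big_cat. Qed.

Lemma weval_gen G (f : X -> G) s : weval f (gen s) = f s.
Proof. by rewrite weval_cons weval_nil mulg1. Qed.

Lemma weval_winv G (f : X -> G) w : weval f (winv w) = (weval f w)^-1.
Proof.
elim: w => [|[s e] w IH]; first by rewrite !weval_nil invg1.
rewrite -cat1s winv_cat !weval_cat IH invgM /winv /= !weval_cons !weval_nil /=.
by rewrite !mulg1; case: e => //=; rewrite invgK.
Qed.

Lemma weval_wsubst G (f : X -> G) (sigma : X -> word X) w :
  weval f (wsubst sigma w) = weval (fun s => weval f (sigma s)) w.
Proof.
elim: w => [|[s e] w IH]; first by rewrite !weval_nil.
by rewrite weval_cons -IH /wsubst /= weval_cat; case: e; rewrite ?weval_winv.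
Qed.

Lemma weval_morph G K (f : X -> G) (h : G -> K) w :
  h 1 = 1 -> {morph h : x y / x * y} -> h (weval f w) = weval (h \o f) w.
Proof.
move=> h1 hM; have hV x : h x^-1 = (h x)^-1.
  by apply: (@mulgI _ (h x)); rewrite -hM !mulgV.
elim: w => [|[s e] w IH]; first by rewrite !weval_nil.
by rewrite !weval_cons hM IH; case: e; rewrite /= ?hV.
Qed.

Lemma eq_weval G (f g : X -> G) w : f =1 g -> weval f w = weval g w.
Proof. by move=> fg; congr weval; exact/funext. Qed.

End Words.

Section Universal.
Variables (X : choiceType) (Rels : set (word X)).
Local Open Scope group_scope.

Lemma pres_classM w1 w2 :
  pres_class Rels (w1 ++ w2) = pres_class Rels w1 * pres_class Rels w2.
Proof. by rewrite -pres_class_cat. Qed.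

Lemma pres_class_nil : pres_class Rels [::] = 1. Proof. by []. Qed.

Lemma pres_class_weval w :
  pres_class Rels w = weval (fun s => pres_class Rels (gen s)) w.
Proof.
elim: w => [|[s e] w IH]; first by rewrite weval_nil.
rewrite -cat1s pres_classM IH weval_cat weval_cons weval_nil mulg1.
case: e => //=; congr (_ * _).
by rewrite -[RHS]/(pres_inv (pres_class Rels (gen s))) pres_class_winv.
Qed.

Variables (G : groupType) (h : X -> G).
Hypothesis hR : forall r, Rels r -> weval h r = 1.

(** This makes [pres_hom] independent of the representative (von Dyck). *)
Lemma pres_rel_weval w1 w2 : pres_rel Rels w1 w2 -> weval h w1 = weval h w2.
Proof.
elim=> // [? ? ? _ -> //|w3 w4 w5 w6 _ E1 _ E2|s e|r /hR ->].
- by rewrite !weval_cat E1 E2.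
- by rewrite !weval_cons !weval_nil mulg1; case: e; rewrite ?mulgV ?mulVg.
- by rewrite weval_nil.
Qed.

Definition pres_hom (x : presented Rels) : G := weval h (repr x).

Lemma pres_hom_class w : pres_hom (pres_class Rels w) = weval h w.
Proof. exact/pres_rel_weval/pres_repr. Qed.

Lemma pres_homM : {morph pres_hom : x y / x * y}.
Proof.
move=> x y; rewrite -{1}(pres_classK x) -{1}(pres_classK y) -pres_classM.
by rewrite pres_hom_class weval_cat.
Qed.

End Universal.

(** * Automorphisms of the binary tree and their sections *)

Section Rooted.
Implicit Types (g : aut adjT2) (v : seq bool).

Definition rooted g :=
  g [::] = [::] /\ forall v d, exists e, g (rcons v d) = rcons (g v) e.

Lemma rooted1 : rooted 1%g. Proof. by split=> // v d; exists d. Qed.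

Lemma rootedM g h : rooted g -> rooted h -> rooted (g * h)%g.
Proof.
move=> [g0 gr] [h0 hr]; split=> [|v d]; first by rewrite autM g0.
have [e E] := gr v d; have [e' E'] := hr (g v) e.
by exists e'; rewrite autM E E'.
Qed.

Lemma rootedV g : rooted g -> rooted g^-1%g.
Proof.
move=> [g0 gr]; split=> [|v d]; first by rewrite -{1}g0 autK.
have := autVK g (rcons v d); case/lastP: ((g^-1)%g (rcons v d)) => [|u e].
  by rewrite g0; case: v.
have [e' ->] := gr u e; move=> /rcons_inj[<- _]; exists e.
by rewrite autK.
Qed.

Lemma rooted_size g v : rooted g -> size (g v) = size v.
Proof.
move=> [g0 gr]; elim/last_ind: v => [|v d IH]; first by rewrite g0.
by have [e ->] := gr v d; rewrite !size_rcons IH.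
Qed.

Lemma rooted_weval (X : choiceType) (f : X -> aut adjT2) w :
  (forall s, rooted (f s)) -> rooted (weval f w).
Proof.
move=> fr; elim: w => [|[s e] w IH]; first by rewrite weval_nil; exact: rooted1.
rewrite weval_cons; apply: rootedM => //.
by case: e => /=; [exact: rootedV|].
Qed.

(** In the language of self-similar groups, [g] is the section of [f] at the fixed vertex [u]. *)
Definition acts_under (u : seq bool) (f g : aut adjT2) :=
  forall v, f (u ++ v) = u ++ g v.

Lemma acts_under_weval1 (X : choiceType) (f : X -> aut adjT2) u w :
  (forall s, acts_under u (f s) 1%g) -> acts_under u (weval f w) 1%g.
Proof.
move=> f1; elim: w => [|[s e] w IH] v; first by rewrite weval_nil.
rewrite weval_cons autM -[RHS]IH; congr (_ _); case: e => /=; last exact: f1.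
by apply: (aut_inj (g := f s)); rewrite autVK f1.
Qed.

Lemma acts_under_weval (X : choiceType) (f g : X -> aut adjT2) u w :
  (forall s, acts_under u (f s) (g s)) -> acts_under u (weval f w) (weval g w).
Proof.
move=> fg; elim: w => [|[s e] w IH] v; first by rewrite !weval_nil.
rewrite !weval_cons !autM -IH; congr (_ _); case: e => /=; last exact: fg.
by apply: (aut_inj (g := f s)); rewrite autVK fg autVK.
Qed.

End Rooted.

(** * Automorphisms of the 3-regular tree assembled from its binary subtrees *)

Section TreeAutomorphisms.

Lemma parent_preserving_aut (f f' : T3 -> T3) : cancel f f' -> cancel f' f ->
  (forall x, parent (f x) = f (parent x)) ->
  {g : aut adjT3 | (g : T3 -> T3) = f}.
Proof.
move=> fK f'K fP; have fb : f \in @is_bij T3 by apply/asboolP; exists f'.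
have fa : Sym fb \in graph_aut adjT3.
  apply/asboolP => x y /=; have fI := can_inj fK.
  apply/adjT3P/adjT3P; rewrite !fP; first by case=> /fI; [left|right].
  by case=> ->; [left|right].
by exists (Aut fa).
Qed.

(** This is the action of the stable letter; rereading a word in the next copy lowers its level by
    1. *)
Definition translate (x : T3) : T3 := vertex (repr x).1.+1 (repr x).2.
(** The index may already be 0, so instead of lowering it one puts a letter 0 in front. *)
Definition translate_inv (x : T3) : T3 := vertex (repr x).1 (false :: (repr x).2).

Lemma translate_vertex n v : translate (vertex n v) = vertex n.+1 v.
Proof.
rewrite /translate; have [k [l [E1 E2]]] := repr_vertex n v.
by apply/(@vertex_eqP _ _ _ _ k l); rewrite // !addnS E1.
Qed.

Lemma translate_inv_vertex n v :
  translate_inv (vertex n v) = vertex n (false :: v).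
Proof.
rewrite /translate_inv; have [k [l [E1 E2]]] := repr_vertex n v.
by apply/(@vertex_eqP _ _ _ _ k l); rewrite // !nseq_cons_cat E2.
Qed.

Lemma translateK : cancel translate translate_inv.
Proof.
by elim/T3_ind => n v; rewrite translate_vertex translate_inv_vertex vertexS.
Qed.

Lemma translate_invK : cancel translate_inv translate.
Proof.
by elim/T3_ind => n v; rewrite translate_inv_vertex translate_vertex vertexS.
Qed.

Lemma parent_translate x : parent (translate x) = translate (parent x).
Proof.
elim/T3_ind: x => n v; rewrite translate_vertex !parent_vertex.
by rewrite translate_vertex.
Qed.

Variable F : nat -> aut adjT2.
Hypothesis rootedF : forall n, rooted (F n).
Hypothesis compatF : forall n, acts_under [:: false] (F n.+1) (F n).

Definition glue (x : T3) : T3 := vertex (repr x).1 (F (repr x).1 (repr x).2).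

Lemma compat_nseq n k : acts_under (nseq k false) (F (k + n)) (F n).
Proof. by elim: k => [//|k IH] v; rewrite addSn compatF IH. Qed.

Lemma glue_vertex n v : glue (vertex n v) = vertex n (F n v).
Proof.
rewrite /glue; have [k [l [E1 E2]]] := repr_vertex n v.
by apply/(@vertex_eqP _ _ _ _ k l) => //; rewrite -!compat_nseq E1 E2.
Qed.

Lemma parent_glue x : parent (glue x) = glue (parent x).
Proof.
elim/T3_ind: x => n v; case/lastP: v => [|v d].
  by rewrite glue_vertex (rootedF n).1 parent_vertex glue_vertex (rootedF _).1.
have [e E] := (rootedF n).2 v d.
by rewrite glue_vertex E !parent_rcons glue_vertex.
Qed.

End TreeAutomorphisms.

Lemma glue_aut_subproof (F : nat -> aut adjT2) :
  (forall n, rooted (F n)) -> (forall n, acts_under [:: false] (F n.+1) (F n)) ->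
  {g : aut adjT3 | (g : T3 -> T3) = glue F}.
Proof.
move=> rF cF; pose F' n := (F n)^-1%g.
have rF' n : rooted (F' n) by exact: rootedV.
have cF' n : acts_under [:: false] (F' n.+1) (F' n).
  by move=> v; apply: (aut_inj (g := F n.+1)); rewrite autVK cF autVK.
apply: (@parent_preserving_aut _ (glue F')); last exact: parent_glue.
  by elim/T3_ind => n v; rewrite !glue_vertex // autK.
by elim/T3_ind => n v; rewrite !glue_vertex // autVK.
Qed.

Definition translate_aut : aut adjT3 :=
  sval (parent_preserving_aut translateK translate_invK parent_translate).

Lemma translate_autE x : translate_aut x = translate x.
Proof. by rewrite /translate_aut; case: parent_preserving_aut => g /= ->. Qed.

Section HNNAction.
Variables (X : choiceType) (sigma : X -> word X) (act : X -> aut adjT2).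
Hypothesis rooted_act : forall s, rooted (act s).
Hypothesis sigma_act :
  forall s, acts_under [:: false] (weval act (sigma s)) (act s).

(** This is [act] precomposed with the [n]-th iterate of [sigma]. *)
Fixpoint iter_act n : X -> aut adjT2 :=
  if n is n'.+1 then fun s => weval (iter_act n') (sigma s) else act.

Lemma rooted_iter_act n s : rooted (iter_act n s).
Proof. by elim: n s => //= n IH s; exact: rooted_weval. Qed.

Lemma iter_act_compat n s : acts_under [:: false] (iter_act n.+1 s) (iter_act n s).
Proof. by elim: n s => //= n IH s; exact: acts_under_weval. Qed.

Definition tree_act (s : option X) : aut adjT3 :=
  if s is Some x then
    sval (glue_aut_subproof (fun n => rooted_iter_act n x)
                            (fun n => @iter_act_compat n x))
  else translate_aut.

Lemma tree_act_gen x n v :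
  tree_act (Some x) (vertex n v) = vertex n (iter_act n x v).
Proof.
rewrite /tree_act; case: glue_aut_subproof => g /= ->.
by rewrite (glue_vertex (fun m => @iter_act_compat m x)).
Qed.

Lemma tree_act_base w n v :
  weval tree_act (base_word w) (vertex n v) = vertex n (weval (iter_act n) w v).
Proof.
elim: w v => [|[s e] w IH] v; first by rewrite !weval_nil.
rewrite /= !weval_cons !autM -IH; congr (_ _); case: e => /=; last exact: tree_act_gen.
apply: (aut_inj (g := tree_act (Some s))).
by rewrite autVK tree_act_gen autVK.
Qed.

(** Products being read from left to right, [t w t^-1] acts on the copy [n] as [w] does on the copy
    [n + 1], that is, as [sigma(w)] does on the copy [n]. *)
Lemma tree_act_hnn w : weval tree_act (hnn_relator sigma w) = 1%g.
Proof.
rewrite /hnn_relator !weval_cat !weval_winv weval_gen.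
suff -> : weval tree_act (base_word (wsubst sigma w)) =
  (translate_aut * weval tree_act (base_word w) * translate_aut^-1)%g.
  by rewrite !mulgA mulgV.
apply: autP; elim/T3_ind => n v; apply: (aut_inj (g := translate_aut)).
rewrite tree_act_base !autM autVK !translate_autE !translate_vertex tree_act_base.
by rewrite weval_wsubst.
Qed.

Lemma tree_act_parent s : parent_preserving (tree_act s).
Proof.
case: s => [s|] x; last by rewrite !translate_autE parent_translate.
rewrite /tree_act; case: glue_aut_subproof => g /= ->.
apply: parent_glue => n; [exact: rooted_iter_act|exact: iter_act_compat].
Qed.

Lemma tree_act_word_parent w : parent_preserving (weval tree_act w).
Proof.
elim: w => [|[s e] w IH]; first by rewrite weval_nil; exact: parent_preserving1.
rewrite weval_cons; apply: parent_preservingM => //.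
have := @tree_act_parent s; case: e => //=; exact: parent_preservingV.
Qed.

End HNNAction.

(** * Faithfulness and transitivity of the action of the extension *)

Section HNNGroup.
Variables (X : choiceType) (sigma : X -> word X) (act : X -> aut adjT2).
Variable Rels : set (word (option X)).
Hypothesis rooted_act : forall s, rooted (act s).
Hypothesis sigma_act :
  forall s, acts_under [:: false] (weval act (sigma s)) (act s).
Hypothesis relsP : forall r, Rels r ->
  (exists2 w, r = base_word w & forall n, weval (iter_act sigma act n) w = 1%g) \/
  exists w, r = hnn_relator sigma w.
Hypothesis hnn_rels : forall s, pres_rel Rels (hnn_relator sigma (gen s)) [::].

Local Notation act_ := (iter_act sigma act).
Local Notation phi := (tree_act rooted_act sigma_act).
Local Notation P := (presented Rels).
Local Notation cls := (pres_class Rels).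
Local Open Scope group_scope.

Lemma tree_act_rels r : Rels r -> weval phi r = 1.
Proof.
case/relsP => [[w -> w1]|[w ->]]; last exact: tree_act_hnn.
by apply: autP; elim/T3_ind => n v; rewrite tree_act_base w1.
Qed.

Definition tree_hom : P -> aut adjT3 := pres_hom phi.

Lemma tree_homM : {morph tree_hom : x y / x * y}.
Proof. exact: pres_homM tree_act_rels. Qed.

Lemma tree_hom_class w : tree_hom (cls w) = weval phi w.
Proof. exact: pres_hom_class tree_act_rels w. Qed.

Lemma tree_hom1 : tree_hom 1 = 1.
Proof. by rewrite -pres_class_nil tree_hom_class weval_nil. Qed.

Lemma tree_homV x : tree_hom x^-1 = (tree_hom x)^-1.
Proof. by apply: (@mulgI _ (tree_hom x)); rewrite -tree_homM !mulgV tree_hom1. Qed.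

Lemma tree_hom_parent x : parent_preserving (tree_hom x).
Proof. exact: tree_act_word_parent. Qed.

Lemma base_word_sound w : cls (base_word w) = 1 -> weval act w = 1.
Proof.
move=> w1; apply: autP => v; apply: (@vertex_inj 0).
by rewrite -(tree_act_base rooted_act sigma_act) -tree_hom_class w1 tree_hom1.
Qed.

Local Notation tau := (cls (gen None)).
Definition base_class (w : word X) : P := cls (base_word w).

Lemma base_class_cat w1 w2 : base_class (w1 ++ w2) = base_class w1 * base_class w2.
Proof. by rewrite /base_class /base_word map_cat pres_classM. Qed.

Lemma base_class_weval w : base_class w = weval (fun s => base_class (gen s)) w.
Proof.
rewrite /base_class pres_class_weval; elim: w => [|[s e] w IH].
  by rewrite !weval_nil.
by rewrite /= !weval_cons IH.
Qed.

(** Conjugation by [tau] is a morphism, so the relators of the generators suffice. *)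
Lemma base_class_subst w : base_class (wsubst sigma w) = tau * base_class w * tau^-1.
Proof.
rewrite base_class_weval weval_wsubst [in RHS]base_class_weval.
rewrite (@weval_morph _ _ _ _ (fun x => tau * x * tau^-1)).
- apply: eq_weval => s /=; rewrite -base_class_weval.
  have /pres_classP := hnn_rels s; rewrite /hnn_relator !pres_classM.
  rewrite -2!pres_class_winv /= pres_class_nil -/(base_class _) -/(base_class _).
  rewrite !mulgA => /divg1_eq ->; rewrite /base_class /wsubst /=.
  by rewrite cats0.
- by rewrite mulg1 mulgV.
- by move=> x y; rewrite !mulgA mulgVK.
Qed.

Lemma tau_base_class n w :
  exists w', tau ^+ n * base_class w = base_class w' * tau ^+ n.
Proof.
elim: n w => [|n IH] w; first by exists w; rewrite expg0 mul1g mulg1.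
have [w' E] := IH (wsubst sigma w); exists w'.
rewrite expgSr -mulgA -[tau * _](mulgVK tau) -base_class_subst mulgA E.
by rewrite -mulgA -expgSr.
Qed.

(** Positive powers of [tau] pass to the right of base words at the cost of [sigma]; a trailing
    [tau^-1] passes to the left in the same way. *)
Lemma normal_form x :
  exists m n w, x = (tau ^+ m)^-1 * base_class w * tau ^+ n.
Proof.
rewrite -(pres_classK x); elim/last_ind: (repr x) => [|W [[s|] e] [m [n [w E]]]].
- by exists 0%N, 0%N, [::]; rewrite expg0 invg1 !mul1g.
- have [w' E'] := tau_base_class n [:: (s, e)]; exists m, n, (w ++ w').
  by rewrite -cats1 pres_classM E -mulgA -[cls [:: (Some s, e)]]/(base_class [:: (s, e)]) E'
    base_class_cat !mulgA.
rewrite -cats1 pres_classM E; case: e; last first.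
  by exists m, n.+1, w; rewrite expgSr !mulgA.
have -> : cls [:: (None, true)] = tau^-1.
  by rewrite -[RHS]/(pres_inv tau) pres_class_winv.
case: n {E} => [|n]; last by exists m, n, w; rewrite expgSr -!mulgA mulgV mulg1.
exists m.+1, 0%N, (wsubst sigma w).
by rewrite base_class_subst !expg0 !mulg1 expgS invgM !mulgA mulgVK.
Qed.

Hypothesis faithful : forall w, weval act w = 1 -> base_class w = 1.

Lemma translation_translate : translation translate_aut = -1.
Proof. by rewrite /translation translate_autE translate_vertex level_vertex. Qed.

Lemma translation_base w : translation (tree_hom (base_class w)) = 0.
Proof.
rewrite /translation tree_hom_class tree_act_base level_vertex.
by rewrite (rooted_weval _ rooted_act).1.
Qed.

Lemma translation_homM x y :
  translation (tree_hom (x * y)) = translation (tree_hom x) + translation (tree_hom y).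
Proof. by rewrite tree_homM translationM //; exact: tree_hom_parent. Qed.

Lemma translation_tauX n : translation (tree_hom (tau ^+ n)) = - n%:Z.
Proof.
elim: n => [|n IH].
  by rewrite expg0 tree_hom1 /translation level_vertex.
rewrite expgSr translation_homM IH tree_hom_class weval_gen translation_translate; lia.
Qed.

Lemma tree_hom_inj : injective tree_hom.
Proof.
move=> x y xy; apply: (@mulIg _ y^-1); rewrite mulgV.
have : tree_hom (x * y^-1) = 1 by rewrite tree_homM tree_homV xy mulgV.
move: (x * y^-1) => {xy}x'; have [m [n [w ->]]] := normal_form x' => {x y x'}.
move=> E; have := congr1 translation E.
rewrite !translation_homM.
have -> : translation (tree_hom (tau ^+ m)^-1) = m%:Z.
  have := translation_homM (tau ^+ m)^-1 (tau ^+ m); rewrite mulVg tree_hom1.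
  rewrite translation_tauX /translation level_vertex /=.
  lia.
rewrite translation_base translation_tauX /translation level_vertex /= => nm.
have {}nm : n = m by lia.
move: E; rewrite {}nm => E; have w1 : tree_hom (base_class w) = 1.
  apply: (@mulgI _ (tree_hom (tau ^+ m)^-1)); apply: (@mulIg _ (tree_hom (tau ^+ m))).
  by rewrite -!tree_homM E mulg1 -tree_homM mulVg tree_hom1.
have {}w1 : weval act w = 1.
  apply: autP => v; apply: (@vertex_inj 0).
  by rewrite -(tree_act_base rooted_act sigma_act) -tree_hom_class -/(base_class w) w1.
by rewrite faithful // mulg1 mulVg.
Qed.

Local Notation u0 := (vertex 0 [::]).
Variable a : X.
Hypothesis a1 : forall v, act a (true :: v) = false :: v.
Hypothesis a0 : forall v, head false (act a (false :: v)) = true.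
(** The generator [a] brings any word under 0, where [sigma(w)] acts on the shorter rest as [w]
    does. *)
Lemma act_transitive v : exists w, weval act w v = nseq (size v) false.
Proof.
suff zero u : exists w, weval act w (false :: u) = nseq (size u).+1 false.
  case: v => [|[] v]; [|have [w wE] := zero v|exact: zero].
    by exists [::]; rewrite weval_nil.
  by exists (gen a ++ w); rewrite weval_cat weval_gen autM a1 wE.
have [n] := ubnP (size u); elim: n u => // n IH u un.
have [w wE] : exists w, weval act w u = nseq (size u) false.
  case: u un => [|[] u] un; first by exists [::]; rewrite weval_nil.
    have [w wE] := IH u un; exists (gen a ++ w).
    by rewrite weval_cat weval_gen autM a1 wE.
  exact: IH.
exists (wsubst sigma w); rewrite weval_wsubst.
by have /= -> := acts_under_weval w sigma_act u; rewrite wE.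
Qed.

Hypothesis subtree_transitive : forall p, exists w,
  weval act w (false :: false :: p) = false :: false :: nseq (size p) false /\
  acts_under [:: true] (weval act w) 1%g.
Hypothesis adjust : forall d e p q, exists w p' q',
  weval act w (false :: d :: p) = false :: false :: p' /\
  weval act w (true :: e :: q) = true :: false :: q'.

Let rooted_word w : rooted (weval act w) := rooted_weval w rooted_act.

Lemma act_pair_transitive_subtrees p q : size p = size q -> exists w,
  weval act w (false :: p) = nseq (size p).+1 false /\
  weval act w (true :: q) = true :: nseq (size p) false.
Proof.
case: p q => [|d p] [|e q] //; first by move=> _; exists [::]; rewrite weval_nil.
move=> /= [pq].
have [w [p' [q' [wp wq]]]] := adjust d e p q.
have sp : size p' = size p.
  by have := rooted_size (false :: d :: p) (rooted_word w); rewrite wp => -[].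
have sq : size q' = size q.
  by have := rooted_size (true :: e :: q) (rooted_word w); rewrite wq => -[].
have [w1 [w1E w1t]] := subtree_transitive p'.
have [w2 [w2E w2t]] := subtree_transitive q'.
have fixt w0 v : acts_under [:: true] (weval act w0) 1%g ->
  weval act w0 (true :: v) = true :: v.
  exact.
(* [w1] straightens the word under 0 and fixes everything under 1; conjugation by [a] makes [w2] do
   the same with the two subtrees exchanged. *)
exists (w ++ w1 ++ gen a ++ w2 ++ winv (gen a)).
rewrite !weval_cat !weval_winv !weval_gen !autM wp wq w1E (fixt w1) // a1 w2E.
rewrite sp sq -pq; split; last by apply: (aut_inj (g := act a)); rewrite autVK a1.
have := a0 (false :: nseq (size p) false).
case E : (act a (false :: false :: nseq (size p) false)) => [//|x v] /= xE.
by rewrite xE fixt //; apply: (aut_inj (g := act a)); rewrite autVK E xE.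
Qed.

Lemma act_pair_normal p q : size p = size q -> head false p != head false q ->
  exists w, weval act w p = nseq (size p) false /\
    weval act w q = true :: nseq (size p).-1 false.
Proof.
case: p q => [|[] p] [|[] q] //= [pq] _; last exact: act_pair_transitive_subtrees.
have := a0 q; have := rooted_size (false :: q) (rooted_act a).
case E : (act a (false :: q)) => [//|x q'] [sq'] /= xE; rewrite xE in E.
have [|w [wp wq]] := @act_pair_transitive_subtrees p q'; first by rewrite sq' -pq.
by exists (gen a ++ w); rewrite !weval_cat !weval_gen !autM a1 E wp wq.
Qed.

Lemma act_pair_transitive p q p' q' :
  size p = size q -> size p' = size p -> size q' = size p ->
  head false p != head false q -> head false p' != head false q' ->
  exists w, weval act w p = p' /\ weval act w q = q'.
Proof.
move=> pq p'p q'p /(act_pair_normal pq)[w [wp wq]].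
move=> /act_pair_normal[|w' [w'p w'q]]; first by rewrite p'p.
exists (w ++ winv w'); rewrite !weval_cat weval_winv !autM wp wq.
by split; apply: (aut_inj (g := weval act w')); rewrite autVK ?w'p ?w'q p'p.
Qed.

Lemma tree_hom_range_group : group_closed (mem (range tree_hom)).
Proof.
split; first by apply/mem_set; exists 1; rewrite ?tree_hom1.
move=> g h /set_mem[x _ <-] /set_mem[y _ <-]; apply/mem_set.
by exists (x / y) => //; rewrite tree_homM tree_homV.
Qed.

Lemma tree_hom_transitive : vertex_transitive (range tree_hom).
Proof.
suff to_root x : exists y, tree_hom y x = u0.
  move=> u v; have [x xu] := to_root u; have [y yv] := to_root v.
  exists (tree_hom (x * y^-1)); first by exists (x * y^-1).
  by rewrite tree_homM autM xu tree_homV -yv autK.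
have tauE n m v : tree_hom (tau ^+ n) (vertex m v) = vertex (n + m) v.
  elim: n => [|n IH]; first by rewrite expg0 tree_hom1.
  rewrite expgSr tree_homM autM IH tree_hom_class weval_gen.
  by rewrite translate_autE translate_vertex.
elim/T3_ind: x => n v; have [w wv] := act_transitive v.
(* The copy [n] is brought to the copy 0, [v] is moved to a word of zeros there, and the power of
   [tau] turns this word into the root. *)
exists ((tau ^+ n)^-1 * base_class w * tau ^+ size v).
rewrite !tree_homM !autM.
have -> : tree_hom (tau ^+ n)^-1 (vertex n v) = vertex 0 v.
  apply: (aut_inj (g := tree_hom (tau ^+ n))).
  by rewrite tree_homV autVK tauE addn0.
rewrite tree_hom_class tree_act_base wv tauE -[nseq _ _]cats0.
by have := vertex_lift (size v) 0 [::].
Qed.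

Lemma tree_hom_pairs (p q p' q' : seq bool) :
  size p = size q -> size p' = size p -> size q' = size p ->
  head false p != head false q -> head false p' != head false q' ->
  exists2 g, range tree_hom g &
    g (vertex 0 p) = vertex 0 p' /\ g (vertex 0 q) = vertex 0 q'.
Proof.
move=> pq p'p q'p hpq hpq'.
have [w [wp wq]] := act_pair_transitive pq p'p q'p hpq hpq'.
exists (tree_hom (base_class w)); first by exists (base_class w).
by rewrite tree_hom_class !tree_act_base wp wq.
Qed.

Theorem hnn_scale_group_embedding (R : realType) :
  exists (f : {multiplicative P -> dil (Q2 R)})
         (g : {multiplicative P -> aut adjT3}),
    [/\ injective f,
        forall x, corresponds (f x) (g x),
        vertex_transitive (range g),
        scale_group (closure (range g))
      & two_transitive_on (closure (range g)) punctured_boundary].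
Proof.
pose f x : dil (Q2 R) := dil_of R (tree_hom_parent x).
have fM : {morph f : x y / x * y}.
  move=> x y; do 2 apply: val_inj; apply/funext => z /=.
  by rewrite tree_homM; apply: boundary_mapM; exact: tree_hom_parent.
pose fm := isMultiplicative.Build _ _ f fM.
pose gm := isMultiplicative.Build _ _ tree_hom tree_homM.
pose F : {multiplicative P -> dil (Q2 R)} := HB.pack f fm.
pose G : {multiplicative P -> aut adjT3} := HB.pack tree_hom gm.
have parentH h : range tree_hom h -> parent_preserving h.
  by case=> x _ <-; exact: tree_hom_parent.
exists F, G; split.
- by move=> x y /dil_of_inj; exact: tree_hom_inj.
- by move=> x; exact: dil_of_corresponds.
- exact: tree_hom_transitive.
- exact: (closure_scale_group tree_hom_range_group parentH tree_hom_transitive).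
- exact: (closure_two_transitive tree_hom_range_group parentH tree_hom_transitive
    tree_hom_pairs).
Qed.

End HNNGroup.

(** * The Basilica group *)

Section Basilica.
Local Notation act := basilica_gen.
Local Notation a := (act Ba).
Local Notation b := (act Bb).
Implicit Types (w : word letter2) (v : seq bool) (d : bool).

Lemma basilica_a0 v : a (false :: v) = true :: b v. Proof. by []. Qed.
Lemma basilica_a1 v : a (true :: v) = false :: v. Proof. by []. Qed.
Lemma basilica_b0 v : b (false :: v) = false :: a v. Proof. by []. Qed.
Lemma basilica_b1 v : b (true :: v) = true :: v. Proof. by []. Qed.

Lemma basilica_aV0 v : (a^-1)%g (false :: v) = true :: v.
Proof. by apply: (aut_inj (g := a)); rewrite autVK. Qed.
Lemma basilica_aV1 v : (a^-1)%g (true :: v) = false :: (b^-1)%g v.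
Proof. by apply: (aut_inj (g := a)); rewrite autVK basilica_a0 autVK. Qed.
Lemma basilica_bV0 v : (b^-1)%g (false :: v) = false :: (a^-1)%g v.
Proof. by apply: (aut_inj (g := b)); rewrite autVK basilica_b0 autVK. Qed.
Lemma basilica_bV1 v : (b^-1)%g (true :: v) = true :: v.
Proof. by apply: (aut_inj (g := b)); rewrite autVK. Qed.

Definition basilicaE := (basilica_a0, basilica_a1, basilica_b0, basilica_b1,
  basilica_aV0, basilica_aV1, basilica_bV0, basilica_bV1).

Lemma basilica_rooted s : rooted (act s).
Proof. by case: s; split=> // v d; case: (basilica_fun_rcons v d). Qed.

Lemma basilica_sigma s : acts_under [:: false] (weval act (sigmaB s)) (act s).
Proof.
by case: s => v; rewrite /sigmaB ?weval_cat !weval_gen ?autM !basilicaE.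
Qed.

Fixpoint basilica_end d w : bool :=
  match w with
  | [::] => d
  | (Ba, _) :: w' => basilica_end (~~ d) w'
  | (Bb, _) :: w' => basilica_end d w'
  end.

(** The wreath recursion on words: [a] leaves a letter when it reads 0, and [a^-1] when it reads
    1. *)
Fixpoint basilica_section d w : word letter2 :=
  match w with
  | [::] => [::]
  | (Ba, e) :: w' =>
    if d == e then (Bb, e) :: basilica_section (~~ d) w'
    else basilica_section (~~ d) w'
  | (Bb, e) :: w' =>
    if d then basilica_section d w' else (Ba, e) :: basilica_section d w'
  end.

Lemma basilica_sectionE w d v :
  weval act w (d :: v) = basilica_end d w :: weval act (basilica_section d w) v.
Proof.
elim: w d v => [|[[] e] w IH] d v; first by rewrite !weval_nil.
all: by case: d e => -[]; rewrite (weval_consT, weval_consF) autM basilicaE IH /=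
  ?weval_consT ?weval_consF ?autM.
Qed.

Fixpoint exponent_sum (s : letter2) w : int :=
  if w is l :: w' then
    (if l.1 == s then (if l.2 then -1 else 1) else 0) + exponent_sum s w'
  else 0.

(* Hides the implicit type argument of [size], which [lia] compares up to syntax. *)
Definition word_length w := size w.

(** Each letter of [w] leaves one letter in exactly one of the two sections. *)
Lemma basilica_section_length w d :
  (word_length (basilica_section d w) + word_length (basilica_section (~~ d) w)
   = word_length w)%N.
Proof.
rewrite /word_length; elim: w d => // -[[] e] w IH d /=.
  by case: d e (IH d) (IH (~~ d)) => -[] /=; lia.
by case: d (IH d) => /=; lia.
Qed.

(** The letter left in a section is the other generator with the same sign. *)
Lemma exponent_sum_section w d :
  exponent_sum Ba w = exponent_sum Bb (basilica_section d w) +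
    exponent_sum Bb (basilica_section (~~ d) w) /\
  exponent_sum Bb w = exponent_sum Ba (basilica_section d w) +
    exponent_sum Ba (basilica_section (~~ d) w).
Proof.
have BaBb : (Ba == Bb) = false by apply/eqP.
have BbBa : (Bb == Ba) = false by apply/eqP.
elim: w d => // -[[] e] w IH d; rewrite /= ?eqxx ?BaBb ?BbBa.
  by case: d e (IH d) (IH (~~ d)) => -[] /= [-> ->] _;
    rewrite /= ?eqxx ?BaBb ?BbBa; lia.
by case: d e (IH d) => -[] /= [-> ->]; rewrite /= ?eqxx ?BaBb ?BbBa; lia.
Qed.

(** When nothing is left, every [a] reads 1 and every [a^-1] reads 0, so the sum telescopes over the
    letters read. *)
Lemma section_nil_exponent w d : basilica_section d w = [::] ->
  exponent_sum Ba w = (d : nat)%:Z - (basilica_end d w : nat)%:Z.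
Proof.
have BbBa : (Bb == Ba) = false by apply/eqP.
elim: w d => [|[[] e] w IH] d /=; first by rewrite subrr.
  by rewrite eqxx; case: d e => -[] //= /IH ->; lia.
by rewrite BbBa; case: d => // /IH ->; rewrite add0r.
Qed.

Lemma basilica_trivial_section w d : weval act w = 1%g ->
  basilica_end d w = d /\ weval act (basilica_section d w) = 1%g.
Proof.
move=> w1; have E v := basilica_sectionE w d v; rewrite w1 /= in E.
split; first by have [] := E [::].
by apply: autP => v; have [] := E v.
Qed.

(* The two sections of a word have the length of the word in total, so either both
   are shorter or one is empty; the latter makes the exponent sum of [a] vanish,
   and that of [b] is a sum of exponent sums of [a] in the sections. *)
Lemma basilica_trivial_exponent w : weval act w = 1%g ->
  exponent_sum Ba w = 0 /\ exponent_sum Bb w = 0.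
Proof.
have [n] := ubnP (word_length w); elim: n w => // n IH.
have expa w : (word_length w < n.+1)%N -> weval act w = 1%g -> exponent_sum Ba w = 0.
  move=> wn w1; have [E0 w01] := basilica_trivial_section false w1.
  have [E1 w11] := basilica_trivial_section true w1.
  case S0 : (basilica_section false w) => [|l0 u0].
    by rewrite (section_nil_exponent S0) E0.
  case S1 : (basilica_section true w) => [|l1 u1].
    by rewrite (section_nil_exponent S1) E1.
  have := basilica_section_length w false; rewrite /= => sw.
  have s0 : (0 < word_length (basilica_section false w))%N by rewrite S0.
  have s1 : (0 < word_length (basilica_section true w))%N by rewrite S1.
  rewrite (exponent_sum_section w false).1 /=.
  have [|_ ->] := IH _ _ w01; first by lia.
  by have [|_ ->] := IH _ _ w11; first by lia.
move=> w wn w1; split; first exact: expa.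
have sw := basilica_section_length w false; rewrite /= in sw.
rewrite (exponent_sum_section w false).2 /= !expa //; try by lia.
- exact: (basilica_trivial_section true w1).2.
- exact: (basilica_trivial_section false w1).2.
Qed.

(** Under 0, [sigma(w)] acts as [w]. Under 1, [sigma(a) = b] is trivial and [sigma(b) = a^2] acts as
    [b]; the result is a power of [b] whose exponent vanishes by [basilica_trivial_exponent]. *)
Lemma basilica_sigma_trivial w :
  weval act w = 1%g -> weval act (wsubst sigmaB w) = 1%g.
Proof.
move=> w1; have [_ wb] := basilica_trivial_exponent w1.
rewrite weval_wsubst; apply: autP => -[|[] v].
- by rewrite (rooted_weval _ _).1 // => s; apply: rooted_weval; exact: basilica_rooted.
- pose rho s : aut adjT2 := if s is Bb then b else 1%g.
  have rhoE s : acts_under [:: true] (weval act (sigmaB s)) (rho s).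
    by case: s => u; rewrite /sigmaB ?weval_cat !weval_gen ?autM !basilicaE.
  suff rho1 : weval rho w = 1%g.
    apply: etrans (acts_under_weval w rhoE v) _.
    have rhov : (weval rho w : aut adjT2) v = v by rewrite rho1.
    exact: (congr1 (cons true) rhov).
  suff [m [n [rhoX mn]]] : exists m n : nat, weval rho w = (b ^+ m * (b ^+ n)^-1)%g /\
      exponent_sum Bb w = m%:Z - n%:Z.
    apply: etrans rhoX _.
    by have -> : m = n by [lia]; rewrite mulgV.
  have BaBb : (Ba == Bb) = false by apply/eqP.
  elim: {w1 wb} w => [|[[] e] w [m [n [rhoX wE]]]].
  + by exists 0%N, 0%N; rewrite weval_nil expg0 mulgV.
  + exists m, n; split; last by rewrite /= BaBb add0r wE.
    apply: etrans rhoX; case: e; rewrite (weval_consT, weval_consF) /= ?invg1.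
      exact: mul1g.
    exact: mul1g.
  + rewrite /= eqxx wE; case: e; last first.
      exists m.+1, n; split; last by lia.
      by rewrite weval_consF rhoX expgS mulgA.
    exists m, n.+1; split; last by lia.
    rewrite weval_consT rhoX expgSr invgM !mulgA.
    congr (_ * _)%g; apply: commute_sym; apply: commuteV.
    exact/commute_sym/commuteX/commute_refl.
- by have /= -> := acts_under_weval w basilica_sigma v; rewrite w1.
Qed.

Lemma basilica_iter_trivial w n :
  weval act w = 1%g -> weval (iter_act sigmaB act n) w = 1%g.
Proof.
elim: n w => [//|n IH] w w1; rewrite -[LHS]weval_wsubst.
exact/IH/basilica_sigma_trivial.
Qed.

(** As [a^2 = (b, b)] and [b = (a, 1)], the commutator [b a^-2 b^-1 a^2] has sections
    [a b^-1 a^-1 b] and 1, and the former acts as [a] under 0. Likewise [b^2 = (a^2, 1)], and [a^2]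
    acts as [b] under 0. *)
Definition basilica_theta (s : letter2) : word letter2 :=
  match s with
  | Ba => [:: (Bb, false); (Ba, true); (Ba, true); (Bb, true);
              (Ba, false); (Ba, false)]
  | Bb => gen Bb ++ gen Bb
  end.

Lemma basilica_theta0 s :
  acts_under [:: false; false] (weval act (basilica_theta s)) (act s).
Proof.
case: s => v; rewrite /basilica_theta ?weval_cat ?weval_gen
  ?(weval_consT, weval_consF) ?weval_nil ?mulg1 !autM !basilicaE //.
by rewrite autK.
Qed.

Lemma basilica_theta1 s : acts_under [:: true] (weval act (basilica_theta s)) 1%g.
Proof.
case: s => v; rewrite /basilica_theta ?weval_cat ?weval_gen
  ?(weval_consT, weval_consF) ?weval_nil ?mulg1 !autM !basilicaE //.
by rewrite autVK.
Qed.

Lemma basilica_subtree_transitive p : exists w,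
  weval act w (false :: false :: p) = false :: false :: nseq (size p) false /\
  acts_under [:: true] (weval act w) 1%g.
Proof.
have [w wp] := act_transitive basilica_sigma basilica_a1 p.
exists (wsubst basilica_theta w); rewrite !weval_wsubst; split.
  by have /= -> := acts_under_weval w basilica_theta0 p; rewrite wp.
exact: acts_under_weval1 basilica_theta1.
Qed.

Lemma basilica_adjust d e p q : exists w p' q',
  weval act w (false :: d :: p) = false :: false :: p' /\
  weval act w (true :: e :: q) = true :: false :: q'.
Proof.
(* [b] acts as [a] under 0 and trivially under 1; for its conjugate [r] by [a] the roles are
   exchanged on the words at hand. *)
pose r : word letter2 := [:: (Ba, false); (Bb, false); (Ba, true)].
exists ((if d then gen Bb else [::]) ++ (if e then r else [::])).
exists p, q; rewrite /r.
by case: d e => -[]; rewrite ?cats0 ?cat0s ?weval_cat ?weval_gen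
  ?(weval_consT, weval_consF) ?weval_nil ?mulg1 ?autM ?basilicaE ?autK.
Qed.

Theorem basilica_embedding (R : realType) :
  exists (f : {multiplicative Btilde -> dil (Q2 R)})
         (g : {multiplicative Btilde -> aut adjT3}),
    [/\ injective f,
        forall x, corresponds (f x) (g x),
        vertex_transitive (range g),
        scale_group (closure (range g))
      & two_transitive_on (closure (range g)) punctured_boundary].
Proof.
apply: (@hnn_scale_group_embedding _ sigmaB act _ basilica_rooted basilica_sigma
  _ _ _ Ba _ _ basilica_subtree_transitive basilica_adjust).
- move=> r [[w wR <-]|[w _ <-]]; last by right; exists w.
  by left; exists w => // n; exact: basilica_iter_trivial.
- by move=> s; apply: pres_relator; right; exists (gen s).
- move=> w w1; apply/pres_classP/pres_relator; left; by exists w.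
- by [].
- by [].
Qed.

End Basilica.

(** * The Grigorchuk group *)

Section GrigorchukWords.
Implicit Types (u v : seq letter4).

(** This is the section at 1 of [sigmaG s] for the action [grig]. The generators are involutions, so
    sequences of letters replace signed words. *)
Definition grig_rho (s : letter4) : seq letter4 :=
  match s with La => [:: Ld] | Lb => [::] | Lc | Ld => [:: La] end.

Definition grig_rho_word u := flatten [seq grig_rho s | s <- u].

Definition is_La (s : letter4) := if s is La then true else false.

Fixpoint grig_parity u : bool := if u is s :: u' then is_La s (+) grig_parity u' else false.

Definition grig_out (x : bool) (s : letter4) : seq letter4 :=
  match s with
  | La => [::]
  | Lb => [:: if x then La else Lc]
  | Lc => [:: if x then La else Ld]
  | Ld => if x then [::] else [:: Lb]
  end.

Fixpoint grig_section (x : bool) u : seq letter4 :=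
  if u is s :: u' then grig_out x s ++ grig_section (x (+) is_La s) u' else [::].

Lemma grig_parity_rcons u s : grig_parity (rcons u s) = grig_parity u (+) is_La s.
Proof. by elim: u => [|s' u IH] /=; rewrite ?addbF // IH addbA. Qed.

Lemma grig_section_rcons x u s :
  grig_section x (rcons u s) = grig_section x u ++ grig_out (x (+) grig_parity u) s.
Proof.
elim: u x => [|s' u IH] x /=; first by rewrite addbF cats0.
by rewrite IH catA addbA.
Qed.

Lemma grig_rho_word_cat u v : grig_rho_word (u ++ v) = grig_rho_word u ++ grig_rho_word v.
Proof. by rewrite /grig_rho_word map_cat flatten_cat. Qed.

(** An [La] leaves nothing in a section and any other letter at most one, so the sections are
    shorter than [u] as soon as it contains [La]. *)
Lemma size_grig_section x u :
  (size (grig_section x u) + count is_La u <= size u)%N.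
Proof.
elim: u x => // s u IH x /=; rewrite size_cat.
by have := IH (x (+) is_La s); case: s x => -[] /=; lia.
Qed.

End GrigorchukWords.

(** * Consequences of the relators in an abstract group *)

Section Lysenok.
Variables (G : groupType) (h : letter4 -> G) (t : G).
Local Open Scope group_scope.
Local Notation A := (h La).
Local Notation B := (h Lb).
Local Notation C := (h Lc).
Local Notation D := (h Ld).
Hypothesis sq : forall s, h s * h s = 1.
Hypothesis bcd : B * C * D = 1.
Hypothesis ad4 : (A * D) ^+ 4 = 1.
Hypothesis adacac4 : (A * D * A * C * A * C) ^+ 4 = 1.
Hypothesis conj_t : forall s, t * h s * t^-1 = weval h (sigmaG s).
Implicit Types (u v : seq letter4) (x y : G).

Definition word_prod u : G := \prod_(s <- u) h s.
Local Notation val := word_prod.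

Lemma word_prod_nil : val [::] = 1. Proof. exact: big_nil. Qed.

Lemma word_prod_cons s u : val (s :: u) = h s * val u.
Proof. exact: big_cons. Qed.

Lemma word_prod_cat u v : val (u ++ v) = val u * val v.
Proof. exact: big_cat. Qed.

Lemma sqK x s : x * h s * h s = x.
Proof. by rewrite -mulgA sq mulg1. Qed.

Lemma sqV s : (h s)^-1 = h s. Proof. exact/mulg1_eq/sq. Qed.

Lemma mulCD : C * D = B.
Proof. by apply: (@mulgI _ B); rewrite mulgA bcd sq. Qed.

Lemma mulBD : B * D = C.
Proof. by rewrite -mulCD sqK. Qed.

Lemma mulDC : D * C = B.
Proof. by rewrite -(sqV Ld) -(sqV Lc) -invgM mulCD sqV. Qed.

Lemma mulDB : D * B = C.
Proof. by rewrite -mulDC mulgA sq mul1g. Qed.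

Lemma dada : D * A * D * A = A * D * A * D.
Proof.
have E : (A * D * A * D) * (A * D * A * D) = 1.
  by rewrite -[RHS]ad4 !expgS expg0 mulg1 !mulgA.
by rewrite -[RHS](mulg1_eq E) !invgM !sqV !mulgA.
Qed.

Lemma dadaK x : x * D * A * D * A = x * A * D * A * D.
Proof. by have := congr1 (fun y => x * y) dada; rewrite !mulgA. Qed.

Lemma mulDBD x : x * D * B * D = x * B.
Proof. by rewrite -(mulgA x) mulDB -mulgA mulCD. Qed.

(* [locked] prevents [mulgA] from matching the products inside. *)
Definition psi x := locked (t * x * t^-1).
Definition psi' x := locked (A * psi x * A).

Lemma psiE x : psi x = t * x * t^-1. Proof. by rewrite /psi -lock. Qed.
Lemma psi'E x : psi' x = A * psi x * A. Proof. by rewrite /psi' -lock. Qed.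

Lemma psiM x y : psi (x * y) = psi x * psi y.
Proof. by rewrite !psiE !mulgA mulgVK. Qed.

Lemma psi'M x y : psi' (x * y) = psi' x * psi' y.
Proof. by rewrite !psi'E psiM !mulgA sqK. Qed.

Lemma psi1 : psi 1 = 1. Proof. by rewrite psiE mulg1 mulgV. Qed.

Lemma psi'1 : psi' 1 = 1. Proof. by rewrite psi'E psi1 mulg1 sq. Qed.

Lemma psiA : psi A = A * C * A.
Proof. by rewrite psiE conj_t /sigmaG !weval_cat !weval_gen mulgA. Qed.

Lemma psiB : psi B = D. Proof. by rewrite psiE conj_t weval_gen. Qed.
Lemma psiC : psi C = B. Proof. by rewrite psiE conj_t weval_gen. Qed.
Lemma psiD : psi D = C. Proof. by rewrite psiE conj_t weval_gen. Qed.

Lemma psi'A : psi' A = C. Proof. by rewrite psi'E psiA !mulgA sq mul1g sqK. Qed.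
Lemma psi'B : psi' B = A * D * A. Proof. by rewrite psi'E psiB. Qed.
Lemma psi'D : psi' D = A * C * A. Proof. by rewrite psi'E psiD. Qed.

Definition dihedral_word v :=
  all (fun s => match s with La | Ld => true | _ => false end) v.

Lemma dihedral_rho u : dihedral_word (grig_rho_word u).
Proof. by elim: u => // -[] u IH /=. Qed.

(* The conjugates of [B] under the dihedral group generated by [A] and [D]. *)
Definition dihedral_conjugate x :=
  [\/ x = B, x = A * B * A, x = D * A * B * A * D | x = A * D * A * B * A * D * A].

Lemma dihedral_conjugateA x : dihedral_conjugate x -> dihedral_conjugate (A * x * A).
Proof.
case=> ->; [constructor 2|constructor 1|constructor 4|constructor 3];
  by rewrite ?mulgA ?sq ?mul1g ?sqK.
Qed.

(** [D] commutes with [B], and [DADA = ADAD] brings a [D] next to [B] in the last case. *)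
Lemma dihedral_conjugateD x : dihedral_conjugate x -> dihedral_conjugate (D * x * D).
Proof.
case=> ->; [constructor 1|constructor 3|constructor 2|constructor 4];
  rewrite ?mulgA ?sq ?mul1g ?sqK //; first by rewrite mulDB mulCD.
by rewrite dada -dadaK mulDBD.
Qed.

Lemma dihedral_conj v : dihedral_word v ->
  dihedral_conjugate (val v * B * (val v)^-1).
Proof.
elim: v => [_|s v IH] /=; first by rewrite word_prod_nil invg1 mulg1 mul1g; constructor 1.
case/andP=> sP /IH vP.
have -> : val (s :: v) * B * (val (s :: v))^-1 = h s * (val v * B * (val v)^-1) * h s.
  by rewrite word_prod_cons invgM sqV !mulgA.
by case: s sP => // _; [exact: dihedral_conjugateA|exact: dihedral_conjugateD].
Qed.

Lemma commute_psi_dihedral x : dihedral_conjugate x -> D * psi' x = psi' x * D.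
Proof.
have c1 : D * (A * D * A) = A * D * A * D by rewrite !mulgA dada.
(* Since [C = psi' A] commutes with [D], conjugating the argument of [psi'] by [A] preserves the
   claim. *)
have conjC y : D * y = y * D -> D * (C * y * C) = C * y * C * D.
  by move=> yD; rewrite !mulgA mulDC -mulCD -(mulgA C D) yD -!mulgA mulCD mulDC.
have c3 : D * psi' (D * A * B * A * D) = psi' (D * A * B * A * D) * D.
  (* [(ADA Y)^2] spells [(ADACAC)^4], so the involutions [ADA] and [Y] commute; conjugating by [A]
     gives the claim. *)
  pose Y := C * A * C * A * D * A * C * A * C.
  have YY : Y * Y = 1.
    by rewrite /Y !mulgA !sqK sq.
  have XY : (A * D * A * Y) * (A * D * A * Y) = 1.
    by rewrite -[RHS]adacac4 !expgS expg0 mulg1 /Y !mulgA.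
  have comY : A * D * A * Y = Y * (A * D * A).
    by rewrite -[LHS](mulg1_eq XY) invgM (mulg1_eq YY) !invgM !sqV !mulgA.
  clear XY YY; have -> : psi' (D * A * B * A * D) = A * Y * A.
    by rewrite !psi'M psi'A psi'B psi'D /Y !mulgA.
  clearbody Y; have := congr1 (fun y => A * y * A) comY.
  by rewrite !mulgA sq mul1g sqK.
case=> ->.
- by rewrite psi'B.
- by rewrite !psi'M psi'A psi'B; exact: conjC.
- exact: c3.
- have -> : A * D * A * B * A * D * A = A * (D * A * B * A * D) * A by rewrite !mulgA.
  by rewrite (psi'M _ A) (psi'M A) psi'A; exact: conjC.
Qed.

(** The letters pass one by one: [psi A] and [psi D] are values of [psi'], [psi B = D] commutes with
    [psi'] of the dihedral conjugates of [B], and [C = BD]. *)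
Lemma psi_conj u : psi (val u) * psi' B =
  psi' (val (grig_rho_word u) * B * (val (grig_rho_word u))^-1) * psi (val u).
Proof.
elim: u => [|s u IH]; first by rewrite word_prod_nil psi1 invg1 !(mul1g, mulg1).
rewrite word_prod_cons psiM -mulgA IH mulgA.
have rhoE : val (grig_rho_word (s :: u)) = val (grig_rho s) * val (grig_rho_word u).
  by rewrite -word_prod_cat.
have dr : dihedral_conjugate (val (grig_rho_word (s :: u)) * B *
  (val (grig_rho_word (s :: u)))^-1) by apply: dihedral_conj; exact: dihedral_rho.
move: dr; rewrite {}rhoE; set r := val (grig_rho_word u).
have conj_psi' s' z : psi' (h s') * psi' z = psi' (h s' * z * (h s')^-1) * psi' (h s').
  by rewrite -!psi'M mulgVK.
case: s; rewrite /= ?word_prod_cons word_prod_nil ?mulg1 ?mul1g => dr.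
- by rewrite psiA -psi'D conj_psi' invgM !mulgA.
- by rewrite psiB (commute_psi_dihedral dr) mulgA.
- rewrite -mulBD psiM psiB psiD -psi'A -(mulgA D) conj_psi'.
  have -> : A * (r * B * r^-1) * A^-1 = A * r * B * (A * r)^-1.
    by rewrite invgM !mulgA.
  by rewrite mulgA (commute_psi_dihedral dr) !mulgA.
- by rewrite psiD -psi'A conj_psi' invgM !mulgA.
Qed.

(** Letters are appended on the right. After an odd number of [A], the letters [B] and [D] produce a
    factor [psi' B], which [psi_conj] carries to the left across [psi]. *)
Lemma word_prod_sections u : val u =
  psi' (val (grig_section true u) * (val (grig_rho_word (grig_section false u)))^-1)
  * psi (val (grig_section false u)) * (if grig_parity u then A else 1).
Proof.
elim/last_ind: u => [|u s IH].
  by rewrite /grig_rho_word /= !word_prod_nil invg1 !mulg1 psi1 psi'1 mulg1.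
rewrite -{1}cats1 word_prod_cat word_prod_cons word_prod_nil mulg1 {1}IH.
have AC : A * C = psi A * A by rewrite psiA sqK.
have AD : A * D = psi' B * A by rewrite psi'B sqK.
have AB : A * B = psi' B * psi A * A.
  by rewrite psiA -psi'D -psi'M mulBD psi'E psiC sqK.
rewrite grig_parity_rcons !grig_section_rcons grig_rho_word_cat !word_prod_cat.
have := psi_conj (grig_section false u).
set x := val (grig_section true u); set y := val (grig_section false u).
set r := val (grig_rho_word _) => yB.
case: (grig_parity u); case: s => /=;
  rewrite /grig_rho_word /= ?word_prod_cons !word_prod_nil !mulg1 ?invgM ?sqV.
- by rewrite sqK.
- rewrite -(mulgA _ A) AB !mulgA -(mulgA _ (psi y)) yB psiM !mulgA.
  by rewrite -psi'M !mulgA mulgVK -(mulgA x C) mulCD.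
- by rewrite -(mulgA _ A) AC psiM !mulgA sqK.
- by rewrite -(mulgA _ A) AD !mulgA -(mulgA _ (psi y)) yB !mulgA -psi'M !mulgA mulgVK.
- by [].
- by rewrite !mulgA sqK psiM psiC !mulgA.
- by rewrite !mulgA sqK psiM psiD !mulgA.
- by rewrite psiM psiB mulgA.
Qed.

Definition dihedral_forms : seq (seq letter4) :=
  [:: [::]; [:: La]; [:: Ld]; [:: La; Ld]; [:: Ld; La]; [:: La; Ld; La];
      [:: Ld; La; Ld]; [:: La; Ld; La; Ld]].

Lemma dihedral_normal_form v : dihedral_word v ->
  exists2 i, (i < 8)%N & val v = val (nth [::] dihedral_forms i).
Proof.
elim: v => [_|s v IH] /=; first by exists 0%N.
case/andP=> sP /IH[i i8]; rewrite word_prod_cons => ->.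
have sqM s' x : h s' * (h s' * x) = x by rewrite mulgA sq mul1g.
have dadaM : D * (A * (D * A)) = A * (D * (A * D)) by rewrite !mulgA dada.
case: s sP => // _.
(* This table, and the next one for [D], give left multiplication on the indices of the eight
   forms. *)
- exists (nth 0%N [:: 1; 0; 3; 2; 5; 4; 7; 6] i)%N;
    do 8?[case: i i8 => [|i] i8 //=]; rewrite !word_prod_cons ?word_prod_nil ?sqM //.
- exists (nth 0%N [:: 2; 4; 0; 6; 1; 7; 3; 5] i)%N;
    do 8?[case: i i8 => [|i] i8 //=]; rewrite !word_prod_cons ?word_prod_nil ?mulg1 ?sqM //.
  by rewrite -dadaM sqM.
Qed.

Definition klein_forms : seq (seq letter4) := [:: [::]; [:: Lb]; [:: Lc]; [:: Ld]].

Lemma klein_normal_form u : count is_La u = 0%N ->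
  exists2 i, (i < 4)%N & val u = val (nth [::] klein_forms i).
Proof.
elim: u => [_|s u IH] /=; first by exists 0%N.
case: s => //= /IH[i i4]; rewrite word_prod_cons => ->.
- have mulBC : B * C = D by rewrite -mulBD mulgA sq mul1g.
  exists (nth 0%N [:: 1; 0; 3; 2] i)%N; do 4?[case: i i4 => [|i] i4 //=];
    by rewrite !word_prod_cons ?word_prod_nil ?mulg1 ?sq ?mulBC ?mulBD.
- have mulCB : C * B = D by rewrite -mulCD mulgA sq mul1g.
  exists (nth 0%N [:: 2; 3; 0; 1] i)%N; do 4?[case: i i4 => [|i] i4 //=];
    by rewrite !word_prod_cons ?word_prod_nil ?mulg1 ?sq ?mulCB ?mulCD.
- exists (nth 0%N [:: 3; 2; 1; 0] i)%N; do 4?[case: i i4 => [|i] i4 //=];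
    by rewrite !word_prod_cons ?word_prod_nil ?mulg1 ?sq ?mulDB ?mulDC.
Qed.

Lemma weval_letters w : weval h w = val [seq l.1 | l <- w].
Proof.
elim: w => [|[s e] w IH]; first by rewrite weval_nil word_prod_nil.
by rewrite weval_cons word_prod_cons IH; case: e => //=; rewrite sqV.
Qed.

End Lysenok.

(** * The action of the Grigorchuk group, the relators and faithfulness *)

Section Grigorchuk.
Implicit Types (u : seq letter4) (v : seq bool) (w : word letter4).
Local Open Scope group_scope.

(* The letters are exchanged with respect to the recursion of the paper:
   [b = (c, a)], [c = (d, a)], [d = (b, 1)]; this conjugate of the action makes
   [sigmaG] induce [g |-> (g, rho(g))], in accordance with [v |-> 0v]. *)
Fixpoint grig_fun (s : letter4) v : seq bool :=
  if v is x :: v' then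
    match s with
    | La => ~~ x :: v'
    | Lb => x :: grig_fun (if x then La else Lc) v'
    | Lc => x :: grig_fun (if x then La else Ld) v'
    | Ld => x :: if x then v' else grig_fun Lb v'
    end
  else [::].

Lemma grig_funK s : involutive (grig_fun s).
Proof.
move=> v; elim: v s => [|x v IH] [] //=; rewrite ?IH ?negbK //.
by case: x; rewrite ?IH.
Qed.

Lemma grig_fun_rcons s v d : exists e, grig_fun s (rcons v d) = rcons (grig_fun s v) e.
Proof.
elim: v s => [|x v IH] s; first by case: s; case: d; eexists.
case: s => /=.
- by exists d.
- by have [e ->] := IH (if x then La else Lc); exists e.
- by have [e ->] := IH (if x then La else Ld); exists e.
- by case: x; [exists d|have [e ->] := IH Lb; exists e].
Qed.

Lemma grig_bij s : grig_fun s \in @is_bij _.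
Proof. by apply/asboolP; exists (grig_fun s); exact: grig_funK. Qed.

Lemma grig_aut s : Sym (grig_bij s) \in graph_aut adjT2.
Proof.
apply/asboolP; apply: adjT2_preserved => [||].
- exact: can_inj (grig_funK s).
- exact: grig_fun_rcons.
- by [].
Qed.

(* [locked] prevents the rules [grigE] from matching up to computation. *)
Definition grig (s : letter4) : aut adjT2 := locked (Aut (grig_aut s)).

Lemma grig_funE s v : grig s v = grig_fun s v.
Proof. by rewrite /grig -lock. Qed.

Lemma grig_rooted s : rooted (grig s).
Proof.
split=> [|v d]; first by rewrite grig_funE.
by rewrite !grig_funE; exact: grig_fun_rcons.
Qed.

Lemma grigK s v : grig s (grig s v) = v.
Proof. by rewrite !grig_funE grig_funK. Qed.

Lemma grig_nil s : grig s [::] = [::]. Proof. by rewrite grig_funE. Qed.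
Lemma grig_a x v : grig La (x :: v) = ~~ x :: v. Proof. by rewrite grig_funE. Qed.
Lemma grig_b0 v : grig Lb (false :: v) = false :: grig Lc v. Proof. by rewrite !grig_funE. Qed.
Lemma grig_b1 v : grig Lb (true :: v) = true :: grig La v. Proof. by rewrite !grig_funE. Qed.
Lemma grig_c0 v : grig Lc (false :: v) = false :: grig Ld v. Proof. by rewrite !grig_funE. Qed.
Lemma grig_c1 v : grig Lc (true :: v) = true :: grig La v. Proof. by rewrite !grig_funE. Qed.
Lemma grig_d0 v : grig Ld (false :: v) = false :: grig Lb v. Proof. by rewrite !grig_funE. Qed.
Lemma grig_d1 v : grig Ld (true :: v) = true :: v. Proof. by rewrite !grig_funE. Qed.

Definition grigE := (grig_b0, grig_b1, grig_c0, grig_c1, grig_d0, grig_d1, grig_a, grig_nil).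

Lemma grig_sq s : grig s * grig s = 1.
Proof. by apply: autP => v; exact: grigK. Qed.

Lemma grig_sigma s : acts_under [:: false] (weval grig (sigmaG s)) (grig s).
Proof.
by case: s => v; rewrite /sigmaG ?weval_cat !weval_gen ?autM -[_ ++ _]/(false :: _) !grigE.
Qed.

Lemma grig_sigma1 s : acts_under [:: true] (weval grig (sigmaG s))
  (word_prod grig (grig_rho s)).
Proof.
by case: s => v; rewrite /sigmaG ?weval_cat !weval_gen ?autM -[_ ++ _]/(true :: _) !grigE
  /= ?word_prod_cons word_prod_nil ?mulg1.
Qed.

Definition grig_relations (G : groupType) (h : letter4 -> G) :=
  [/\ forall s, h s * h s = 1, h Lb * h Lc * h Ld = 1, (h La * h Ld) ^+ 4 = 1
    & (h La * h Ld * h La * h Lc * h La * h Lc) ^+ 4 = 1].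

Lemma weval_wpow (G : groupType) (h : letter4 -> G) w n :
  weval h (wpow w n) = weval h w ^+ n.
Proof.
elim: n => [|n IH]; first by rewrite weval_nil.
by rewrite expgS -IH -weval_cat.
Qed.

Lemma grig_relationsP (G : groupType) (h : letter4 -> G) :
  (forall r, relatorsG r -> weval h r = 1) <-> grig_relations h.
Proof.
have relE r : relatorsG r <->
    r \in [:: gen La ++ gen La; gen Lb ++ gen Lb; gen Lc ++ gen Lc;
            gen Ld ++ gen Ld; gen Lb ++ gen Lc ++ gen Ld;
            wpow (gen La ++ gen Ld) 4;
            wpow (gen La ++ gen Ld ++ gen La ++ gen Lc ++ gen La ++ gen Lc) 4] by [].
split=> [H|[sq bcd ad4 adacac4] r /relE].
  split.
  - by move=> s; rewrite -!(weval_gen h) -weval_cat; apply/H/relE;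
      case: s; rewrite !inE eqxx ?orbT.
  - rewrite -!(weval_gen h) -mulgA -!weval_cat; apply/H/relE.
    by rewrite !inE eqxx ?orbT.
  - rewrite -!(weval_gen h) -!weval_cat -weval_wpow; apply/H/relE.
    by rewrite !inE eqxx ?orbT.
  - rewrite -!(weval_gen h) -!mulgA -!weval_cat -weval_wpow; apply/H/relE.
    by rewrite !inE eqxx ?orbT.
rewrite !inE => /orP[/eqP->|]; first by rewrite weval_cat !weval_gen.
do 3![case/orP => [/eqP->|]; first by rewrite weval_cat !weval_gen].
case/orP => [/eqP->|]; first by rewrite !weval_cat !weval_gen mulgA.
case/orP => [/eqP->|/eqP->]; first by rewrite weval_wpow !weval_cat !weval_gen.
by rewrite weval_wpow !weval_cat !weval_gen !mulgA.
Qed.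

Lemma grig_relations_act : grig_relations grig.
Proof.
split.
- exact: grig_sq.
- apply: autP => v; rewrite !autM.
  (* The section of [bcd] at 0 is a cyclic rotation of it, so the three rotations are treated
     together. *)
  suff [] : [/\ grig Ld (grig Lc (grig Lb v)) = v, grig Lb (grig Ld (grig Lc v)) = v
    & grig Lc (grig Lb (grig Ld v)) = v] by [].
  elim: v => [|[] v [dcb bdc cbd]]; first by rewrite !grig_nil.
  by rewrite !grigE !grigK.
  by rewrite !grigE dcb bdc cbd.
- by apply: autP => -[|[] v]; rewrite !expgS expg0 mulg1 !autM !grigE ?grigK.
- by apply: autP => -[|[] v]; rewrite !expgS expg0 mulg1 !autM !grigE ?grigK.
Qed.

Fixpoint grig_rho_iter n : letter4 -> aut adjT2 :=
  if n is n'.+1 then fun s => weval (grig_rho_iter n') (sigmaG s)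
  else fun s => word_prod grig (grig_rho s).

Lemma iter_act_grig1 n s :
  acts_under [:: true] (iter_act sigmaG grig n.+1 s) (grig_rho_iter n s).
Proof.
elim: n s => [|n IH] s; first exact: grig_sigma1.
exact: (acts_under_weval (sigmaG s) IH).
Qed.

Local Notation a := (grig La).
Local Notation d := (grig Ld).

Definition grig_values (h : letter4 -> aut adjT2) x y z t :=
  [/\ h La = x, h Lb = y, h Lc = z & h Ld = t].

Lemma grig_values_sigma h x y z t : grig_values h x y z t ->
  grig_values (fun s => weval h (sigmaG s)) (x * z * x) t y z.
Proof.
by move=> [hx hy hz ht]; split; rewrite -[LHS]/(weval h (sigmaG _)) /sigmaG ?weval_cat
  !weval_gen ?hx ?hy ?hz ?ht ?mulgA.
Qed.

(** The values of the generators are followed through [sigmaG]: after two steps they repeat with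
    period 3. All lie in the group generated by [a] and [d], where the relators are easily
    checked. *)
Lemma grig_rho_values n :
  [\/ grig_values (grig_rho_iter n) d 1 a a,
      grig_values (grig_rho_iter n) (d * a * d) a 1 a,
      grig_values (grig_rho_iter n) 1 a a 1 |
      grig_values (grig_rho_iter n) a 1 a a \/ grig_values (grig_rho_iter n) a a 1 a].
Proof.
have aa := grig_sq La; have dd := grig_sq Ld.
elim: n => [|n IH].
  by constructor 1; split; rewrite /= ?word_prod_cons word_prod_nil ?mulg1.
case: IH => [| | |[]] /grig_values_sigma.
- by constructor 2.
- by rewrite mulg1 !mulgA -(mulgA _ d d) dd mulg1 -(mulgA _ a a) aa mulg1 dd; constructor 3.
- by rewrite mul1g mulg1; constructor 4; left.
- by rewrite aa mul1g; constructor 4; right.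
- by rewrite mulg1 aa; constructor 3.
Qed.

Lemma grig_relations_values h x y z t : grig_values h x y z t ->
  [/\ x * x = 1, y * y = 1, z * z = 1 & t * t = 1] -> y * z * t = 1 ->
  (x * t) ^+ 4 = 1 -> (x * t * x * z * x * z) ^+ 4 = 1 -> grig_relations h.
Proof.
by move=> [hx hy hz ht] [xx yy zz tt] *; split; rewrite ?hx ?hy ?hz ?ht //;
  case; rewrite ?hx ?hy ?hz ?ht.
Qed.

Lemma grig_relations_rho n : grig_relations (grig_rho_iter n).
Proof.
have aa := grig_sq La; have dd := grig_sq Ld.
have [_ _ ad4 _] := grig_relations_act.
have aV : a^-1 = a by exact: mulg1_eq.
have dV : d^-1 = d by exact: mulg1_eq.
have da4 : (d * a) ^+ 4 = 1 by rewrite -(invgK (d * a)) invgM aV dV expVgn ad4 invg1.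
have aaK x : x * a * a = x by rewrite -mulgA aa mulg1.
have ddK x : x * d * d = x by rewrite -mulgA dd mulg1.
have dada2 : d * a * d * a = (d * a) ^+ 2 by rewrite expg2 !mulgA.
case: (grig_rho_values n) => [| | |[]] /grig_relations_values; apply.
all: rewrite ?mulg1 ?mul1g ?mulgA ?aaK ?ddK ?aa ?dd ?mul1g ?expg1n //.
- have -> : d * a * d * a * d * a = (d * a) ^+ 3 by rewrite !expgS expg0 mulg1 !mulgA.
  by rewrite -expgnA mulnC expgnA da4 expg1n.
- by rewrite aaK dd.
- by rewrite dada2 -expgnA mulnC expgnA da4 expg1n.
- by rewrite aaK ddK dada2 -expgnA mulnC expgnA da4 expg1n.
Qed.

(** Passing from [n] to [n + 1], a relator acts under 0 by the previous action and under 1 by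
    [grig_rho_iter n]. *)
Lemma grig_iter_act_relations n : grig_relations (iter_act sigmaG grig n).
Proof.
elim: n => [|n IH]; first exact: grig_relations_act.
apply/grig_relationsP => r rR; apply: autP => -[|[] v].
- by rewrite (rooted_weval _ _).1 // => s; exact: rooted_iter_act grig_rooted _ _.
- have := acts_under_weval r (iter_act_grig1 n) v.
  by have /grig_relationsP -> := grig_relations_rho n.
- have := acts_under_weval r (iter_act_compat grig_sigma n) v.
  by have /grig_relationsP -> := IH.
Qed.

Lemma word_prod_grigE u v :
  word_prod grig u v = foldl (fun v s => grig_fun s v) v u.
Proof.
elim: u v => [|s u IH] v; first by rewrite word_prod_nil.
by rewrite word_prod_cons autM IH grig_funE.
Qed.

Lemma word_prod_grig_section u x v : word_prod grig u (x :: v) =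
  (x (+) grig_parity u) :: word_prod grig (grig_section x u) v.
Proof.
elim: u x v => [|s u IH] x v; first by rewrite !word_prod_nil addbF.
rewrite word_prod_cons autM word_prod_cat autM.
have -> : grig s (x :: v) = (x (+) is_La s) :: word_prod grig (grig_out x s) v.
  by case: s x => -[]; rewrite grigE /= ?word_prod_cons word_prod_nil ?mulg1 ?addbF ?addbT.
by rewrite IH /= addbA.
Qed.

Lemma dihedral_forms_act i : (i < 8)%N ->
  word_prod grig (nth [::] dihedral_forms i) = 1 -> i = 0%N.
Proof.
move=> i8 E.
have {}E v : foldl (fun v s => grig_fun s v) v (nth [::] dihedral_forms i) = v.
  by rewrite -word_prod_grigE E.
(* Each of the seven nontrivial forms moves one of these two vertices. *)
move: (E [:: false; true; false]) (E [:: true; true; false]) => {E}.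
by do 8?[case: i i8 => [|i] i8 //=].
Qed.

Lemma klein_forms_act i : (i < 4)%N ->
  word_prod grig (nth [::] klein_forms i) = 1 -> i = 0%N.
Proof.
move=> i4 E.
have {}E v : foldl (fun v s => grig_fun s v) v (nth [::] klein_forms i) = v.
  by rewrite -word_prod_grigE E.
move: (E [:: false; true; false]) (E [:: true; false]) => {E}.
by do 4?[case: i i4 => [|i] i4 //=].
Qed.

Local Notation Rels :=
  (base_relators relatorsG `|` [set hnn_relator sigmaG (gen s) | s in setT]).

Lemma Gtilde_rels r : Rels r ->
  (exists2 w, r = base_word w & forall n, weval (iter_act sigmaG grig n) w = 1) \/
  exists w, r = hnn_relator sigmaG w.
Proof.
case=> [[w wR <-]|[s _ <-]]; last by right; exists (gen s).
left; exists w => // n.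
by have /grig_relationsP -> := grig_iter_act_relations n.
Qed.

Lemma Gtilde_hnn s : pres_rel Rels (hnn_relator sigmaG (gen s)) [::].
Proof. by apply: pres_relator; right; exists s. Qed.

Local Notation cls := (@base_class letter4 Rels).
Local Notation h := (fun s => cls (gen s)).
Local Notation tau := (pres_class Rels (gen None)).

Lemma Gtilde_relations : grig_relations h.
Proof.
apply/grig_relationsP => r rR; rewrite -base_class_weval.
by apply/pres_classP/pres_relator; left; exists r.
Qed.

Lemma Gtilde_conj s : tau * h s * tau^-1 = weval h (sigmaG s).
Proof.
rewrite -(base_class_subst Gtilde_hnn) -base_class_weval.
by rewrite /wsubst /= cats0.
Qed.

Let flag u : word letter4 := [seq (s, false) | s <- u].

Lemma weval_flag (G : groupType) (f : letter4 -> G) u :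
  weval f (flag u) = word_prod f u.
Proof.
elim: u => [|s u IH]; first by rewrite weval_nil word_prod_nil.
by rewrite /= weval_consF word_prod_cons IH.
Qed.

Lemma word_prod_sound u u' :
  word_prod h u = word_prod h u' -> word_prod grig u = word_prod grig u'.
Proof.
rewrite -!weval_flag => E; apply: (@mulIg _ (weval grig (flag u'))^-1).
rewrite mulgV -weval_winv -weval_cat.
apply: (base_word_sound grig_rooted grig_sigma Gtilde_rels).
by rewrite -/(cls _) base_class_weval weval_cat weval_winv E mulgV.
Qed.

Lemma word_prod_rho u :
  word_prod (fun s => word_prod grig (grig_rho s)) u = word_prod grig (grig_rho_word u).
Proof.
elim: u => [|s u IH]; first by rewrite !word_prod_nil.
by rewrite word_prod_cons IH -word_prod_cat.
Qed.

(** If [u] is trivial in the extension, so is its conjugate [sigma(u)], whose section at 1 is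
    [rho(u)]. *)
Lemma rho_word_sound u : word_prod h u = 1 ->
  word_prod grig (grig_rho_word u) = 1.
Proof.
rewrite -weval_flag -base_class_weval => E.
have {}E : weval grig (wsubst sigmaG (flag u)) = 1.
  apply: (base_word_sound grig_rooted grig_sigma Gtilde_rels).
  by rewrite -/(cls _) (base_class_subst Gtilde_hnn) E mulg1 mulgV.
apply: autP => v; have := acts_under_weval (flag u) grig_sigma1 v.
by rewrite -weval_wsubst E weval_flag word_prod_rho => -[<-].
Qed.

Lemma word_prod_faithful u : word_prod grig u = 1 -> word_prod h u = 1.
Proof.
have [sq bcd ad4 adacac4] := Gtilde_relations.
have [n] := ubnP (size u); elim: n u => // n IH u un u1.
have [a0|] := posnP (count is_La u).
  have [i i4 iE] := klein_normal_form sq bcd a0.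
  rewrite iE (klein_forms_act i4) ?word_prod_nil //.
  by rewrite -(word_prod_sound iE).
move=> a0; have E x v : x :: v = (x (+) grig_parity u) :: word_prod grig (grig_section x u) v.
  by rewrite -word_prod_grig_section u1.
have par : grig_parity u = false by have [] := E false [::].
(* The sections act trivially and are shorter, as [La] occurs in [u]. *)
have sec x : word_prod h (grig_section x u) = 1.
  apply: IH; first by have := size_grig_section x u; lia.
  by apply: autP => v; have [_ <-] := E x v.
rewrite (word_prod_sections sq bcd ad4 adacac4 Gtilde_conj) par mulg1 !sec.
rewrite psi1 mulg1 mul1g.
(* What remains lies in a dihedral group with eight normal forms, which the action on the tree tells
   apart from 1. *)
have [i i8 iE] := dihedral_normal_form sq ad4 (dihedral_rho (grig_section false u)).
rewrite iE (dihedral_forms_act i8) ?word_prod_nil ?invg1 ?psi'1 //.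
by rewrite -(word_prod_sound iE) rho_word_sound.
Qed.

Lemma Gtilde_faithful w : weval grig w = 1 -> cls w = 1.
Proof.
have [sq _ _ _] := Gtilde_relations.
rewrite (weval_letters grig_sq) base_class_weval (weval_letters sq).
exact: word_prod_faithful.
Qed.

(* [A'], [C'] and [K'] act trivially under [1], and under [00] as [a], [c] and
   [b a b]; these generate a subgroup of index 2 whose sections at [0] are all
   of the group. *)
Definition grig_theta (s : letter4) : seq letter4 :=
  let A' := [:: La; Lc; La; Ld; La; Lc; La] in
  let C' := [:: Ld] in
  let K' := Lc :: A' ++ [:: Lc] in
  match s with
  | La => A' ++ C' ++ A'
  | Lb => A' ++ C' ++ K' ++ C'
  | Lc => A' ++ C' ++ K'
  | Ld => C'
  end.

Lemma grig_theta0 s : acts_under [:: false; false; false]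
  (word_prod grig (grig_theta s)) (grig s).
Proof.
case: s => v; rewrite -[_ ++ _]/[:: false, false, false & v] /= !word_prod_cons
  word_prod_nil mulg1 ?autM !grigE ?grigK //.
have [sq bcd _ _] := grig_relations_act.
by rewrite -autM (mulCD sq bcd).
Qed.

Lemma grig_theta1 s : acts_under [:: true] (word_prod grig (grig_theta s)) 1.
Proof.
case: s => v; rewrite -[_ ++ _]/(true :: v) /= !word_prod_cons
  word_prod_nil mulg1 ?autM !grigE ?grigK //.
Qed.

Lemma grig_subtree_transitive p : exists w,
  weval grig w (false :: false :: p) = false :: false :: nseq (size p) false /\
  acts_under [:: true] (weval grig w) 1.
Proof.
have a1 v : grig La (true :: v) = false :: v by rewrite grigE.
have tr0 q : exists w, weval grig w [:: false, false, false & q] =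
    [:: false, false, false & nseq (size q) false] /\
    acts_under [:: true] (weval grig w) 1.
  have [w wq] := act_transitive grig_sigma a1 q.
  exists (wsubst (fun s => flag (grig_theta s)) w); rewrite !weval_wsubst; split.
    have H s : acts_under [:: false; false; false]
        (weval grig (flag (grig_theta s))) (grig s).
      by rewrite weval_flag; exact: grig_theta0.
    by have /= -> := acts_under_weval w H q; rewrite wq.
  by apply: acts_under_weval1 => s; rewrite weval_flag; exact: grig_theta1.
case: p => [|[] q]; last exact: tr0.
  by exists [::]; rewrite weval_nil.
have [w [wq w1]] := tr0 q.
(* [r] acts as [a] under 00 and trivially under 1, so it exchanges the subtrees under 001 and
   000. *)
pose r : word letter4 := flag [:: La; Lc; La; Ld; La; Lc; La].
exists (r ++ w); rewrite !weval_cat !weval_flag !word_prod_cons word_prod_nil mulg1; split.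
  by rewrite !autM !grigE wq.
by move=> v; rewrite !autM -[_ ++ _]/(true :: v) !grigE grigK; exact: w1.
Qed.

Lemma grig_adjust e f p q : exists w p' q',
  weval grig w (false :: e :: p) = false :: false :: p' /\
  weval grig w (true :: f :: q) = true :: false :: q'.
Proof.
(* [aca] acts as [a] under 0 and as [d] under 1, while [c] acts as [d] under 0 and as [a] under 1;
   as [d] preserves the first letter, the two corrections do not interfere. *)
exists (flag ((if e then [:: La; Lc; La] else [::]) ++ (if f then [:: Lc] else [::]))).
rewrite !weval_flag.
case: e f => -[]; do 2 eexists; rewrite /= ?word_prod_cons word_prod_nil ?mulg1 ?autM ?grigE;
  by split.
Qed.

Theorem grigorchuk_embedding (R : realType) :
  exists (f : {multiplicative Gtilde -> dil (Q2 R)})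
         (g : {multiplicative Gtilde -> aut adjT3}),
    [/\ injective f,
        forall x, corresponds (f x) (g x),
        vertex_transitive (range g),
        scale_group (closure (range g))
      & two_transitive_on (closure (range g)) punctured_boundary].
Proof.
apply: (@hnn_scale_group_embedding _ sigmaG grig _ grig_rooted grig_sigma
  Gtilde_rels Gtilde_hnn Gtilde_faithful La _ _ grig_subtree_transitive grig_adjust).
- by move=> v; rewrite grigE.
- by move=> v; rewrite grigE.
Qed.

End Grigorchuk.

Theorem theorem3 (R : realType) :
  (exists (f : {multiplicative Gtilde -> dil (Q2 R)})
          (g : {multiplicative Gtilde -> aut adjT3}),
    [/\ injective f,
        forall x, corresponds (f x) (g x),
        vertex_transitive (range g),
        scale_group (closure (range g))
      & two_transitive_on (closure (range g)) punctured_boundary])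
  /\
  (exists (f : {multiplicative Btilde -> dil (Q2 R)})
          (g : {multiplicative Btilde -> aut adjT3}),
    [/\ injective f,
        forall x, corresponds (f x) (g x),
        vertex_transitive (range g),
        scale_group (closure (range g))
      & two_transitive_on (closure (range g)) punctured_boundary]).
Proof. by split; [exact: grigorchuk_embedding|exact: basilica_embedding]. Qed.
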